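(* Let $n\geq2$ and let $(M^n,\bar g)$ be a Riemannian manifold with scalar curvature $R_{\bar g}\leq0$. Let $\Omega\subsetneq M$ be any compactly contained domain with smooth boundary, and let $g\in[\bar g]$ be any metric on $\Omega$ (smooth up to the boundary) with $g=\bar g$ on $\partial\Omega$. (I) If $R_g\geq R_{\bar g}$ on $\Omega$, then $m_{BY}(\partial\Omega,\bar g;g)\geq0$. (II) If $R_g\leq R_{\bar g}$ on $\Omega$, then $m_{BY}(\partial\Omega,\bar g;g)\leq0$. In either case, equality holds if and only if $g=\bar g$ on $\Omega$. In particular, $g=\bar g$ is the unique solution of the problem $$R_g=R_{\bar g},\qquad g\in[\bar g],\qquad \mathrm{supp}(g-\bar g)\subset\Omega.$$
   Context: All metrics are smooth; manifolds are connected. A domain is a connected open set; it is compactly contained if its closure is compact in $M$. $[\bar g]$ is the conformal class of $\bar g$, i.e. all metrics $e^{2f}\bar g$ with $f$ smooth. $R_g$ is the scalar curvature of $g$. Brown–York mass relative to $\bar g$: for a compact manifold $\overline\Omega$ with smooth boundary $\partial\Omega$ and $g\in[\bar g]$ on $\overline\Omega$ with $g=\bar g$ on $\partial\Omega$, $$m_{BY}(\partial\Omega,\bar g;g)=\int_{\partial\Omega}(H_{\bar g}-H_g)\,d\sigma_{\bar g},$$ where $H_{\bar g}$, $H_g$ are the mean curvatures of $\partial\Omega$ with respect to the outward normals for $\bar g$ and $g$ respectively (the sign convention is the one in which the boundary of a Euclidean ball has positive mean curvature; mean curvature is the trace of the second fundamental form). *)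

(* Defs.v *)
From HB Require Import structures.
From mathcomp Require Import all_boot all_order all_algebra.
From mathcomp Require Import finmap.
From mathcomp Require Import all_classical all_reals all_analysis.

Set Implicit Arguments.
Unset Strict Implicit.
Unset Printing Implicit Defensive.

Import Order.TTheory GRing.Theory Num.Theory.
Import numFieldNormedType.Exports.

Local Open Scope classical_set_scope.
Local Open Scope ring_scope.

Definition boundary (T : topologicalType) (A : set T) : set T :=
  closure A `\` interior A.

Section EuclideanSpace.
Context {R : realType} {n : nat}.
Implicit Types (U : set 'rV[R]_n) (f : 'rV[R]_n -> R).

Definition partial (i : 'I_n) f : 'rV[R]_n -> R :=
  fun x => 'D_(delta_mx ord0 i) f x.

Definition iter_partial (s : seq 'I_n) f : 'rV[R]_n -> R := foldr partial f s.

(* C^oo on an open set U.  Differentiability of all iterated partial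
   derivatives makes them all continuous. *)
Definition smooth_on U f :=
  forall (s : seq 'I_n) x, U x -> differentiable (iter_partial s f) x.

End EuclideanSpace.

(* Integral of a nonnegative Borel function on R^n for n-dimensional Lebesgue
   measure, as an iterated one-dimensional Lebesgue integral (Tonelli). *)
Fixpoint Rn_integral (R : realType) (n : nat) :
    ('rV[R]_n -> \bar R) -> \bar R :=
  match n with
  | 0 => fun F => F 0
  | m.+1 => fun F =>
    (\int[@lebesgue_measure R]_t
       Rn_integral (fun y : 'rV[R]_m => F (row_mx (t%:M : 'rV[R]_1) y)))%E
  end.

(* A local coordinate system; the values of cmap outside cdom and of cinv
   outside cmap @` cdom are irrelevant. *)
Record chart (R : realType) (d : nat) (M : Type) := Chart {
  cdom : set M;
  cmap : M -> 'rV[R]_d;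
  cinv : 'rV[R]_d -> M }.

HB.instance Definition _ R d M := gen_eqMixin (chart R d M).
HB.instance Definition _ R d M := gen_choiceMixin (chart R d M).

Record is_chart (R : realType) (d : nat) (M : topologicalType)
    (c : chart R d M) : Prop := {
  chart_open_dom : open (cdom c);
  chart_open_img : open (cmap c @` cdom c);
  chart_mapK : forall p, cdom c p -> cinv c (cmap c p) = p;
  chart_map_cts : {within cdom c, continuous (cmap c)};
  chart_inv_cts : {within cmap c @` cdom c, continuous (cinv c)} }.

Definition smooth_transition (R : realType) (d : nat) (M : Type)
    (c e : chart R d M) :=
  forall k : 'I_d, smooth_on (cmap c @` (cdom c `&` cdom e))
                             (fun x => cmap e (cinv c x) ord0 k).

(* Connected smooth manifold without boundary, of dimension d; the smooth
   structure is a maximal atlas. *)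
Record manifold (R : realType) (d : nat) := Manifold {
  carrier :> topologicalType;
  atlas : set (chart R d carrier);
  manifold_hausdorff : hausdorff_space carrier;
  manifold_second_countable : @second_countable carrier;
  manifold_connected : connected [set: carrier];
  atlas_chart : forall c, atlas c -> is_chart c;
  atlas_cover : forall p, exists c, atlas c /\ cdom c p;
  atlas_smooth : forall c e, atlas c -> atlas e -> smooth_transition c e;
  atlas_maximal : forall c, is_chart c ->
    (forall e, atlas e -> smooth_transition c e /\ smooth_transition e c) ->
    atlas c }.

Arguments atlas {R d} M : rename.

Section Metrics.
Context {R : realType} {d : nat} {M : manifold R d}.

Definition smooth_fun (W : set M) (f : M -> R) :=
  forall c, atlas M c -> smooth_on (cmap c @` (cdom c `&` W)) (f \o cinv c).

(* g c p is the matrix of components at p, in the chart c, of a (0,2)-tensor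
   field g; it is irrelevant unless c is in the atlas and p in cdom c. *)
Definition tensor2 := chart R d M -> M -> 'M[R]_d.

Definition in_chart (g : tensor2) (c : chart R d M) : 'rV[R]_d -> 'M[R]_d :=
  fun x => g c (cinv c x).

(* g is a smooth Riemannian metric on the open set V.  Vectors are rows, so
   lin1_mx of a differential is the transpose of the usual Jacobian matrix. *)
Record is_metric (V : set M) (g : tensor2) : Prop := {
  metric_smooth : forall c, atlas M c -> forall i j,
    smooth_on (cmap c @` (cdom c `&` V)) (fun x => in_chart g c x i j);
  metric_sym : forall c p, atlas M c -> cdom c p -> V p -> (g c p)^T = g c p;
  metric_pos : forall c p, atlas M c -> cdom c p -> V p ->
    forall v : 'rV[R]_d, v != 0 -> 0 < (v *m g c p *m v^T) ord0 ord0;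
  metric_transition : forall c e p, atlas M c -> atlas M e ->
    cdom c p -> cdom e p -> V p ->
    let J := lin1_mx ('d (cmap e \o cinv c) (cmap c p)) in
    g c p = J *m g e p *m J^T }.

Definition eq_at (g h : tensor2) (p : M) :=
  forall c, atlas M c -> cdom c p -> g c p = h c p.

Definition eq_on (A : set M) (g h : tensor2) := forall p, A p -> eq_at g h p.

Definition tensor_supp (g h : tensor2) : set M :=
  closure [set p | ~ eq_at g h p].

(* g = e^(2f) h on A, with f smooth on A, that is, the restriction to A of a
   smooth function on an open set containing A. *)
Definition conformal_on (A : set M) (h g : tensor2) :=
  exists (W : set M) (f : M -> R),
    [/\ open W, A `<=` W, smooth_fun W f &
        forall p, A p -> forall c, atlas M c -> cdom c p ->
          g c p = expR (2 * f p) *: h c p].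

Definition chart_at (p : M) : chart R d M := projT1 (cid (atlas_cover p)).

Lemma chart_atP (p : M) : atlas M (chart_at p) /\ cdom (chart_at p) p.
Proof. exact: projT2 (cid (atlas_cover p)). Qed.

End Metrics.

Arguments tensor2 {R d} M.

Section LocalCurvature.
Context {R : realType} {d : nat}.
Variable G : 'rV[R]_d -> 'M[R]_d.

(* The connection coefficient Gamma^k_ij. *)
Definition christoffel (k i j : 'I_d) : 'rV[R]_d -> R := fun x =>
  2^-1 * \sum_l invmx (G x) k l *
    (partial i (fun y => G y j l) x + partial j (fun y => G y i l) x
     - partial l (fun y => G y i j) x).

(* Ric_jk, positive on round spheres. *)
Definition ricci (j k : 'I_d) : 'rV[R]_d -> R := fun x =>
  \sum_i (partial i (christoffel i j k) x - partial j (christoffel i i k) x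
    + \sum_m (christoffel i i m x * christoffel m j k x
              - christoffel i j m x * christoffel m i k x)).

Definition scalar : 'rV[R]_d -> R := fun x =>
  \sum_j \sum_k invmx (G x) j k * ricci j k x.

End LocalCurvature.

Definition scalar_curvature (R : realType) (d : nat) (M : manifold R d)
    (g : tensor2 M) (p : M) : R :=
  scalar (in_chart g (chart_at p)) (cmap (chart_at p) p).

(* Extrinsic geometry of the hypersurface x_0 = 0, oriented by increasing x_0;
   the coordinate fields along it are those of index lift ord0 a. *)
Section LocalHypersurface.
Context {R : realType} {n : nat}.
Variables (G : 'rV[R]_n.+1 -> 'M[R]_n.+1) (x : 'rV[R]_n.+1).

Definition induced_metric : 'M[R]_n :=
  \matrix_(a, b) G x (lift ord0 a) (lift ord0 b).

(* The unit normal: grad x_0 / |grad x_0|. *)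
Definition unit_normal : 'rV[R]_n.+1 :=
  \row_k (invmx (G x) k ord0 / Num.sqrt (invmx (G x) ord0 ord0)).

(* II(X, Y) = g(nabla_X nu, Y) = - g(nabla_X Y, nu) for X, Y tangent. *)
Definition second_fundamental_form : 'M[R]_n :=
  \matrix_(a, b) - \sum_k \sum_l
    christoffel G k (lift ord0 a) (lift ord0 b) x * G x k l
      * unit_normal ord0 l.

Definition local_mean_curvature : R :=
  \tr (invmx induced_metric *m second_fundamental_form).

Definition area_density : R := Num.sqrt (\det induced_metric).

End LocalHypersurface.

Section Boundary.
Context {R : realType} {n : nat} {M : manifold R n.+1}.
Variable Omega : set M.

(* Omega is x_0 < 0 in the chart c; hence its boundary is x_0 = 0 there, and
   the outward normal points towards increasing x_0. *)
Definition adapted_chart (c : chart R n.+1 M) :=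
  atlas M c /\
  forall p, cdom c p -> (Omega p <-> cmap c p ord0 ord0 < 0).

Definition smooth_boundary :=
  forall p, boundary Omega p -> exists c, adapted_chart c /\ cdom c p.

Definition adapted_at (p : M) : chart R n.+1 M :=
  xget (chart_at p) [set c | adapted_chart c /\ cdom c p].

Definition mean_curvature (g : tensor2 M) (p : M) : R :=
  local_mean_curvature (in_chart g (adapted_at p)) (cmap (adapted_at p) p).

Definition covering (s : seq (chart R n.+1 M)) :=
  (forall c, c \in s -> adapted_chart c) /\
  forall p, boundary Omega p -> exists2 c, c \in s & cdom c p.

Definition boundary_charts : seq (chart R n.+1 M) := xget [::] covering.

(* Integral of phi over the part of A in the domain of the adapted chart c,
   A being a part of the boundary. *)
Definition patch_integral (g : tensor2 M) (phi : M -> \bar R)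
    (c : chart R n.+1 M) (A : set M) : \bar R :=
  let pt (y : 'rV[R]_n) : 'rV[R]_n.+1 := row_mx (0 : 'rV[R]_1) y in
  Rn_integral
    ((fun y => phi (cinv c (pt y)) * (area_density (in_chart g c) (pt y))%:E)%E
     \_ [set y | (cmap c @` (cdom c `&` A)) (pt y)]).

Fixpoint patch_sum (g : tensor2 M) (phi : M -> \bar R)
    (s : seq (chart R n.+1 M)) (A : set M) : \bar R :=
  match s with
  | [::] => 0%E
  | c :: s' =>
    (patch_integral g phi c A + patch_sum g phi s' (A `\` cdom c))%E
  end.

(* Integral over the boundary for the area measure of g: the boundary is cut
   into finitely many disjoint Borel pieces, each in an adapted chart. *)
Definition boundary_integral (g : tensor2 M) (phi : M -> R) : \bar R :=
  let I psi := patch_sum g psi boundary_charts (boundary Omega) in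
  (I ((EFin \o phi)^\+) - I ((EFin \o phi)^\-))%E.

Definition brown_york_mass (gbar g : tensor2 M) : \bar R :=
  boundary_integral gbar (fun p => mean_curvature gbar p - mean_curvature g p).

Lemma adapted_atP (p : M) : smooth_boundary -> boundary Omega p ->
  adapted_chart (adapted_at p) /\ cdom (adapted_at p) p.
Proof.
by move=> sO /sO exc; exact: (xgetPex _ exc).
Qed.

Lemma boundary_chartsP : smooth_boundary -> compact (closure Omega) ->
  covering boundary_charts.
Proof.
move=> sO cO; apply: xgetPex.
have [B0|/existsNP[p0 _]] := pselect (forall p, ~ boundary Omega p).
  by exists [::]; split => // p /B0.
pose pt := isPointed.Build (carrier M) p0.
pose T : ptopologicalType := HB.pack (carrier M) pt.
have cB : @compact T (boundary Omega).
  apply: (@subclosed_compact M _ (closure Omega)) => [||p []//]; last by [].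
  rewrite /boundary setDE; apply: closedI; first exact: closed_closure.
  exact/open_closedC/open_interior.
rewrite compact_cover in cB.
have [||D DO cov] := cB (chart R n.+1 M) adapted_chart (@cdom R n.+1 M).
- by move=> c [/atlas_chart/chart_open_dom].
- by move=> p /sO[c [ac cp]]; exists c.
exists (enum_fset D); split => [c cD|p /cov[c cD cp]]; last by exists c.
by have /set_mem := DO _ cD.
Qed.

End Boundary.

(* Main.v *)
(* Write g = e^(2f) gbar, with f = 0 on the boundary, and let N be the
   dimension.  The conformal change of the scalar curvature reads
     e^(2f) R_g = Rbar - 2(N-1) gbar^ij d_i d_j f + (first order terms in f),
   so u = s f, with s = 1 in case (I) and s = -1 in case (II), satisfies a
   linear elliptic inequality L u <= s (1 - e^(2su)) Rbar.  Since Rbar <= 0, the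
   right-hand side is nonpositive where u <= 0, and at most c u with c >= 0
   locally bounded where u >= 0.  The strong maximum principle then gives
   u >= 0, and either u = 0 or u > 0 on Omega; in the latter case the outward
   normal derivative of u is negative at every boundary point by Hopf's lemma.
   As f = 0 on the boundary, Hbar - H_g = -(N-1) d_nu f = s (N-1) |grad f|, whose
   sign settles the mass and the case of equality.  In the uniqueness problem
   f vanishes off the support, so that both cases apply to f.
   The local boundedness of c requires the scalar curvature, which is computed
   in arbitrarily chosen charts, to be independent of the chart; this is the
   gauge transformation law of the curvature of the connection matrices. *)

Require Import Defs.
From mathcomp Require Import all_boot all_order all_algebra.
From mathcomp Require Import all_classical all_reals all_analysis.
From mathcomp Require Import ring lra.

Set Implicit Arguments.
Unset Strict Implicit.
Unset Printing Implicit Defensive.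

Import Order.TTheory GRing.Theory Num.Theory.
Import numFieldNormedType.Exports.

Local Open Scope classical_set_scope.
Local Open Scope ring_scope.

(** * Differential calculus on R^d *)

(** The coefficients of the first order terms depend on f, because the law for the scalar curvature
    contains the square of its gradient; they are frozen as smooth functions of the point, which
    turns a quasilinear equation into a linear one. Nonnegativity of u has to precede the dichotomy,
    since the bound by c u holds only where u >= 0: at a negative minimum the principle is applied
    to u - min u with c = 0 instead. Hopf's lemma acts at boundary points, so the coefficients must
    be regular on a neighbourhood W of the closure, while g = e^(2f) gbar is known on the closure
    only; one-sided derivatives bridge this gap. Interior balls are explicit because the boundary is
    flat in an adapted chart. Mean curvature is defined through a chart chosen separately at each
    boundary point, so its continuity is not visible; |grad f|, computable in any chart, supplies a
    continuous integrand, and a positive lower bound on one small box makes the integral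
    positive. *)

Lemma near_eq_differentiable {K : numFieldType} {V W : normedModType K}
    (f g : V -> W) (x : V) :
  (\near x, f x = g x) -> differentiable f x -> differentiable g x.
Proof.
move=> fg df.
have fgx : f x = g x by exact: nbhs_singleton fg.
have dg : g \o shift x = cst (g x) + 'd f x +o_ 0 id.
  apply/eqaddoP => e e0.
  have /eqaddoP/(_ e e0) := diff_locally df.
  have fg0 : \forall y \near (0 : V), f (y + x) = g (y + x).
    move: fg; rewrite (near_shift 0)/=; apply: filterS => y.
    by rewrite /= subr0.
  apply: filterS2 fg0 => y + .
  by rewrite !fctE /= -fgx => ->.
apply/diff_locallyP.
have E := diff_unique (diff_continuous df) dg.
split; first by rewrite E; exact: diff_continuous.
by rewrite E.
Unshelve. all: by end_near. Qed.

Section PartialCalculus.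
Context {R : realType} {d : nat}.
Implicit Types (U : set 'rV[R]_d) (f g : 'rV[R]_d -> R) (x : 'rV[R]_d).

Lemma partialE i f x :
  differentiable f x -> partial i f x = 'd f x (delta_mx ord0 i).
Proof. exact: deriveE. Qed.

Lemma derive_sum_partial f x v : differentiable f x ->
  'D_v f x = \sum_i v ord0 i * partial i f x.
Proof.
move=> df; rewrite deriveE// {1}[v]row_sum_delta linear_sum.
by apply: eq_bigr => i _; rewrite linearZ partialE.
Qed.

Lemma eq_partial i f g x : (\near x, f x = g x) ->
  partial i f x = partial i g x.
Proof. exact: near_eq_derive. Qed.

Lemma partialD i f g x : differentiable f x -> differentiable g x ->
  partial i (fun y => f y + g y) x = partial i f x + partial i g x.
Proof. by move=> df dg; apply: deriveD; exact: diff_derivable. Qed.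

Lemma partialN i f x : differentiable f x ->
  partial i (fun y => - f y) x = - partial i f x.
Proof. by move=> df; apply: deriveN; exact: diff_derivable. Qed.

Lemma partialB i f g x : differentiable f x -> differentiable g x ->
  partial i (fun y => f y - g y) x = partial i f x - partial i g x.
Proof. by move=> df dg; apply: deriveB; exact: diff_derivable. Qed.

Lemma partialM i f g x : differentiable f x -> differentiable g x ->
  partial i (fun y => f y * g y) x = partial i f x * g x + f x * partial i g x.
Proof.
move=> df dg; rewrite /partial (@deriveM _ _ f g) //; try exact: diff_derivable.
by rewrite addrC; congr (_ + _); exact: mulrC.
Qed.

Lemma partial_cst i (c : R) x : partial i (fun=> c) x = 0.
Proof. exact: derive_cst. Qed.

Lemma partial_sum i (I : Type) (r : seq I) (F : I -> 'rV[R]_d -> R) x :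
  (forall k, differentiable (F k) x) ->
  partial i (fun y => \sum_(k <- r) F k y) x = \sum_(k <- r) partial i (F k) x.
Proof.
move=> dF; elim: r => [|k r IH].
  by rewrite big_nil -[RHS](partial_cst i 0 x); congr partial; apply/funext=> y; rewrite big_nil.
rewrite big_cons -IH -partialD//.
  by congr partial; apply/funext=> y; rewrite big_cons.
elim: r {IH} => [|l r IH].
  by under eq_fun do rewrite big_nil; exact: differentiable_cst.
by under eq_fun do rewrite big_cons; exact: differentiableD.
Qed.

Lemma differentiable_bigsum (I : Type) (r : seq I) (F : I -> 'rV[R]_d -> R) x :
  (forall k, differentiable (F k) x) ->
  differentiable (fun y => \sum_(k <- r) F k y) x.
Proof.
move=> dF; elim: r => [|l r IH].
  by under eq_fun do rewrite big_nil; exact: differentiable_cst.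
by under eq_fun do rewrite big_cons; exact: differentiableD.
Qed.

Lemma partial_coord i j x : partial i (fun y => y ord0 j) x = (i == j)%:R.
Proof.
have := @derive_mx _ _ _ _ id x (delta_mx ord0 i) (@derivable_id _ _ _ _).
by rewrite derive_id => /(congr1 (fun M : 'rV[R]_d => M ord0 j)); rewrite !mxE eqxx eq_sym.
Qed.

Lemma partial_comp1 i (h : R -> R) (dh : R) f x : differentiable f x ->
  is_derive (f x) 1 h dh ->
  partial i (fun y => h (f y)) x = dh * partial i f x.
Proof.
move=> df [dhx <-].
have dh' : differentiable h (f x) by exact/derivable1_diffP.
rewrite partialE; last exact: (@differentiable_comp _ _ _ _ f h).
rewrite (@diff_comp _ _ _ _ f h)//= -partialE// deriveE//.
by rewrite -[in LHS](mulr1 (partial i f x)) -[_ * 1]/(_ *: 1) linearZ/= mulrC.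
Qed.

Lemma differentiable_comp1 (h : R -> R) (dh : R) f x : differentiable f x ->
  is_derive (f x) 1 h dh -> differentiable (fun y => h (f y)) x.
Proof.
by move=> df [dhx _]; apply: (@differentiable_comp _ _ _ _ f h) => //; exact/derivable1_diffP.
Qed.

End PartialCalculus.

(** * Chain rule and Jacobian matrices *)

Section ChainRule.
Context {R : realType} {m d : nat}.
Variables (tau : 'rV[R]_m -> 'rV[R]_d) (x : 'rV[R]_m).
Hypothesis dtau : forall k, differentiable (fun y => tau y ord0 k) x.

Lemma differentiable_row : differentiable tau x.
Proof.
have -> : tau = fun y => \sum_k tau y ord0 k *: (delta_mx ord0 k : 'rV[R]_d).
  by apply/funext => y; rewrite -row_sum_delta.
elim: (index_enum _) => [|k r IH].
  by under eq_fun do rewrite big_nil; exact: differentiable_cst.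
under eq_fun do rewrite big_cons.
by apply: (@differentiableD _ _ _ (fun y => tau y ord0 k *: _)) => //; exact: differentiableZl.
Qed.

Lemma jacobianE i k :
  lin1_mx ('d tau x) i k = partial i (fun y => tau y ord0 k) x.
Proof.
rewrite /partial mxE -deriveE; last exact: differentiable_row.
by rewrite derive_mx ?mxE//; apply: diff_derivable; exact: differentiable_row.
Qed.

Lemma partial_comp i f : differentiable f (tau x) ->
  partial i (fun y => f (tau y)) x =
  \sum_k partial i (fun y => tau y ord0 k) x * partial k f (tau x).
Proof.
move=> df; rewrite partialE; last first.
  by apply: (@differentiable_comp _ _ _ _ tau f) => //; exact: differentiable_row.
rewrite (@diff_comp _ _ _ _ tau f)//=; last exact: differentiable_row.
rewrite -deriveE// derive_sum_partial//; apply: eq_bigr => k _.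
by rewrite -jacobianE [in RHS]mxE.
Qed.

End ChainRule.

(** * Closure properties of smooth functions *)

Section Smooth.
Context {R : realType} {d : nat}.
Variable U : set 'rV[R]_d.
Implicit Types (f g : 'rV[R]_d -> R) (x : 'rV[R]_d).
Hypothesis oU : open U.

Lemma open_near (P : set 'rV[R]_d) x : (forall y, U y -> P y) -> U x ->
  \forall y \near x, P y.
Proof. by move=> UP Ux; apply: filterS UP _; exact: open_nbhs_nbhs. Qed.

Lemma smooth_differentiable f x : smooth_on U f -> U x -> differentiable f x.
Proof. by move=> /(_ [::]); apply. Qed.

Lemma iter_partial_rcons s i f :
  iter_partial (rcons s i) f = iter_partial s (partial i f).
Proof. by rewrite /iter_partial foldr_rcons. Qed.

Lemma smooth_partial f i : smooth_on U f -> smooth_on U (partial i f).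
Proof. by move=> sf s x Ux; rewrite -iter_partial_rcons; exact: sf. Qed.

Lemma eq_on_iter_partial s f g : (forall x, U x -> f x = g x) ->
  forall x, U x -> iter_partial s f x = iter_partial s g x.
Proof.
move=> fg; elim: s => //= i s IH x Ux.
by apply: eq_partial; exact: open_near.
Qed.

Lemma eq_smooth f g : (forall x, U x -> f x = g x) ->
  smooth_on U f -> smooth_on U g.
Proof.
move=> fg sf s x Ux; apply: near_eq_differentiable (sf s x Ux).
by apply: open_near Ux => y Uy; exact: eq_on_iter_partial.
Qed.

(* The algebra generated by the smooth functions is stable under partial
   derivatives, hence consists of smooth functions. *)
Inductive elementary : ('rV[R]_d -> R) -> Prop :=
| elementary_smooth f : smooth_on U f -> elementary f
| elementary_add f g : elementary f -> elementary g ->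
    elementary (fun x => f x + g x)
| elementary_mul f g : elementary f -> elementary g ->
    elementary (fun x => f x * g x)
| elementary_inv f : (forall x, U x -> f x != 0) -> elementary f ->
    elementary (fun x => (f x)^-1)
| elementary_exp f : elementary f -> elementary (fun x => expR (f x)).

Lemma smooth_cst (c : R) : smooth_on U (fun=> c).
Proof.
move=> s x _; have [c' ->] : exists c', iter_partial s (fun=> c) = fun=> c' :> R.
  elim: s => [|i s [c' /= ->]]; first by exists c.
  by exists 0; apply/funext => y; exact: partial_cst.
exact: differentiable_cst.
Qed.

Lemma is_derive_invr (y : R) : y != 0 -> is_derive y 1 (@GRing.inv R) (- y ^- 2).
Proof.
move=> y0; split; first exact/derivable1_diffP/differentiable_Rinv.
rewrite deriveE; last exact: differentiable_Rinv.
by rewrite diff_Rinv//; exact: mulr1.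
Qed.

Lemma elementary_differentiable f : elementary f ->
  forall x, U x -> differentiable f x.
Proof.
elim => {f} [f sf|f g _ df _ dg|f g _ df _ dg|f f0 _ df|f _ df] x Ux.
- exact: smooth_differentiable.
- exact: differentiableD (df x Ux) (dg x Ux).
- exact: differentiableM (df x Ux) (dg x Ux).
- exact: differentiableV (df x Ux) (f0 x Ux).
- exact: differentiable_comp1 (df x Ux) _.
Qed.

Lemma elementary_partial f : elementary f -> forall i,
  exists2 g, elementary g & forall x, U x -> partial i f x = g x.
Proof.
elim => {f} [f sf|f g ef df eg dg|f g ef df eg dg|f f0 ef df|f ef df] i.
- by exists (partial i f) => //; apply: elementary_smooth; exact: smooth_partial.
- have [[f' ef' E] [g' eg' E']] := (df i, dg i).
  exists (fun x => f' x + g' x); first exact: elementary_add.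
  by move=> x Ux; rewrite partialD ?E ?E'//; exact: elementary_differentiable.
- have [[f' ef' E] [g' eg' E']] := (df i, dg i).
  exists (fun x => f' x * g x + f x * g' x).
    by apply: elementary_add; exact: elementary_mul.
  by move=> x Ux; rewrite partialM ?E ?E'//; exact: elementary_differentiable.
- have [f' ef' E] := df i.
  exists (fun x => (-1) * ((f x)^-1 * (f x)^-1) * f' x).
    apply: elementary_mul => //; apply: (@elementary_mul (fun=> -1)).
      by apply: elementary_smooth; exact: smooth_cst.
    by apply: elementary_mul; exact: elementary_inv.
  move=> x Ux; rewrite (partial_comp1 _ (elementary_differentiable ef Ux) (is_derive_invr (f0 x Ux))).
  by rewrite E// mulN1r -invfM.
- have [f' ef' E] := df i.
  exists (fun x => expR (f x) * f' x).
    by apply: elementary_mul => //; exact: elementary_exp.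
  move=> x Ux; rewrite (partial_comp1 _ (elementary_differentiable ef Ux) (is_derive_expR _)).
  by rewrite E.
Qed.

(** A partial derivative of an elementary function is elementary only up to equality on U. Since U
    is open, such an equality can be differentiated again, so the induction replaces each iterated
    derivative by an elementary function that agrees with it on U. *)
Lemma elementary_is_smooth f : elementary f -> smooth_on U f.
Proof.
move=> ef s; have [g eg E] : exists2 g, elementary g &
    forall x, U x -> g x = iter_partial s f x.
  elim: s => [|i s [g eg E]]; first by exists f.
  have [h eh Eh] := elementary_partial eg i.
  exists h => // x Ux; rewrite -Eh//=; apply: eq_partial.
  by apply: open_near Ux.
move=> x Ux; apply: near_eq_differentiable (elementary_differentiable eg Ux).
exact: open_near Ux.
Qed.

Lemma smoothD f g : smooth_on U f -> smooth_on U g ->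
  smooth_on U (fun x => f x + g x).
Proof.
by move=> sf sg; apply/elementary_is_smooth/elementary_add; exact: elementary_smooth.
Qed.

Lemma smoothM f g : smooth_on U f -> smooth_on U g ->
  smooth_on U (fun x => f x * g x).
Proof.
by move=> sf sg; apply/elementary_is_smooth/elementary_mul; exact: elementary_smooth.
Qed.

Lemma smoothV f : (forall x, U x -> f x != 0) -> smooth_on U f ->
  smooth_on U (fun x => (f x)^-1).
Proof.
by move=> f0 sf; apply/elementary_is_smooth/elementary_inv => //; exact: elementary_smooth.
Qed.

Lemma smooth_expR f : smooth_on U f -> smooth_on U (fun x => expR (f x)).
Proof.
by move=> sf; apply/elementary_is_smooth/elementary_exp; exact: elementary_smooth.
Qed.

Lemma smoothN f : smooth_on U f -> smooth_on U (fun x => - f x).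
Proof.
move=> sf; apply: eq_smooth (smoothM (smooth_cst (-1)) sf) => x _.
by rewrite mulN1r.
Qed.

Lemma smoothB f g : smooth_on U f -> smooth_on U g ->
  smooth_on U (fun x => f x - g x).
Proof. by move=> sf sg; apply: smoothD => //; exact: smoothN. Qed.

Lemma smooth_bigsum (I : Type) (r : seq I) (F : I -> 'rV[R]_d -> R) :
  (forall k, smooth_on U (F k)) -> smooth_on U (fun y => \sum_(k <- r) F k y).
Proof.
move=> sF; elim: r => [|k r IH].
  by under eq_fun do rewrite big_nil; exact: smooth_cst.
by under eq_fun do rewrite big_cons; exact: smoothD.
Qed.

Lemma smooth_bigprod (I : Type) (r : seq I) (F : I -> 'rV[R]_d -> R) :
  (forall k, smooth_on U (F k)) -> smooth_on U (fun y => \prod_(k <- r) F k y).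
Proof.
move=> sF; elim: r => [|k r IH].
  by under eq_fun do rewrite big_nil; exact: smooth_cst.
by under eq_fun do rewrite big_cons; exact: smoothM.
Qed.

Lemma smooth_coord j : smooth_on U (fun x => x ord0 j).
Proof.
move=> s; elim/last_ind: s => [|s i _] x Ux; first exact: differentiable_coord.
rewrite iter_partial_rcons (_ : partial i _ = fun=> (i == j)%:R).
  exact: (smooth_cst _ s).
by apply/funext => y; exact: partial_coord.
Qed.

Lemma smooth_det k (A : 'rV[R]_d -> 'M[R]_k) :
  (forall i j, smooth_on U (fun x => A x i j)) ->
  smooth_on U (fun x => \det (A x)).
Proof.
move=> sA; rewrite /determinant; apply: smooth_bigsum => s.
by apply: smoothM; [exact: smooth_cst|exact: smooth_bigprod].
Qed.

(** Cramer's rule: each entry is a cofactor divided by the determinant, which does not vanish on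
    U. *)
Lemma smooth_invmx k (A : 'rV[R]_d -> 'M[R]_k) :
  (forall i j, smooth_on U (fun x => A x i j)) ->
  (forall x, U x -> A x \in unitmx) ->
  forall i j, smooth_on U (fun x => invmx (A x) i j).
Proof.
move=> sA uA i j.
apply: (@eq_smooth (fun x => (\det (A x))^-1 * ((-1) ^+ (j + i) * \det (row' j (col' i (A x)))))).
  by move=> x Ux; rewrite /invmx uA// !mxE.
apply: smoothM; first by apply: smoothV (smooth_det sA) => x /uA; rewrite unitmxE unitfE.
apply: smoothM; first exact: smooth_cst.
by apply: smooth_det => a b; under eq_fun do rewrite !mxE; exact: sA.
Qed.

Lemma smooth_continuous f x : smooth_on U f -> U x -> {for x, continuous f}.
Proof. by move=> sf Ux; apply/differentiable_continuous/smooth_differentiable. Qed.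

End Smooth.

Lemma smooth_onS {R : realType} {d : nat} (U V : set 'rV[R]_d) f :
  V `<=` U -> smooth_on U f -> smooth_on V f.
Proof. by move=> VU sf s x /VU; exact: sf. Qed.

(** * Calculus along segments: mean values, mixed derivatives, extrema *)

Section Lines.
Context {R : realType} {V : normedModType R}.
Implicit Types (f : V -> R) (x v w : V) (U : set V).

Lemma is_derive_line f x v (t : R) : differentiable f (x + t *: v) ->
  is_derive t 1 (fun s : R => f (x + s *: v)) ('D_v f (x + t *: v)).
Proof.
move=> df.
have dl : is_diff t (fun s : R => x + s *: v) (fun s => s *: v).
  by apply: is_diff_eq; rewrite add0r.
have dl' : differentiable (fun s : R => x + s *: v) t by exact: ex_diff.
have dc : differentiable (fun s : R => f (x + s *: v)) t.
  exact: (differentiable_comp dl').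
split; first exact/derivable1_diffP.
rewrite deriveE// (diff_comp dl')//= diff_val scale1r.
by rewrite deriveE.
Qed.

Lemma continuous_line f x v (a b : R) :
  (forall t, a <= t <= b -> differentiable f (x + t *: v)) ->
  {within `[a, b], continuous (fun s : R => f (x + s *: v))}.
Proof.
move=> df; apply: derivable_within_continuous => t.
by rewrite in_itv/= => /df /is_derive_line[].
Qed.

Lemma MVT_line f x v (h : R) : 0 < h ->
  (forall t, 0 <= t <= h -> differentiable f (x + t *: v)) ->
  exists2 t, 0 < t < h & f (x + h *: v) - f x = h * 'D_v f (x + t *: v).
Proof.
move=> h0 df.
have dl t : t \in `]0, h[ ->
    is_derive t 1 (fun s : R => f (x + s *: v)) ('D_v f (x + t *: v)).
  rewrite in_itv/= => /andP[t0 th]; apply: is_derive_line.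
  by apply: df; rewrite !ltW.
have [t] := MVT h0 dl (continuous_line df).
rewrite in_itv/= => th; rewrite scale0r addr0 subr0 mulrC => E.
by exists t.
Qed.

Lemma nbhs_line (P : set V) x v w : nbhs x P ->
  exists2 h : R, 0 < h &
    forall s t, `|s| <= h -> `|t| <= h -> P (x + s *: v + t *: w).
Proof.
move=> /nbhs_normP[r /= r0 Pr].
(* The summand 1 keeps the denominator positive when both vectors vanish and makes the final
   inequality strict. *)
have k0 : 0 < 1 + `|v| + `|w| by rewrite -addrA ltr_pwDl// addr_ge0.
exists (r / (1 + `|v| + `|w|)); first by rewrite divr_gt0.
move=> s t sr tr; apply: Pr => /=.
rewrite -addrA opprD addNKr normrN.
apply: le_lt_trans (ler_normD _ _) _; rewrite !normrZ.
apply: (@le_lt_trans _ _ (r / (1 + `|v| + `|w|) * (`|v| + `|w|))).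
  by rewrite mulrDr lerD// ler_wpM2r.
rewrite mulrAC ltr_pdivrMr// ltr_pM2l//; lra.
Qed.

(** The mean value theorem is applied along [v] to the increment [f (y + h *: w) - f y], then along
    [w] to ['D_v f]. *)
Lemma second_difference f x v w (h : R) : 0 < h ->
  (forall s t, 0 <= s <= h -> 0 <= t <= h ->
     differentiable f (x + s *: v + t *: w) /\
     differentiable ('D_v f) (x + s *: v + t *: w)) ->
  exists s t, [/\ 0 < s < h, 0 < t < h &
    (f (x + h *: v + h *: w) - f (x + h *: v)) - (f (x + h *: w) - f x) =
    h * (h * 'D_w ('D_v f) (x + s *: v + t *: w))].
Proof.
move=> h0 df.
have hh : 0 <= h <= h by rewrite ltW//=.
have dl (s : R) : 0 <= s <= h ->
    differentiable (fun y => f (y + h *: w) - f y) (x + s *: v).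
  move=> sh; apply: differentiableB.
    apply: (@differentiable_comp _ _ _ _ (fun y => y + h *: w) f).
      by apply: differentiableD => //; exact: differentiable_cst.
    by have [] := df _ _ sh hh.
  by have [] := df s 0 sh; rewrite ?lexx ?ltW// scale0r addr0.
have [s sh E] := MVT_line h0 dl.
have sh' : 0 <= s <= h by case/andP: sh => *; rewrite !ltW.
have dl2 (t : R) : 0 <= t <= h ->
    differentiable ('D_v f) (x + s *: v + t *: w).
  by move=> th; have [] := df _ _ sh' th.
have [t th E2] := MVT_line h0 dl2.
exists s, t; split => //; rewrite E -E2; congr (_ * _).
have ds : is_diff (x + s *: v) (fun y : V => y + h *: w) id.
  by apply: is_diff_eq; rewrite addr0.
have df1 : differentiable f (x + s *: v + h *: w) by have [] := df _ _ sh' hh.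
have df2 : differentiable f (x + s *: v).
  by have [] := df s 0 sh'; rewrite ?lexx ?ltW// scale0r addr0.
have dc : differentiable (fun y => f (y + h *: w)) (x + s *: v).
  by apply: (@differentiable_comp _ _ _ _ (fun y => y + h *: w) f).
rewrite deriveB; try exact: diff_derivable.
congr (_ - _); rewrite deriveE// (@diff_comp _ _ _ _ (fun y => y + h *: w) f)//.
by rewrite /= diff_val deriveE.
Qed.

(* The second derivatives are named p and q to keep them folded. *)
Lemma derive_comm f (p q : V -> R) x v w U : open U -> U x ->
  (forall y, U y -> differentiable f y) ->
  (forall y, U y -> differentiable ('D_v f) y) ->
  (forall y, U y -> differentiable ('D_w f) y) ->
  'D_w ('D_v f) =1 p -> 'D_v ('D_w f) =1 q ->
  {for x, continuous p} -> {for x, continuous q} -> p x = q x.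
Proof.
move=> oU Ux df dvf dwf pE qE cwv cvw; apply/eqP/negPn/negP => ne.
have e0 : 0 < `|p x - q x| / 2 by rewrite divr_gt0// normr_gt0 subr_eq0.
have /cvgrPdist_lt /(_ _ e0) nA := cwv.
have /cvgrPdist_lt /(_ _ e0) nB := cvw.
have nU : nbhs x U by exact: open_nbhs_nbhs.
have [h h0 H] := nbhs_line v w (filterI nU (filterI nA nB)).
have Hp s t : 0 <= s <= h -> 0 <= t <= h ->
    [/\ U (x + s *: v + t *: w),
        `|p x - p (x + s *: v + t *: w)| < `|p x - q x| / 2 &
        `|q x - q (x + s *: v + t *: w)| < `|p x - q x| / 2].
  move=> /andP[s0 sh] /andP[t0 th].
  have s1 : `|s| <= h by rewrite ger0_norm.
  have t1 : `|t| <= h by rewrite ger0_norm.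
  by have [c1 [c2 c3]] := H s t s1 t1; exact: (And3 c1 c2 c3).
have [s [t [sh th E]]] : exists s t, [/\ 0 < s < h, 0 < t < h &
    (f (x + h *: v + h *: w) - f (x + h *: v)) - (f (x + h *: w) - f x) =
    h * (h * p (x + s *: v + t *: w))].
  have [|s [t [sh th]]] := @second_difference f x v w h h0; last first.
    by rewrite pE => E; exists s, t.
  move=> s t sh th;
  by have [Uy _ _] := Hp s t sh th; split; [exact: df|exact: dvf].
have [s' [t' [sh' th' E']]] : exists s t, [/\ 0 < s < h, 0 < t < h &
    (f (x + h *: w + h *: v) - f (x + h *: w)) - (f (x + h *: v) - f x) =
    h * (h * q (x + s *: w + t *: v))].
  have [|s' [t' [sh' th']]] := @second_difference f x w v h h0; last first.
    by rewrite qE => E'; exists s', t'.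
  move=> s' t' sh' th'; rewrite addrAC.
  by have [Uy _ _] := Hp t' s' th' sh'; split; [exact: df|exact: dwf].
have [||_ P1 _] := Hp s t; try (by case/andP: sh; case/andP: th => *; rewrite !ltW).
have [||_ _ P2] := Hp t' s'; try (by case/andP: sh'; case/andP: th' => *; rewrite !ltW).
rewrite addrAC in P2.
(* The second difference is symmetric in [v] and [w], so both mean values coincide. This common
   value is closer than half of [|p x - q x|] to [p x] and to [q x], which contradicts the triangle
   inequality. *)
have EE : p (x + s *: v + t *: w) = q (x + s' *: w + t' *: v).
  apply: (mulfI (lt0r_neq0 h0)); apply: (mulfI (lt0r_neq0 h0)); rewrite -E -E'.
  by rewrite (addrAC x); ring.
rewrite EE in P1.
have := ler_distD (q (x + s' *: w + t' *: v)) (p x) (q x).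
rewrite leNgt => /negP; apply.
rewrite [X in _ < X](splitr (`|p x - q x|)); apply: ltrD; first exact: P1.
by rewrite distrC; exact: P2.
Qed.

Lemma derive_at_local_min f x v U : open U -> U x ->
  (forall y, U y -> differentiable f y) -> (forall y, U y -> f x <= f y) ->
  'D_v f x = 0.
Proof.
move=> oU Ux df fmin.
have [h h0 H] := nbhs_line v 0 (open_nbhs_nbhs (conj oU Ux)).
have Hs s : -h < s < h -> U (x + s *: v).
  move=> sh; have := H s 0; rewrite scale0r addr0 normr0; apply; last exact: ltW.
  by rewrite ler_norml; case/andP: sh => *; rewrite !ltW.
have Hh : - h <= h by lra.
have := @derive1_at_min R (fun s => f (x + s *: v)) (- h) h 0 Hh.
case.
- by move=> t; rewrite in_itv/= => /Hs /df /is_derive_line[].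
- by rewrite in_itv/=; apply/andP; split; lra.
- move=> t; rewrite in_itv/= => /Hs /fmin.
  by rewrite scale0r addr0.
move=> _; have := @is_derive_line f x v 0.
by rewrite scale0r addr0 => /(_ (df x Ux)) [_ ->].
Qed.

(** Were the second derivative negative, the first derivative, which vanishes at [x], would be
    negative at all small positive times along [v], and [f] would drop below [f x] by the mean value
    theorem. *)
Lemma derive2_at_local_min f x v U : open U -> U x ->
  (forall y, U y -> differentiable f y) -> differentiable ('D_v f) x ->
  (forall y, U y -> f x <= f y) -> 0 <= 'D_v ('D_v f) x.
Proof.
move=> oU Ux df dvf fmin; rewrite leNgt; apply/negP => L0.
have D0 := derive_at_local_min v oU Ux df fmin.
set L := 'D_v ('D_v f) x in L0.
have cv : h^-1 *: ('D_v f (h *: v + x) - 'D_v f x) @[h --> 0^'] --> L.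
  exact: (@diff_derivable _ _ _ ('D_v f) x v dvf).
have [h h0 H] := nbhs_line v 0 (open_nbhs_nbhs (conj oU Ux)).
have /cvgrPdist_lt/(_ (- L)) := cv; rewrite oppr_gt0 => /(_ L0).
rewrite near_withinE => /nbhs_normP[r /= r0 Hr].
pose k := Num.min h (r / 2).
have k0 : 0 < k by rewrite lt_min h0 divr_gt0.
have kh : k <= h by rewrite ge_min lexx.
have kr : k < r by rewrite (@le_lt_trans _ _ (r / 2))// ?ge_min ?lexx ?orbT// ltr_pdivrMr//; lra.
have Hs s : 0 <= s <= k -> U (x + s *: v).
  move=> /andP[s0 sk]; have := H s 0; rewrite scale0r addr0 normr0; apply; last exact: ltW.
  by rewrite ger0_norm// (le_trans sk).
have [t /andP[t0 tk] E] := MVT_line k0 (fun t tk => df _ (Hs t tk)).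
have := fmin _ (Hs k _); rewrite lexx ltW// => /(_ isT).
rewrite -subr_ge0 E pmulr_rge0// leNgt => /negP; apply.
have := Hr t; rewrite /= sub0r normrN gtr0_norm// => /(_ (lt_trans tk kr) (lt0r_neq0 t0)).
rewrite D0 subr0 (addrC (t *: v)) ltr_distl => /andP[W _].
have {}W : t^-1 * 'D_v f (x + t *: v) < 0 by move: W; rewrite opprK gtrDr.
by move: W; rewrite pmulr_rlt0// invr_gt0.
Qed.

(** Only points on one side of [x] are compared, which is all that is available at a boundary
    point. *)
Lemma derive_ge0_right f x v (h : R) : 0 < h -> differentiable f x ->
  (forall t, 0 < t < h -> f x <= f (x + t *: v)) -> 0 <= 'D_v f x.
Proof.
move=> h0 df fmin; rewrite leNgt; apply/negP => L0.
have cv : t^-1 *: (f (t *: v + x) - f x) @[t --> 0^'] --> 'D_v f x.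
  exact: (@diff_derivable _ _ _ f x v df).
have /cvgrPdist_lt/(_ (- 'D_v f x)) := cv; rewrite oppr_gt0 => /(_ L0).
rewrite near_withinE => /nbhs_normP[r /= r0 Hr].
pose t := Num.min h r / 2.
have m0 : 0 < Num.min h r by rewrite lt_min h0.
have t0 : 0 < t by rewrite divr_gt0.
have tm : t < Num.min h r by rewrite ltr_pdivrMr//; lra.
have [th tr] : t < h /\ t < r by move: tm; rewrite lt_min => /andP[].
have := Hr t; rewrite /= sub0r normrN gtr0_norm// => /(_ tr (lt0r_neq0 t0)).
rewrite (addrC (t *: v)) ltr_distl => /andP[W _].
have {}W : t^-1 * (f (x + t *: v) - f x) < 0 by move: W; rewrite opprK gtrDr.
by move: W; rewrite pmulr_rlt0 ?invr_gt0// subr_lt0 ltNge fmin// t0.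
Qed.

End Lines.

(** * Positive definite matrices *)

Section PositiveDefinite.
Context {R : realType}.

Definition posdef n (A : 'M[R]_n) :=
  A^T = A /\ forall v : 'rV[R]_n, v != 0 -> 0 < (v *m A *m v^T) ord0 ord0.

Lemma posdef_unit n (A : 'M[R]_n) : posdef A -> A \in unitmx.
Proof.
move=> [_ pA]; rewrite -row_free_unit -kermx_eq0; apply/eqP/row_matrixP => i.
rewrite row0; apply/eqP/negPn/negP => /pA.
by rewrite -row_mul mulmx_ker row0 mul0mx mxE ltxx.
Qed.

Lemma invmx_congruence n (J A : 'M[R]_n) : J \in unitmx -> A \in unitmx ->
  invmx (J *m A *m J^T) = (invmx J)^T *m invmx A *m invmx J.
Proof.
move=> uJ uA; have uJT : J^T \in unitmx by rewrite unitmx_tr.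
have uG : J *m A *m J^T \in unitmx by rewrite !unitmx_mul uJ uA.
rewrite -[RHS](mulKmx uG).
suff -> : J *m A *m J^T *m ((invmx J)^T *m invmx A *m invmx J) = 1%:M by rewrite mulmx1.
by rewrite trmx_inv !mulmxA mulmxK// mulmxK// mulmxV.
Qed.

(** The value of the inverse form at [v] is the value of [A] at [v *m invmx A]. *)
Lemma posdef_inv n (A : 'M[R]_n) : posdef A -> posdef (invmx A).
Proof.
move=> pA; have uA := posdef_unit pA; case: pA => sA pA.
split=> [|v v0]; first by rewrite trmx_inv sA.
have vA0 : v *m invmx A != 0.
  apply: contra_neq v0 => /(congr1 (fun w => w *m A)).
  by rewrite mulmxKV// mul0mx.
by have := pA _ vA0; rewrite trmx_mul trmx_inv sA mulmxKV// mulmxA.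
Qed.

Lemma posdef_diag n (A : 'M[R]_n) i : posdef A -> 0 < A i i.
Proof.
move=> [_ /(_ (delta_mx ord0 i))]; rewrite -rowE trmx_delta -colE !mxE; apply.
by apply/eqP => /matrixP/(_ ord0 i)/eqP; rewrite !mxE !eqxx oner_eq0.
Qed.

Lemma quad_formE n (A : 'M[R]_n) (v : 'rV[R]_n) :
  (v *m A *m v^T) ord0 ord0 = \sum_i \sum_j A i j * (v ord0 i * v ord0 j).
Proof.
rewrite mxE exchange_big/=; apply: eq_bigr => j _; rewrite !mxE mulr_suml.
by apply: eq_bigr => i _; ring.
Qed.

(* S is the Schur complement of the first diagonal entry a. *)
Lemma posdef_block n (A : 'M[R]_(1 + n)) : posdef A ->
  exists a b S, [/\ 0 < a, posdef S &
    A = block_mx a%:M b b^T (S + a^-1 *: (b^T *m b))].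
Proof.
move=> pA.
have a0 : 0 < ulsubmx A ord0 ord0.
  by rewrite !mxE; exact: posdef_diag.
set a := ulsubmx A ord0 ord0 in a0.
set b := ursubmx A; set C := drsubmx A.
have [sA posA] := pA.
have ulE : ulsubmx A = a%:M by apply/matrixP => i j; rewrite !ord1 [in RHS]mxE eqxx.
have dlE : dlsubmx A = b^T by rewrite -[in LHS]sA -trmx_ursub.
have AE : A = block_mx a%:M b b^T C by rewrite -[LHS]submxK ulE dlE.
have sC : C^T = C by rewrite trmx_drsub sA.
exists a, b, (C - a^-1 *: (b^T *m b)); split; last by rewrite subrK.
  by [].
split; first by rewrite linearB/= linearZ/= trmx_mul trmxK sC.
move=> w w0; pose v := row_mx (- a^-1 *: (w *m b^T)) w : 'rV_(1 + n).
have v0 : v != 0 by rewrite row_mx_eq0 negb_and w0 orbT.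
have := posA v v0; rewrite AE mul_row_block tr_row_mx mul_row_col.
suff -> : - a^-1 *: (w *m b^T) *m a%:M + w *m b^T = 0.
  rewrite mul0mx add0r mulmxBr mulmxBl -scalemxAl -scalemxAr -!scalemxAl !mulmxA.
  by rewrite mulmxDl -scalemxAl scaleNr addrC.
by rewrite mul_mx_scalar scalerA mulrN mulfV ?lt0r_neq0// scaleN1r addNr.
Qed.

(** One step of Gaussian elimination factors [A] into a unipotent lower triangular block matrix and
    an upper triangular one with diagonal blocks [a] and the Schur complement [S]. *)
Lemma posdef_det n (A : 'M[R]_n) : posdef A -> 0 < \det A.
Proof.
elim: n A => [|n IH] A; first by rewrite det_mx00.
move: A; change n.+1 with (1 + n)%N => A /posdef_block[a [b [S [a0 /IH S0 ->]]]].
have -> : block_mx a%:M b b^T (S + a^-1 *: (b^T *m b)) =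
    block_mx 1%:M 0 (a^-1 *: b^T) 1%:M *m block_mx a%:M b 0 S.
  rewrite mulmx_block !mul1mx !mul0mx !addr0 mul_mx_scalar scalerA.
  by rewrite mulfV ?lt0r_neq0// scale1r -scalemxAl addrC.
by rewrite det_mulmx det_lblock det_ublock !det1 det_scalar1 !mul1r mulr_gt0.
Qed.

(* Induction on the dimension: splitting off the first row u of A leaves
   A = u^T u / a + (0 0; 0 S). *)
Lemma posdef_trace_ge0 n (A D : 'M[R]_n) : posdef A ->
  (forall v : 'rV[R]_n, 0 <= (v *m D *m v^T) ord0 ord0) ->
  0 <= \tr (A *m D^T).
Proof.
elim: n A D => [|n IH] A D pA pD; first by rewrite /mxtrace big_ord0.
move: A D pA pD; change n.+1 with (1 + n)%N => A D.
move=> /posdef_block[a [b [S [a0 pS ->]]]] pD.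
pose u := row_mx a%:M b : 'rV_(1 + n).
have -> : block_mx a%:M b b^T (S + a^-1 *: (b^T *m b)) =
    a^-1 *: (u^T *m u) + block_mx 0 0 0 S.
  rewrite /u tr_row_mx mul_col_row tr_scalar_mx scale_block_mx add_block_mx !addr0.
  rewrite -scalar_mxM mul_scalar_mx mul_mx_scalar !scalerA mulVf ?lt0r_neq0// !scale1r.
  by rewrite scale_scalar_mx mulKf ?lt0r_neq0// addrC.
rewrite mulmxDl mxtraceD addr_ge0//.
  rewrite -scalemxAl mxtraceZ mulr_ge0 ?invr_ge0 ?(ltW a0)//.
  rewrite -mulmxA mxtrace_mulC -[X in \tr X]trmxK trmx_mul trmxK mxtrace_tr.
  by rewrite trmx_mul trmxK mulmxA /mxtrace big_ord1; exact: pD.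
rewrite -[D]submxK tr_block_mx mulmx_block !mul0mx !add0r.
rewrite mxtrace_block mxtrace0 add0r.
apply: IH => // w.
have := pD (row_mx 0 w); rewrite -[D in X in X -> _]submxK mul_row_block tr_row_mx mul_row_col.
by rewrite !mul0mx !add0r trmx0 mulmx0 add0r.
Qed.

Lemma posdef_sum_ge0 n (A D : 'M[R]_n) : posdef A ->
  (forall v : 'rV[R]_n, 0 <= (v *m D *m v^T) ord0 ord0) ->
  0 <= \sum_i \sum_j A i j * D i j.
Proof.
move=> pA pD; have := posdef_trace_ge0 pA pD; rewrite /mxtrace.
congr (0 <= _); apply: eq_bigr => i _; rewrite mxE.
by apply: eq_bigr => j _; rewrite mxE.
Qed.

End PositiveDefinite.

(** * Curvature in coordinates *)

Lemma partial_comm {R : realType} {d : nat} (U : set 'rV[R]_d) f i j x :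
  open U -> smooth_on U f -> U x ->
  partial i (partial j f) x = partial j (partial i f) x.
Proof.
move=> oU sf Ux.
apply: (@derive_comm _ _ f (partial i (partial j f)) (partial j (partial i f))
  x (delta_mx ord0 j) (delta_mx ord0 i) U) => //.
- by move=> y Uy; exact: smooth_differentiable sf Uy.
- by move=> y Uy; exact: smooth_differentiable (smooth_partial j sf) Uy.
- by move=> y Uy; exact: smooth_differentiable (smooth_partial i sf) Uy.
- exact: smooth_continuous (smooth_partial i (smooth_partial j sf)) Ux.
- exact: smooth_continuous (smooth_partial j (smooth_partial i sf)) Ux.
Qed.

Fact seal : unit. Proof. exact: tt. Qed.

(* A sealed copy of [partial]: comparing [partial i f] with [partial j f] by
   unfolding would run into the construction of limits. *)
Definition pd {R : realType} {d : nat} := locked_with seal (@partial R d).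

Section SealedPartial.
Context {R : realType} {d : nat}.
Implicit Types (U : set 'rV[R]_d) (f g : 'rV[R]_d -> R) (x : 'rV[R]_d).

Lemma pdE : @pd R d = @partial R d. Proof. exact: unlock. Qed.

Lemma pd_comm U f i j x : open U -> smooth_on U f -> U x ->
  pd i (pd j f) x = pd j (pd i f) x.
Proof. by rewrite pdE; exact: partial_comm. Qed.

Lemma eq_pd i f g x : (\near x, f x = g x) -> pd i f x = pd i g x.
Proof. by rewrite pdE; exact: eq_partial. Qed.

Lemma pdD i f g x : differentiable f x -> differentiable g x ->
  pd i (fun y => f y + g y) x = pd i f x + pd i g x.
Proof. by rewrite pdE; exact: partialD. Qed.

Lemma pdB i f g x : differentiable f x -> differentiable g x ->
  pd i (fun y => f y - g y) x = pd i f x - pd i g x.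
Proof. by rewrite pdE; exact: partialB. Qed.

Lemma pdM i f g x : differentiable f x -> differentiable g x ->
  pd i (fun y => f y * g y) x = pd i f x * g x + f x * pd i g x.
Proof. by rewrite pdE; exact: partialM. Qed.

Lemma pd_cst i (k : R) x : pd i (fun=> k) x = 0.
Proof. by rewrite pdE partial_cst. Qed.

Lemma pdZ i (k : R) f x : differentiable f x ->
  pd i (fun y => k * f y) x = k * pd i f x.
Proof.
move=> df; rewrite (@pdM i (fun=> k))//.
by rewrite pd_cst mul0r add0r.
Qed.

Lemma pd_sum i (I : Type) (r : seq I) (F : I -> 'rV[R]_d -> R) x :
  (forall k, differentiable (F k) x) ->
  pd i (fun y => \sum_(k <- r) F k y) x = \sum_(k <- r) pd i (F k) x.
Proof. by rewrite pdE; exact: partial_sum. Qed.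

Lemma smooth_pd U f i : smooth_on U f -> smooth_on U (pd i f).
Proof. by rewrite pdE; exact: smooth_partial. Qed.

End SealedPartial.

Section MatrixEntries.
Context {R : comPzRingType}.

Lemma addmxE m n (A B : 'M[R]_(m, n)) i j : (A + B) i j = A i j + B i j.
Proof. by rewrite mxE. Qed.

Lemma submxE m n (A B : 'M[R]_(m, n)) i j : (A - B) i j = A i j - B i j.
Proof. by rewrite !mxE. Qed.

Lemma oppmxE m n (A : 'M[R]_(m, n)) i j : (- A) i j = - A i j.
Proof. by rewrite mxE. Qed.

Lemma scalemxE m n a (A : 'M[R]_(m, n)) i j : (a *: A) i j = a * A i j.
Proof. by rewrite mxE. Qed.

Lemma mulmxE m n p (A : 'M[R]_(m, n)) (B : 'M[R]_(n, p)) i k :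
  (A *m B) i k = \sum_j A i j * B j k.
Proof. by rewrite mxE. Qed.

Lemma trmxE m n (A : 'M[R]_(m, n)) i j : A^T i j = A j i.
Proof. by rewrite mxE. Qed.

End MatrixEntries.

(** * Entrywise derivatives of matrix-valued functions *)

Section MatrixDerivative.
Context {R : realType} {d : nat}.
Variable x : 'rV[R]_d.

Definition mx_partial {m n} := locked_with seal
  (fun i (A : 'rV[R]_d -> 'M[R]_(m, n)) y =>
     \matrix_(j, k) pd i (fun z => A z j k) y : 'M[R]_(m, n)).

Lemma mx_partialE {m n} i (A : 'rV[R]_d -> 'M[R]_(m, n)) y j k :
  mx_partial i A y j k = pd i (fun z => A z j k) y.
Proof. by rewrite /mx_partial unlock mxE. Qed.

Definition mx_differentiable {m n} (A : 'rV[R]_d -> 'M[R]_(m, n)) :=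
  forall j k, differentiable (fun z => A z j k) x.

Lemma mx_differentiableM m n p (A : 'rV[R]_d -> 'M[R]_(m, n)) (B : 'rV[R]_d -> 'M[R]_(n, p)) :
  mx_differentiable A -> mx_differentiable B ->
  mx_differentiable (fun y => A y *m B y).
Proof.
move=> dA dB j k; under eq_fun do rewrite mxE.
by apply: differentiable_bigsum => l; apply: differentiableM.
Qed.

Lemma mx_partialM m n p i (A : 'rV[R]_d -> 'M[R]_(m, n)) (B : 'rV[R]_d -> 'M[R]_(n, p)) :
  mx_differentiable A -> mx_differentiable B ->
  mx_partial i (fun y => A y *m B y) x =
  mx_partial i A x *m B x + A x *m mx_partial i B x.
Proof.
move=> dA dB; apply/matrixP => j k.
rewrite mx_partialE addmxE !mulmxE -big_split/=.
under eq_fun do rewrite mulmxE.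
rewrite pd_sum; last by move=> l; apply: differentiableM.
by apply: eq_bigr => l _; rewrite pdM// !mx_partialE.
Qed.

Lemma mx_partialD m n i (A B : 'rV[R]_d -> 'M[R]_(m, n)) :
  mx_differentiable A -> mx_differentiable B ->
  mx_partial i (fun y => A y + B y) x = mx_partial i A x + mx_partial i B x.
Proof.
move=> dA dB; apply/matrixP => j k; rewrite addmxE !mx_partialE.
by under eq_fun do rewrite addmxE; exact: pdD.
Qed.

Lemma mx_partial_tr m n i (A : 'rV[R]_d -> 'M[R]_(m, n)) :
  mx_partial i (fun y => (A y)^T) x = (mx_partial i A x)^T.
Proof.
apply/matrixP => j k; rewrite trmxE !mx_partialE.
by under eq_fun do rewrite trmxE.
Qed.

Lemma eq_mx_partial m n i (A B : 'rV[R]_d -> 'M[R]_(m, n)) :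
  (\near x, A x = B x) -> mx_partial i A x = mx_partial i B x.
Proof.
move=> AB; apply/matrixP => j k; rewrite !mx_partialE; apply: eq_pd.
by apply: filterS AB => y ->.
Qed.

End MatrixDerivative.

Definition mx_smooth {R : realType} {d m n} (U : set 'rV[R]_d)
    (A : 'rV[R]_d -> 'M[R]_(m, n)) :=
  forall j k, smooth_on U (fun y => A y j k).

Lemma mx_smooth_differentiable {R : realType} {d m n} (U : set 'rV[R]_d)
    (A : 'rV[R]_d -> 'M[R]_(m, n)) x :
  mx_smooth U A -> U x -> mx_differentiable x A.
Proof. by move=> sA Ux j k; exact: smooth_differentiable (sA j k) Ux. Qed.

(* Row j of [connection G i] holds the components of nabla_i e_j. *)
Definition connection {R : realType} {d} := locked_with seal
  (fun (G : 'rV[R]_d -> 'M[R]_d) i x => \matrix_(j, k) christoffel G k i j x).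

(** Row m holds the components of the commutator of nabla_i and nabla_j applied to e_m. As the
    connection matrices act on rows, nabla_i nabla_j contributes the product with the matrix of j on
    the left. *)
Definition curvature {R : realType} {d} (G : 'rV[R]_d -> 'M[R]_d) i j x : 'M[R]_d :=
  mx_partial i (connection G j) x - mx_partial j (connection G i) x
  + (connection G j x *m connection G i x - connection G i x *m connection G j x).

Definition ricci_mx {R : realType} {d} (G : 'rV[R]_d -> 'M[R]_d) x : 'M[R]_d :=
  \matrix_(j, k) ricci G j k x.

Lemma connectionE {R : realType} {d} (G : 'rV[R]_d -> 'M[R]_d) i j k x :
  connection G i x j k = christoffel G k i j x.
Proof. by rewrite /connection unlock mxE. Qed.

Lemma christoffelE {R : realType} {d} (G : 'rV[R]_d -> 'M[R]_d) k i j x :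
  christoffel G k i j x = 2^-1 * \sum_l invmx (G x) k l *
    (pd i (fun y => G y j l) x + pd j (fun y => G y i l) x
     - pd l (fun y => G y i j) x).
Proof. by rewrite pdE. Qed.

(** This is the trace of X -> R(X, e_j) e_k. It reduces the transformation law of the Ricci tensor
    to that of the curvature matrices. *)
Lemma ricci_curvature {R : realType} {d} (G : 'rV[R]_d -> 'M[R]_d) j k x :
  ricci G j k x = \sum_i curvature G i j x k i.
Proof.
rewrite /ricci -pdE; apply: eq_bigr => i _.
rewrite /curvature addmxE 2!submxE !mulmxE sumrB !mx_partialE.
congr (_ - _ + (_ - _)).
- by under [in RHS]eq_fun do rewrite connectionE.
- by under [in RHS]eq_fun do rewrite connectionE.
- by apply: eq_bigr => m _; rewrite !connectionE mulrC.
- by apply: eq_bigr => m _; rewrite !connectionE mulrC.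
Qed.

Lemma ricci_mxE {R : realType} {d} (G : 'rV[R]_d -> 'M[R]_d) j k x :
  ricci_mx G x j k = ricci G j k x.
Proof. by rewrite mxE. Qed.

Lemma scalar_trace {R : realType} {d} (G : 'rV[R]_d -> 'M[R]_d) x :
  Defs.scalar G x = \tr (invmx (G x) *m (ricci_mx G x)^T).
Proof.
by apply: eq_bigr => j _; rewrite mxE; apply: eq_bigr => k _; rewrite !mxE.
Qed.

(** Koszul's formula as linear algebra. After lowering an index, [P i = C i *m G] is symmetric in
    its first two indices, and each [dG] is a sum of two values of [P]; the alternating sum isolates
    twice one of them. A connection can then be identified by checking compatibility and symmetry,
    without transforming Christoffel symbols. *)
Lemma levi_civita_unique {R : realType} {d} (G : 'M[R]_d) (dG C : 'I_d -> 'M[R]_d) :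
  G \in unitmx -> G^T = G ->
  (forall i, dG i = C i *m G + (C i *m G)^T) ->
  (forall i j k, C i j k = C j i k) ->
  forall i j k, C i j k =
    2^-1 * \sum_l invmx G k l * (dG i j l + dG j i l - dG l i j).
Proof.
move=> uG sG dGE sC i j k.
pose P i := C i *m G.
have sP a b l : P a b l = P b a l.
  by rewrite !mxE; apply: eq_bigr => m _; rewrite sC.
have E a b l : dG a b l = P a b l + P a l b by rewrite dGE mxE [X in _ + X]mxE.
transitivity ((P i *m invmx G) j k); first by rewrite mulmxK.
have sGi : (invmx G)^T = invmx G by rewrite trmx_inv sG.
rewrite mulr_sumr mxE; apply: eq_bigr => l _.
have -> : invmx G l k = invmx G k l by rewrite -[in LHS]sGi trmxE.
by rewrite !E (sP l i j) (sP l j i) (sP j i l); field.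
Qed.

(** * The Levi-Civita connection of a metric on an open set *)

Section MetricOnOpenSet.
Context {R : realType} {d : nat}.
Variables (U : set 'rV[R]_d) (G : 'rV[R]_d -> 'M[R]_d).
Hypotheses (oU : open U) (sG : mx_smooth U G) (pG : forall x, U x -> posdef (G x)).

Lemma metric_pd_sym l i j x : U x ->
  pd l (fun y => G y i j) x = pd l (fun y => G y j i) x.
Proof.
move=> Ux; apply: eq_pd; apply: (open_near oU) Ux => y /pG[sGy _].
by rewrite -[in LHS]sGy trmxE.
Qed.

Lemma smooth_inv_metric i j : smooth_on U (fun x => invmx (G x) i j).
Proof. by apply: smooth_invmx => // x Ux; apply/posdef_unit/pG. Qed.

Lemma smooth_christoffel k i j : smooth_on U (christoffel G k i j).
Proof.
rewrite /christoffel -pdE; apply: smoothM => //; first exact: smooth_cst.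
apply: smooth_bigsum => // l; apply: smoothM => //; first exact: smooth_inv_metric.
by apply: smoothB => //; [apply: smoothD => //|]; exact: smooth_pd.
Qed.

Lemma smooth_connection i : mx_smooth U (connection G i).
Proof.
by move=> j k; under eq_fun do rewrite connectionE; exact: smooth_christoffel.
Qed.

Lemma smooth_ricci j k : smooth_on U (ricci G j k).
Proof.
rewrite /ricci -pdE; apply: smooth_bigsum => // i; apply: smoothD => //.
  by apply: smoothB => //; apply: smooth_pd; exact: smooth_christoffel.
apply: smooth_bigsum => // m.
by apply: smoothB => //; apply: smoothM => //; exact: smooth_christoffel.
Qed.

Lemma smooth_scalar : smooth_on U (Defs.scalar G).
Proof.
apply: smooth_bigsum => // j; apply: smooth_bigsum => // k.
by apply: smoothM => //; [exact: smooth_inv_metric|exact: smooth_ricci].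
Qed.

Lemma connection_sym i j k x : U x -> connection G i x j k = connection G j x i k.
Proof.
move=> Ux; rewrite !connectionE !christoffelE; congr (_ * _); apply: eq_bigr => l _.
by rewrite (metric_pd_sym l i j Ux) [X in X - _]addrC.
Qed.

(** These are the Christoffel symbols of the first kind. *)
Lemma connection_lower i j m x : U x ->
  (connection G i x *m G x) j m =
  2^-1 * (pd i (fun y => G y j m) x + pd j (fun y => G y i m) x
          - pd m (fun y => G y i j) x).
Proof.
move=> Ux; have /pG pGx := Ux; have uG := posdef_unit pGx.
pose T l := pd i (fun y => G y j l) x + pd j (fun y => G y i l) x
          - pd l (fun y => G y i j) x.
transitivity (2^-1 * ((\row_l T l) *m (invmx (G x))^T *m G x) ord0 m).
  rewrite !mulmxE mulr_sumr; apply: eq_bigr => k _; rewrite connectionE mulmxE mulrA.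
  congr (_ * _); rewrite christoffelE; congr (_ * _); apply: eq_bigr => l _.
  by rewrite trmxE mxE mulrC.
by rewrite trmx_inv pGx.1 mulmxKV// mxE.
Qed.

Lemma metric_compat i x : U x ->
  mx_partial i G x = connection G i x *m G x + (connection G i x *m G x)^T.
Proof.
move=> Ux; apply/matrixP => j m.
rewrite addmxE trmxE !connection_lower// mx_partialE.
by rewrite (metric_pd_sym i m j Ux); field.
Qed.

End MetricOnOpenSet.

(** * Change of coordinates *)

Section ChangeOfVariables.
Context {R : realType} {d : nat}.
Variables (U W : set 'rV[R]_d) (G H : 'rV[R]_d -> 'M[R]_d) (tau : 'rV[R]_d -> 'rV[R]_d).
Hypotheses (oU : open U) (oW : open W).
Hypotheses (sH : mx_smooth W H).
Hypotheses (pG : forall x, U x -> posdef (G x)) (pH : forall x, W x -> posdef (H x)).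
Hypothesis stau : forall k, smooth_on U (fun x => tau x ord0 k).
Hypothesis tauUW : forall x, U x -> W (tau x).

Definition jac := locked_with seal
  (fun x => \matrix_(i, k) pd i (fun y => tau y ord0 k) x : 'M[R]_d).

Lemma jacE x i k : jac x i k = pd i (fun y => tau y ord0 k) x.
Proof. by rewrite /jac unlock mxE. Qed.

Hypothesis GH : forall x, U x -> G x = jac x *m H (tau x) *m (jac x)^T.

Lemma smooth_jac : mx_smooth U jac.
Proof.
by move=> i k; under eq_fun do rewrite jacE; exact: smooth_pd.
Qed.

(** Invertibility of the Jacobian is read off [G = J H J^T], whose left-hand side is invertible. *)
Lemma jac_unit x : U x -> jac x \in unitmx.
Proof.
move=> Ux; have := posdef_unit (pG Ux).
by rewrite GH// !unitmx_mul => /andP[/andP[]].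
Qed.

Lemma mx_differentiable_comp m n (A : 'rV[R]_d -> 'M[R]_(m, n)) x :
  mx_smooth W A -> U x -> mx_differentiable x (fun y => A (tau y)).
Proof.
move=> sA Ux j k.
apply: (@differentiable_comp _ _ _ _ tau (fun y => A y j k)).
  by apply: differentiable_row => l; exact: smooth_differentiable (stau l) Ux.
exact: smooth_differentiable (sA j k) (tauUW Ux).
Qed.

Lemma mx_partial_comp m n i (A : 'rV[R]_d -> 'M[R]_(m, n)) x :
  mx_smooth W A -> U x ->
  mx_partial i (fun y => A (tau y)) x =
  \sum_b jac x i b *: mx_partial b A (tau x).
Proof.
move=> sA Ux; apply/matrixP => j k; rewrite mx_partialE summxE.
rewrite pdE (@partial_comp _ _ _ tau x _ i (fun y => A y j k)).
- by apply: eq_bigr => b _; rewrite scalemxE jacE mx_partialE pdE.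
- by move=> l; exact: smooth_differentiable (stau l) Ux.
- exact: smooth_differentiable (sA j k) (tauUW Ux).
Qed.

(** The pulled-back connection form, still expressed in the frame of the target coordinates. Passing
    to the frame of the source coordinates adds the inhomogeneous gauge term
    [mx_partial i jac x]. *)
Definition pullback_connection i x : 'M[R]_d :=
  \sum_b jac x i b *: connection H b (tau x).

Lemma mx_partial_jac_sym i j k x : U x ->
  mx_partial i jac x j k = mx_partial j jac x i k.
Proof.
move=> Ux; rewrite !mx_partialE.
under eq_fun do rewrite jacE; under [in RHS]eq_fun do rewrite jacE.
exact: pd_comm oU (stau k) Ux.
Qed.

Lemma mx_differentiable_jac x : U x -> mx_differentiable x jac.
Proof. exact: mx_smooth_differentiable smooth_jac. Qed.

(** With J for [jac x], the product C H J^T equals (C J^-1) G, so this is the metric compatibility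
    of the candidate connection C J^-1. It comes from differentiating J H J^T and using the
    compatibility of the connection of [H]. *)
Lemma mx_partial_metric i x : U x ->
  let C := mx_partial i jac x + jac x *m pullback_connection i x in
  mx_partial i G x =
  C *m H (tau x) *m (jac x)^T + (C *m H (tau x) *m (jac x)^T)^T.
Proof.
move=> Ux C.
have dJ := mx_differentiable_jac Ux.
have dJT : mx_differentiable x (fun y => (jac y)^T).
  by move=> j k; under eq_fun do rewrite trmxE; exact: dJ.
have dHt := mx_differentiable_comp sH Ux.
rewrite (@eq_mx_partial _ _ _ _ _ i G (fun y => jac y *m H (tau y) *m (jac y)^T)); last first.
  by apply: (open_near oU) Ux => y; exact: GH.
rewrite (mx_partialM i (mx_differentiableM dJ dHt) dJT) mx_partialM// mx_partial_tr mx_partial_comp//.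
have -> : \sum_b jac x i b *: mx_partial b H (tau x) =
    pullback_connection i x *m H (tau x) + (pullback_connection i x *m H (tau x))^T.
  rewrite /pullback_connection mulmx_suml linear_sum/= -big_split/=.
  apply: eq_bigr => b _.
  rewrite (metric_compat oW pH b (tauUW Ux)) scalerDr -scalemxAl; congr (_ + _).
  by rewrite linearZ.
have [sHt _] := pH (tauUW Ux).
have -> : (C *m H (tau x) *m (jac x)^T)^T =
    jac x *m H (tau x) *m (mx_partial i jac x)^T
    + jac x *m H (tau x) *m (pullback_connection i x)^T *m (jac x)^T.
  by rewrite !trmx_mul trmxK sHt /C linearD/= trmx_mul mulmxDr mulmxDr !mulmxA.
rewrite trmx_mul sHt /C !(mulmxDl, mulmxDr) !mulmxA -!addrA.
by congr (_ + (_ + _)); exact: addrC.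
Qed.

(** The gauge law A_i J = d_i J + J B_i. The candidate (d_i J + J B_i) J^-1 is compatible with [G]
    by [mx_partial_metric], and symmetric because second derivatives of [tau] commute and the
    connection of [H] is symmetric; uniqueness of the Levi-Civita connection concludes. *)
Lemma connection_change i x : U x ->
  connection G i x *m jac x = mx_partial i jac x + jac x *m pullback_connection i x.
Proof.
move=> Ux.
pose C a := (mx_partial a jac x + jac x *m pullback_connection a x) *m invmx (jac x).
suff -> : connection G i x = C i by rewrite mulmxKV// jac_unit.
have uG := posdef_unit (pG Ux).
have [sGx _] := pG Ux.
have := @levi_civita_unique _ _ (G x) (fun a => mx_partial a G x) C uG sGx.
move=> LC; apply/matrixP => j k; rewrite LC.
- rewrite connectionE christoffelE; congr (_ * _); apply: eq_bigr => l _.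
  by rewrite !mx_partialE.
- move=> a; rewrite (mx_partial_metric a Ux) /= GH// /C.
  by rewrite !mulmxA mulmxKV// jac_unit.
move=> a b c.
have sym e f g : (mx_partial e jac x + jac x *m pullback_connection e x) f g =
                 (mx_partial f jac x + jac x *m pullback_connection f x) e g.
  rewrite !addmxE mx_partial_jac_sym//; congr (_ + _).
  rewrite /pullback_connection !mulmx_sumr !summxE.
  under eq_bigr do rewrite -scalemxAr scalemxE mulmxE mulr_sumr.
  under [RHS]eq_bigr do rewrite -scalemxAr scalemxE mulmxE mulr_sumr.
  rewrite exchange_big/=; apply: eq_bigr => m _; apply: eq_bigr => b' _.
  rewrite (connection_sym oW pH _ _ _ (tauUW Ux)); ring.
by rewrite /C !mulmxE; apply: eq_bigr => m _; rewrite sym.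
Qed.

(** The curvature of the pulled-back form is the pullback of the curvature: the only other terms
    contain second derivatives of [tau], and they cancel by symmetry. *)
Lemma pullback_curvature i j x : U x ->
  mx_partial i (pullback_connection j) x - mx_partial j (pullback_connection i) x
  + (pullback_connection j x *m pullback_connection i x
     - pullback_connection i x *m pullback_connection j x) =
  \sum_a \sum_b (jac x i a * jac x j b) *: curvature H a b (tau x).
Proof.
move=> Ux.
have E k l : mx_partial k (pullback_connection l) x =
    \sum_b mx_partial k jac x l b *: connection H b (tau x)
    + \sum_a \sum_b (jac x k a * jac x l b) *: mx_partial a (connection H b) (tau x).
  apply/matrixP => m n; rewrite mx_partialE.
  under eq_fun do rewrite /pullback_connection summxE.
  have dc b : differentiable (fun y => connection H b (tau y) m n) x.
    by apply: mx_differentiable_comp Ux _ _; exact: (smooth_connection oW sH pH).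
  have dj b : differentiable (fun y => jac y l b) x.
    exact: mx_differentiable_jac Ux _ _.
  rewrite pd_sum; last first.
    by move=> b; under eq_fun do rewrite scalemxE; exact: differentiableM.
  rewrite [X in _ + X]exchange_big/= -big_split/= summxE; apply: eq_bigr => b _.
  under eq_fun do rewrite scalemxE.
  rewrite pdM// addmxE scalemxE; congr (_ + _); first by rewrite mx_partialE.
  have := mx_partial_comp k (smooth_connection oW sH pH b) Ux.
  move=> /matrixP/(_ m n); rewrite mx_partialE => ->.
  rewrite !summxE mulr_sumr; apply: eq_bigr => a _.
  by rewrite !scalemxE; ring.
have M k l : pullback_connection k x *m pullback_connection l x =
    \sum_a \sum_b (jac x k a * jac x l b) *: (connection H a (tau x) *m connection H b (tau x)).
  rewrite mulmx_suml; apply: eq_bigr => a _; rewrite mulmx_sumr.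
  by apply: eq_bigr => b _; rewrite -scalemxAl -scalemxAr scalerA.
rewrite !E !M.
under [X in _ - (X + _)]eq_bigr do rewrite mx_partial_jac_sym//.
rewrite [X in _ - (_ + X)]exchange_big [X in _ + (X - _)]exchange_big/=.
rewrite opprD [X in X + _]addrACA subrr add0r -!sumrB -big_split/=; apply: eq_bigr => a _.
rewrite -!sumrB -big_split/=; apply: eq_bigr => b _.
rewrite (mulrC (jac x j b)) -!scalerBr -scalerDr//.
Qed.

Lemma mx_differentiable_pullback i x : U x -> mx_differentiable x (pullback_connection i).
Proof.
move=> Ux j k; under eq_fun do rewrite /pullback_connection summxE.
apply: differentiable_bigsum => b; under eq_fun do rewrite scalemxE.
apply: differentiableM; first exact: mx_differentiable_jac Ux _ _.
by apply: mx_differentiable_comp Ux _ _; exact: (smooth_connection oW sH pH).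
Qed.

(** The gauge law A_l J = d_l J + J B_l is differentiated in direction k and antisymmetrized. The
    second derivatives of J cancel, and the remaining first derivatives of J are eliminated by the
    gauge law itself. Hence curvature changes by conjugation, without an inhomogeneous term. *)
Lemma curvature_change (sG : mx_smooth U G) i j x : U x ->
  curvature G i j x *m jac x =
  jac x *m \sum_a \sum_b (jac x i a * jac x j b) *: curvature H a b (tau x).
Proof.
move=> Ux; rewrite -pullback_curvature//.
have dJ := mx_differentiable_jac Ux.
have dB k : mx_differentiable x (pullback_connection k).
  exact: mx_differentiable_pullback.
have dC k : mx_differentiable x (connection G k).
  exact: mx_smooth_differentiable (smooth_connection oU sG pG k) Ux.
have dJ2 k : mx_differentiable x (mx_partial k jac).
  move=> m l; under eq_fun do rewrite mx_partialE.
  by apply: (smooth_differentiable _ Ux); apply: smooth_pd; exact: smooth_jac.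
have E k l : mx_partial k (connection G l) x *m jac x =
    mx_partial k (mx_partial l jac) x
    + mx_partial k jac x *m pullback_connection l x
    + jac x *m mx_partial k (pullback_connection l) x
    - connection G l x *m mx_partial k jac x.
  apply/eqP; rewrite eq_sym subr_eq -mx_partialM// eq_sym; apply/eqP.
  transitivity (mx_partial k (fun y => mx_partial l jac y + jac y *m pullback_connection l y) x).
    by apply: eq_mx_partial; apply: (open_near oU) Ux => y; exact: connection_change.
  by rewrite mx_partialD// ?mx_partialM// ?addrA//; exact: mx_differentiableM.
have S k l : mx_partial k (mx_partial l jac) x = mx_partial l (mx_partial k jac) x.
  apply/matrixP => m o; rewrite !mx_partialE.
  under eq_fun do rewrite mx_partialE; under [in RHS]eq_fun do rewrite mx_partialE.
  exact: pd_comm oU (smooth_jac m o) Ux.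
have D k : mx_partial k jac x = connection G k x *m jac x - jac x *m pullback_connection k x.
  by rewrite connection_change// addrK.
rewrite /curvature !(mulmxDl, mulmxBl, mulNmx) !E (S j i) !(mulmxDr, mulmxBr, mulmxN).
rewrite !D !(mulmxDl, mulmxBl, mulmxDr, mulmxBr, mulmxN, mulNmx) !mulmxA.
by apply/matrixP => m n; rewrite !(addmxE, oppmxE); ring.
Qed.

(** In the trace over i the factor [jac x i a] cancels [invmx (jac x)], so that only the free
    indices j and k keep a Jacobian. *)
Lemma ricci_change (sG : mx_smooth U G) x : U x ->
  ricci_mx G x = jac x *m ricci_mx H (tau x) *m (jac x)^T.
Proof.
move=> Ux; have uJ := jac_unit Ux.
apply/matrixP => j k; rewrite ricci_mxE ricci_curvature.
pose X a b := jac x *m curvature H a b (tau x).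
have E i : curvature G i j x =
    \sum_a \sum_b (jac x i a * jac x j b) *: (X a b *m invmx (jac x)).
  rewrite -[LHS](mulmxK uJ) curvature_change// mulmx_sumr mulmx_suml.
  apply: eq_bigr => a _; rewrite mulmx_sumr mulmx_suml; apply: eq_bigr => b _.
  by rewrite -scalemxAr -scalemxAl.
transitivity (\sum_i \sum_a \sum_b jac x i a * jac x j b * (X a b *m invmx (jac x)) k i).
  apply: eq_bigr => i _; rewrite E summxE; apply: eq_bigr => a _.
  by rewrite summxE; apply: eq_bigr => b _; rewrite scalemxE.
rewrite exchange_big/=.
transitivity (\sum_a \sum_b jac x j b * X a b k a).
  apply: eq_bigr => a _; rewrite exchange_big/=; apply: eq_bigr => b _.
  rewrite -[X a b in RHS](mulmxKV uJ) mulmxE mulr_sumr.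
  by apply: eq_bigr => i _; ring.
transitivity (\sum_m \sum_b \sum_a jac x j b * jac x k m * curvature H a b (tau x) m a).
  rewrite [RHS]exchange_big/= exchange_big/=; apply: eq_bigr => b _.
  rewrite [RHS]exchange_big/=; apply: eq_bigr => a _.
  by rewrite /X mulmxE mulr_sumr; apply: eq_bigr => m _; ring.
rewrite mulmxE; apply: eq_bigr => m _; rewrite mulmxE mulr_suml; apply: eq_bigr => b _.
rewrite ricci_mxE ricci_curvature trmxE mulr_sumr mulr_suml.
by apply: eq_bigr => a _; ring.
Qed.

Lemma scalar_change (sG : mx_smooth U G) x : U x ->
  Defs.scalar G x = Defs.scalar H (tau x).
Proof.
move=> Ux; have uJ := jac_unit Ux; have uH := posdef_unit (pH (tauUW Ux)).
rewrite !scalar_trace ricci_change//.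
rewrite [X in invmx X]GH// invmx_congruence//.
rewrite !trmx_mul trmxK !mulmxA mulmxKV// mxtrace_mulC !mulmxA -trmx_mul mulVmx//.
by rewrite trmx1 mul1mx.
Qed.

End ChangeOfVariables.

(** * Conformal change of the metric *)

Section Conformal.
Context {R : realType} {d : nat}.
Variables (U : set 'rV[R]_d) (G Gt : 'rV[R]_d -> 'M[R]_d) (f : 'rV[R]_d -> R).
Hypotheses (oU : open U) (sG : mx_smooth U G) (pG : forall x, U x -> posdef (G x)).
Hypothesis sf : smooth_on U f.
Hypothesis GtE : forall x, U x -> Gt x = expR (2 * f x) *: G x.

Let Gi x := invmx (G x).

Lemma conformal_inv x : U x -> invmx (Gt x) = expR (- (2 * f x)) *: Gi x.
Proof.
move=> Ux; have uG := posdef_unit (pG Ux).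
rewrite GtE// invmxZ ?expRN//.
by rewrite unitmxZ ?unitfE ?gt_eqF ?expR_gt0.
Qed.

Lemma pd_conformal_factor i x : U x ->
  pd i (fun y => expR (2 * f y)) x = expR (2 * f x) * (2 * pd i f x).
Proof.
move=> Ux; have df := smooth_differentiable sf Ux.
have d2 : differentiable (fun y => 2 * f y) x.
  exact: (@differentiableM _ _ (fun=> 2) f).
rewrite pdE (partial_comp1 i d2 (is_derive_expR _)) partialM// partial_cst.
by rewrite mul0r add0r.
Qed.

Lemma pd_conformal i j k x : U x ->
  pd i (fun y => Gt y j k) x =
  expR (2 * f x) * (2 * pd i f x * G x j k + pd i (fun y => G y j k) x).
Proof.
move=> Ux.
rewrite (@eq_pd _ _ i _ (fun y => expR (2 * f y) * G y j k)); last first.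
  by apply: (open_near oU) Ux => y Uy; rewrite GtE// scalemxE.
rewrite pdM; last first.
- exact: smooth_differentiable (sG j k) Ux.
- apply: (smooth_differentiable _ Ux); apply: smooth_expR => //.
  by apply: smoothM => //; exact: smooth_cst.
by rewrite pd_conformal_factor//; ring.
Qed.

Lemma mul_inv_metric x i j : U x -> \sum_l Gi x i l * G x l j = (i == j)%:R.
Proof.
by move=> /pG/posdef_unit uG; rewrite -mulmxE mulVmx// mxE.
Qed.

Lemma inv_metric_sym x i j : U x -> Gi x i j = Gi x j i.
Proof. by move=> /pG/posdef_inv[sGi _]; rewrite /Gi -[in LHS]sGi trmxE. Qed.

(* The difference of the two connections is C^k_ij = sum_l K k l i j f_l. *)
Definition Kcoef (k l i j : 'I_d) x : R :=
  (k == j)%:R * (i == l)%:R + (k == i)%:R * (j == l)%:R - G x i j * Gi x k l.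

Definition Cdiff k i j x : R := \sum_l Kcoef k l i j x * pd l f x.

Lemma smooth_Kcoef k l i j : smooth_on U (Kcoef k l i j).
Proof.
apply: smoothB => //; first by apply: smoothD => //; exact: smooth_cst.
by apply: smoothM => //; exact: smooth_inv_metric.
Qed.

Lemma smooth_Cdiff k i j : smooth_on U (Cdiff k i j).
Proof.
apply: smooth_bigsum => // l; apply: smoothM => //; first exact: smooth_Kcoef.
exact: smooth_pd.
Qed.

Lemma sum_delta_l (F : 'I_d -> R) k : \sum_l (k == l)%:R * F l = F k.
Proof.
rewrite (bigD1 k)//= eqxx mul1r big1 ?addr0// => l.
by rewrite eq_sym => /negbTE ->; rewrite mul0r.
Qed.

Lemma sum_delta_r (F : 'I_d -> R) k : \sum_l (l == k)%:R * F l = F k.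
Proof. by rewrite -[RHS]sum_delta_l; apply: eq_bigr => l _; rewrite eq_sym. Qed.

Lemma CdiffE k i j x : Cdiff k i j x =
  (k == j)%:R * pd i f x + (k == i)%:R * pd j f x
  - G x i j * \sum_l Gi x k l * pd l f x.
Proof.
rewrite /Cdiff -(sum_delta_l (fun l => pd l f x) i) -(sum_delta_l (fun l => pd l f x) j).
rewrite !mulr_sumr -big_split/= -sumrB; apply: eq_bigr => l _.
by rewrite /Kcoef; ring.
Qed.

Lemma christoffel_conformal k i j x : U x ->
  christoffel Gt k i j x = christoffel G k i j x + Cdiff k i j x.
Proof.
move=> Ux; rewrite !christoffelE conformal_inv// CdiffE.
have e0 : expR (- (2 * f x)) * expR (2 * f x) = 1 by rewrite expRN mulVf// gt_eqF// expR_gt0.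
rewrite -(mul_inv_metric k j Ux) -(mul_inv_metric k i Ux) !mulr_suml !mulr_sumr -big_split/=.
rewrite -sumrB -big_split/=; apply: eq_bigr => l _.
rewrite scalemxE !pd_conformal//.
have sGx := (pG Ux).1.
have -> : G x l j = G x j l by rewrite -[in LHS]sGx trmxE.
have -> : G x l i = G x i l by rewrite -[in LHS]sGx trmxE.
(* The exponential from the inverse metric cancels the one from the derivatives of [Gt]. *)
have key (a b c g : R) : 2^-1 * (expR (- (2 * f x)) * g *
    (expR (2 * f x) * a + expR (2 * f x) * b - expR (2 * f x) * c)) =
    2^-1 * (g * (a + b - c)).
  transitivity (expR (- (2 * f x)) * expR (2 * f x) * (2^-1 * (g * (a + b - c)))).
    by ring.
  by rewrite e0 mul1r.
by rewrite key; field.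
Qed.

(* The maximum principle does not depend on the first order terms, so their
   coefficients beta are never computed. *)
Definition first_order (T : 'rV[R]_d -> R) :=
  exists beta : 'I_d -> 'rV[R]_d -> R, (forall l, smooth_on U (beta l)) /\
    forall x, U x -> T x = \sum_l beta l x * pd l f x.

Lemma first_orderD S T : first_order S -> first_order T ->
  first_order (fun x => S x + T x).
Proof.
move=> [b [sb E]] [c [sc F]]; exists (fun l x => b l x + c l x); split.
  by move=> l; exact: smoothD.
move=> x Ux; rewrite E// F// -big_split/=; apply: eq_bigr => l _; ring.
Qed.

Lemma first_orderM a T : smooth_on U a -> first_order T ->
  first_order (fun x => a x * T x).
Proof.
move=> sa [b [sb E]]; exists (fun l x => a x * b l x); split.
  by move=> l; exact: smoothM.
by move=> x Ux; rewrite E// mulr_sumr; apply: eq_bigr => l _; rewrite mulrA.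
Qed.

Lemma first_orderN T : first_order T -> first_order (fun x => - T x).
Proof.
move=> fT; have := first_orderM (smooth_cst (-1)) fT.
by under eq_fun do rewrite mulN1r.
Qed.

Lemma first_orderB S T : first_order S -> first_order T ->
  first_order (fun x => S x - T x).
Proof. by move=> fS fT; apply: first_orderD => //; exact: first_orderN. Qed.

Lemma first_order_sum (I : Type) (r : seq I) (T : I -> 'rV[R]_d -> R) :
  (forall k, first_order (T k)) -> first_order (fun x => \sum_(k <- r) T k x).
Proof.
move=> fT; elim: r => [|k r IH].
  exists (fun _ _ => 0); split=> [l|x _]; first exact: smooth_cst.
  by rewrite big_nil big1// => l _; rewrite mul0r.
by under eq_fun do rewrite big_cons; exact: first_orderD.
Qed.

Lemma eq_first_order S T : (forall x, U x -> S x = T x) ->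
  first_order S -> first_order T.
Proof. by move=> ST [b [sb E]]; exists b; split => // x Ux; rewrite -ST// E. Qed.

Lemma first_order_Cdiff k i j : first_order (Cdiff k i j).
Proof. by exists (fun l => Kcoef k l i j); split => // l; exact: smooth_Kcoef. Qed.

Lemma first_order_pd_Cdiff a k i j : first_order
  (fun x => pd a (Cdiff k i j) x - \sum_l Kcoef k l i j x * pd a (pd l f) x).
Proof.
exists (fun l => pd a (Kcoef k l i j)); split => [l|x Ux].
  by apply: smooth_pd; exact: smooth_Kcoef.
have dK l : differentiable (Kcoef k l i j) x.
  exact: smooth_differentiable (smooth_Kcoef k l i j) Ux.
have df l : differentiable (pd l f) x.
  exact: smooth_differentiable (smooth_pd l sf) Ux.
rewrite pd_sum => [|l]; last exact: differentiableM.
rewrite -sumrB; apply: eq_bigr => l _; rewrite pdM//; ring.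
Qed.

(** The part of the difference of the two Ricci tensors that carries second derivatives of [f]. *)
Definition hessian_part j k x : R := \sum_i \sum_l
  (Kcoef i l j k x * pd i (pd l f) x - Kcoef i l i k x * pd j (pd l f) x).

Lemma ricciE (H : 'rV[R]_d -> 'M[R]_d) j k x : ricci H j k x =
  \sum_i (pd i (christoffel H i j k) x - pd j (christoffel H i i k) x
    + \sum_m (christoffel H i i m x * christoffel H m j k x
              - christoffel H i j m x * christoffel H m i k x)).
Proof. by rewrite pdE. Qed.

(** Products of two [Cdiff] are quadratic in the gradient of [f]. One factor is kept as a smooth
    coefficient, so that these products also count as first order; the coefficients therefore depend
    on [f]. *)
Lemma ricci_conformal j k :
  first_order (fun x => ricci Gt j k x - ricci G j k x - hessian_part j k x).
Proof.
pose Ga k i j := christoffel G k i j.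
have sGa a b c : smooth_on U (Ga a b c) by exact: smooth_christoffel.
have pdC a k' i' j' x : U x -> pd a (christoffel Gt k' i' j') x =
    pd a (Ga k' i' j') x + pd a (Cdiff k' i' j') x.
  move=> Ux; rewrite -pdD.
  - by apply: eq_pd; apply: (open_near oU) Ux => y; exact: christoffel_conformal.
  - exact: smooth_differentiable (sGa _ _ _) Ux.
  - exact: smooth_differentiable (smooth_Cdiff _ _ _) Ux.
apply: (@eq_first_order (fun x => \sum_i (
    (pd i (Cdiff i j k) x - \sum_l Kcoef i l j k x * pd i (pd l f) x)
    - (pd j (Cdiff i i k) x - \sum_l Kcoef i l i k x * pd j (pd l f) x)
    + \sum_m (Ga i i m x * Cdiff m j k x + Ga m j k x * Cdiff i i m x
      + Cdiff i i m x * Cdiff m j k x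
      - (Ga i j m x * Cdiff m i k x + Ga m i k x * Cdiff i j m x
      + Cdiff i j m x * Cdiff m i k x))))).
  move=> x Ux; rewrite !ricciE /hessian_part -!sumrB; apply: eq_bigr => i _.
  have E : \sum_m (christoffel Gt i i m x * christoffel Gt m j k x
              - christoffel Gt i j m x * christoffel Gt m i k x) =
      \sum_m (Ga i i m x * Ga m j k x - Ga i j m x * Ga m i k x) +
      \sum_m (Ga i i m x * Cdiff m j k x + Ga m j k x * Cdiff i i m x
      + Cdiff i i m x * Cdiff m j k x
      - (Ga i j m x * Cdiff m i k x + Ga m i k x * Cdiff i j m x
      + Cdiff i j m x * Cdiff m i k x)).
    rewrite -big_split/=; apply: eq_bigr => m _.
    by rewrite !christoffel_conformal// -!/(Ga _ _ _); ring.
  have F : \sum_l (Kcoef i l j k x * pd i (pd l f) x - Kcoef i l i k x * pd j (pd l f) x) =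
      \sum_l Kcoef i l j k x * pd i (pd l f) x - \sum_l Kcoef i l i k x * pd j (pd l f) x.
    by rewrite sumrB.
  by rewrite E F (pdC i i j k x Ux) (pdC j i i k x Ux) /Ga; ring.
apply: first_order_sum => i; apply: first_orderD; first by apply: first_orderB; exact: first_order_pd_Cdiff.
apply: first_order_sum => m.
apply: first_orderB; (apply: first_orderD; first apply: first_orderD);
  apply: first_orderM (first_order_Cdiff _ _ _) => //; exact: smooth_Cdiff.
Qed.

(** The principal part of the Laplace-Beltrami operator applied to [f]; its Christoffel terms are of
    first order. *)
Definition metric_hessian x : R := \sum_i \sum_j Gi x i j * pd i (pd j f) x.

(** The classical expression -(d - 2) Hess f - (Laplacian of f) G up to first order terms. The
    contraction of [Kcoef] over its first and third indices has Kronecker terms with coefficients 1,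
    d and -1, whence the total d. *)
Lemma hessian_partE j k x : U x ->
  hessian_part j k x =
  (2 - d%:R) * pd j (pd k f) x - G x j k * metric_hessian x.
Proof.
move=> Ux; rewrite /hessian_part.
have sfx a b : pd a (pd b f) x = pd b (pd a f) x by exact: pd_comm oU sf Ux.
transitivity (\sum_i \sum_l Kcoef i l j k x * pd i (pd l f) x
              - \sum_l (\sum_i Kcoef i l i k x) * pd j (pd l f) x).
  under [X in _ = _ - X]eq_bigr do rewrite mulr_suml.
  by rewrite [X in _ - X]exchange_big/= -sumrB; apply: eq_bigr => i _; rewrite sumrB.
have -> : \sum_i \sum_l Kcoef i l j k x * pd i (pd l f) x =
    2 * pd j (pd k f) x - G x j k * metric_hessian x.
  transitivity (\sum_i ((i == k)%:R * pd i (pd j f) x)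
    + \sum_i ((i == j)%:R * pd i (pd k f) x) - G x j k * metric_hessian x).
    rewrite -big_split/= mulr_sumr -sumrB; apply: eq_bigr => i _.
    rewrite -(sum_delta_l (fun l => pd i (pd l f) x) j) -(sum_delta_l (fun l => pd i (pd l f) x) k).
    rewrite !mulr_sumr -big_split/= -sumrB; apply: eq_bigr => l _.
    by rewrite /Kcoef; ring.
  by rewrite !sum_delta_r (sfx k j); ring.
have -> : \sum_l (\sum_i Kcoef i l i k x) * pd j (pd l f) x = d%:R * pd j (pd k f) x.
  transitivity (\sum_l (k == l)%:R * (d%:R * pd j (pd l f) x)); last by rewrite sum_delta_l.
  apply: eq_bigr => l _; rewrite mulrA; congr (_ * _).
  rewrite sumrB big_split/= sum_delta_r.
  have -> : \sum_(i < d) (i == i)%:R * (k == l)%:R = d%:R * (k == l)%:R :> R.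
    rewrite (eq_bigr (fun=> (k == l)%:R)) => [|i _]; last by rewrite eqxx mul1r.
    by rewrite sumr_const card_ord mulr_natl.
  have -> : \sum_i G x i k * Gi x i l = (k == l)%:R.
    have := mul_inv_metric l k Ux; rewrite eq_sym => <-; apply: eq_bigr => i _.
    by rewrite mulrC (inv_metric_sym i l Ux).
  by ring.
by ring.
Qed.

(** The trace of [hessian_partE] with the inverse metric has coefficient (2 - d) - d = -2(d - 1).
    The factor e^(2f) undoes the scaling of the inverse of [Gt]. *)
Lemma scalar_conformal :
  first_order (fun x => expR (2 * f x) * Defs.scalar Gt x - Defs.scalar G x
    + 2 * (d%:R - 1) * metric_hessian x).
Proof.
apply: (@eq_first_order (fun x => \sum_j \sum_k Gi x j k *
    (ricci Gt j k x - ricci G j k x - hessian_part j k x))); last first.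
  apply: first_order_sum => j; apply: first_order_sum => k.
  by apply: first_orderM (ricci_conformal j k); exact: smooth_inv_metric.
move=> x Ux.
transitivity (\sum_j \sum_k Gi x j k * ricci Gt j k x - Defs.scalar G x
   - \sum_j \sum_k Gi x j k * hessian_part j k x).
  rewrite -!sumrB; apply: eq_bigr => j _; rewrite -!sumrB; apply: eq_bigr => k _.
  by rewrite !mulrBr.
have -> : \sum_j \sum_k Gi x j k * ricci Gt j k x = expR (2 * f x) * Defs.scalar Gt x.
  rewrite /Defs.scalar mulr_sumr; apply: eq_bigr => j _; rewrite mulr_sumr.
  apply: eq_bigr => k _; rewrite conformal_inv// scalemxE !mulrA expRN.
  by rewrite mulfV ?mul1r// gt_eqF// expR_gt0.
have -> : \sum_j \sum_k Gi x j k * hessian_part j k x = - (2 * (d%:R - 1) * metric_hessian x).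
  transitivity ((2 - d%:R) * metric_hessian x -
    (\sum_j \sum_k Gi x j k * G x k j) * metric_hessian x).
    rewrite [X in X - _]mulr_sumr mulr_suml -sumrB; apply: eq_bigr => j _.
    rewrite mulr_sumr mulr_suml -sumrB; apply: eq_bigr => k _.
    have -> : G x k j = G x j k by rewrite -[in LHS](pG Ux).1 trmxE.
    by rewrite hessian_partE//; ring.
  have -> : \sum_j \sum_k Gi x j k * G x k j = d%:R.
    rewrite (eq_bigr (fun=> 1)) => [|j _]; last by rewrite mul_inv_metric// eqxx.
    by rewrite sumr_const card_ord.
  by ring.
by ring.
Qed.

End Conformal.

(** * The Hopf lemma and the strong minimum principle *)

Section EuclideanNorm.
Context {R : realType} {d : nat}.
Implicit Types x y : 'rV[R]_d.

(** The squared Euclidean norm. The norm of row vectors is the maximum norm, whose balls have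
    corners, while Hopf's lemma uses round balls and a smooth barrier. *)
Definition sqn x : R := \sum_i x ord0 i ^+ 2.

Lemma sqn_ge0 x : 0 <= sqn x.
Proof. by apply: sumr_ge0 => i _; exact: sqr_ge0. Qed.

Lemma sqn_gt0 x : x != 0 -> 0 < sqn x.
Proof.
move=> x0; rewrite lt_neqAle sqn_ge0 andbT eq_sym; apply: contra x0.
rewrite psumr_eq0; last by move=> i _; exact: sqr_ge0.
move=> /allP z; apply/eqP/rowP => i; rewrite mxE.
by have := z i; rewrite mem_index_enum sqrf_eq0 => /(_ isT)/eqP.
Qed.

Lemma sqn0 : sqn 0 = 0.
Proof. by rewrite /sqn big1// => i _; rewrite mxE expr0n. Qed.

Lemma sqnZ (a : R) x : sqn (a *: x) = a ^+ 2 * sqn x.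
Proof. by rewrite /sqn mulr_sumr; apply: eq_bigr => i _; rewrite mxE exprMn. Qed.

Lemma sqnN x : sqn (- x) = sqn x.
Proof. by rewrite -scaleN1r sqnZ sqrrN expr1n mul1r. Qed.

Lemma sqnB x y : sqn (x - y) = sqn (y - x).
Proof. by rewrite -sqnN opprB. Qed.

(** A substitute for the triangle inequality that avoids square roots. *)
Lemma sqnD_le x y : sqn (x + y) <= 2 * sqn x + 2 * sqn y.
Proof.
rewrite /sqn !mulr_sumr -big_split/=; apply: ler_sum => i _; rewrite mxE -subr_ge0.
have -> : 2 * x ord0 i ^+ 2 + 2 * y ord0 i ^+ 2 - (x ord0 i + y ord0 i) ^+ 2
  = (x ord0 i - y ord0 i) ^+ 2 by ring.
exact: sqr_ge0.
Qed.

Lemma coord_le_sqn x i : x ord0 i ^+ 2 <= sqn x.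
Proof.
by rewrite /sqn (bigD1 i)//= lerDl; apply: sumr_ge0 => j _; exact: sqr_ge0.
Qed.

Lemma smooth_sqnB y : smooth_on [set: 'rV[R]_d] (fun x => sqn (x - y)).
Proof.
have oT := @openT 'rV[R]_d.
apply: smooth_bigsum => // i.
apply: (@eq_smooth _ _ _ oT (fun x => (x ord0 i - y ord0 i) * (x ord0 i - y ord0 i))).
  by move=> x _; rewrite !mxE expr2.
have sB : smooth_on [set: 'rV[R]_d] (fun x => x ord0 i - y ord0 i).
  by apply: smoothB => //; [exact: smooth_coord|exact: smooth_cst].
exact: smoothM.
Qed.

Lemma continuous_sqnB y : continuous (fun x => sqn (x - y)).
Proof. by move=> x; apply: smooth_continuous (smooth_sqnB y) _. Qed.

Lemma pd_sqnB y i x : pd i (fun x => sqn (x - y)) x = 2 * (x - y) ord0 i.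
Proof.
rewrite pdE /sqn partial_sum; last first.
  move=> k; have := smooth_differentiable (smooth_sqnB y) (I : setT x).
  have -> : (fun z => (z - y) ord0 k ^+ 2) =
     (fun z : 'rV[R]_d => (z ord0 k - y ord0 k) * (z ord0 k - y ord0 k)).
    by apply/funext => z; rewrite !mxE expr2.
  by move=> _; apply: differentiableM; apply: differentiableB => //; exact: differentiable_coord.
have E k : partial i (fun z => (z - y) ord0 k ^+ 2) x = (k == i)%:R * (2 * (x - y) ord0 i).
  have -> : (fun z => (z - y) ord0 k ^+ 2) =
     (fun z : 'rV[R]_d => (z ord0 k - y ord0 k) * (z ord0 k - y ord0 k)).
    by apply/funext => z; rewrite !mxE expr2.
  have dk : differentiable (fun z : 'rV[R]_d => z ord0 k - y ord0 k) x.
    by apply: differentiableB => //; exact: differentiable_coord.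
  rewrite partialM// partialB//; last exact: differentiable_coord.
  rewrite partial_coord partial_cst subr0 eq_sym.
  by rewrite submxE; have [->|_] := eqVneq k i; rewrite ?mulr1n ?mulr0n; ring.
rewrite (eq_bigr _ (fun k _ => E k)) (bigD1 i)//= eqxx mul1r big1 ?addr0// => k.
by move=> /negbTE ->; rewrite mul0r.
Qed.

Lemma closed_preimage_le (f : 'rV[R]_d -> R) (k : R) : continuous f ->
  closed [set x | f x <= k].
Proof. by move=> cf; apply: (@closed_comp _ _ f [set z | z <= k]) => [x _|]; [exact: cf|exact: closed_le]. Qed.

Lemma compact_sqn_ball y (r2 : R) : compact [set x | sqn (x - y) <= r2].
Proof.
(* Since t^2 <= r2 implies |t| <= 1 + r2, a cube of this size contains the ball. *)
apply: (@subclosed_compact _ _ [set x : 'rV[R]_d | forall i,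
    `[y ord0 i - (1 + r2), y ord0 i + (1 + r2)]%classic (x ord0 i)]).
- by apply: (@closed_preimage_le (fun x => sqn (x - y)) r2); exact: continuous_sqnB.
- apply: (@rV_compact R d (fun i => `[y ord0 i - (1 + r2), y ord0 i + (1 + r2)]%classic)).
  by move=> i; exact: segment_compact.
- move=> x /= xr i; have := le_trans (coord_le_sqn (x - y) i) xr; rewrite !mxE in_itv/=.
  move=> h; have := sqr_ge0 (x ord0 i - y ord0 i - 1); have := sqr_ge0 (x ord0 i - y ord0 i + 1).
  by move=> *; apply/andP; split; nra.
Qed.

Lemma sqn_ball_nbhs (P : set 'rV[R]_d) x : nbhs x P ->
  exists2 r2 : R, 0 < r2 & forall y, sqn (y - x) < r2 -> P y.
Proof.
move=> /nbhs_normP[r /= r0 Pr]; exists (r ^+ 2); first by rewrite exprn_gt0.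
move=> y yr; apply: Pr => /=.
rewrite [`|_|]mx_normrE.
apply: (big_ind (fun z => z < r)) => // [a b ar br|[i j] _].
  by rewrite gt_max ar.
rewrite ord1/=; have h := le_lt_trans (coord_le_sqn _ j) yr.
have {}h : `|(y - x) ord0 j| ^+ 2 < r ^+ 2 by rewrite real_normK ?num_real.
move: h; rewrite ltr_pXn2r ?nnegrE ?(ltW r0)//.
by rewrite !submxE distrC.
Qed.

Lemma open_sqn_ball y (r2 : R) : open [set x | sqn (x - y) < r2].
Proof.
by apply: (@open_comp _ _ (fun x => sqn (x - y)) [set z | z < r2]) => [x _|]; [exact: continuous_sqnB|exact: open_lt].
Qed.

Lemma continuous_within (A U : set 'rV[R]_d) (f : 'rV[R]_d -> R) :
  A `<=` U -> (forall x, U x -> {for x, continuous f}) -> {within A, continuous f}.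
Proof.
by move=> AU cf; apply: continuous_in_subspaceT => x; rewrite inE => /AU /cf.
Qed.

End EuclideanNorm.

Lemma continuous_bigsum {R : realType} (T : topologicalType) (I : Type) (r : seq I) (F : I -> T -> R) (x : T) :
  (forall k, {for x, continuous (F k)}) ->
  {for x, continuous (fun y => \sum_(k <- r) F k y)}.
Proof.
move=> cF; change (continuous_at x (fun y => \sum_(k <- r) F k y)).
elim: r => [|k r IH].
  by under eq_fun do rewrite big_nil; exact: cst_continuous.
by under eq_fun do rewrite big_cons; exact: continuousD.
Qed.

Definition elliptic {R : realType} {d : nat} (a : 'rV[R]_d -> 'M[R]_d)
    (b : 'I_d -> 'rV[R]_d -> R) (u : 'rV[R]_d -> R) x : R :=
  \sum_i \sum_j a x i j * pd i (pd j u) x + \sum_l b l x * pd l u x.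

(** * First and second order conditions at an interior minimum *)

Section Minimum.
Context {R : realType} {d : nat}.
Variables (O : set 'rV[R]_d) (w : 'rV[R]_d -> R) (x : 'rV[R]_d).
Hypotheses (oO : open O) (Ox : O x) (sw : smooth_on O w).
Hypothesis wmin : forall y, O y -> w x <= w y.

Lemma pd_at_min i : pd i w x = 0.
Proof.
rewrite pdE; apply: (derive_at_local_min _ oO Ox) => // y Oy.
exact: smooth_differentiable sw Oy.
Qed.

Lemma derive2_sum (v : 'rV[R]_d) y : O y ->
  'D_v ('D_v w) y = \sum_i \sum_j pd i (pd j w) y * (v ord0 i * v ord0 j).
Proof.
move=> Oy.
have E : \forall z \near y, 'D_v w z = \sum_j v ord0 j * pd j w z.
  apply: (open_near oO) Oy => z Oz.
  by rewrite pdE; apply: derive_sum_partial; exact: smooth_differentiable sw Oz.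
rewrite (near_eq_derive v E).
have dj j : differentiable (pd j w) y by exact: smooth_differentiable (smooth_pd j sw) Oy.
have dj' j : differentiable (fun z => v ord0 j * pd j w z) y.
  exact: (@differentiableM _ _ (fun=> v ord0 j) (pd j w)).
rewrite derive_sum_partial; last exact: differentiable_bigsum.
apply: eq_bigr => i _; rewrite partial_sum// mulr_sumr; apply: eq_bigr => j _.
by rewrite (@partialM _ _ i (fun=> v ord0 j))// partial_cst -pdE; ring.
Qed.

Lemma hessian_at_min (v : 'rV[R]_d) :
  0 <= \sum_i \sum_j pd i (pd j w) x * (v ord0 i * v ord0 j).
Proof.
rewrite -derive2_sum//; apply: (derive2_at_local_min oO Ox) => //.
  by move=> y Oy; exact: smooth_differentiable sw Oy.
have E : \forall z \near x, \sum_j v ord0 j * pd j w z = 'D_v w z.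
  apply: (open_near oO) Ox => z Oz; apply/esym.
  by rewrite pdE; apply: derive_sum_partial; exact: smooth_differentiable sw Oz.
apply: near_eq_differentiable E _; apply: differentiable_bigsum => j.
apply: (@differentiableM _ _ (fun=> v ord0 j) (pd j w)) => //.
exact: smooth_differentiable (smooth_pd j sw) Ox.
Qed.

(** At a minimum the gradient vanishes and the Hessian is positive semidefinite; its contraction
    with a positive definite matrix is nonnegative. *)
Lemma elliptic_at_min a b : posdef (a x) -> 0 <= elliptic a b w x.
Proof.
move=> pa; rewrite /elliptic [X in _ + X]big1 ?addr0 => [|l _]; last first.
  by rewrite pd_at_min mulr0.
have := @posdef_sum_ge0 _ _ (a x) (\matrix_(i, j) pd i (pd j w) x) pa.
have E : \sum_i \sum_j a x i j * (\matrix_(i, j) pd i (pd j w) x) i j =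
    \sum_i \sum_j a x i j * pd i (pd j w) x.
  by apply: eq_bigr => i _; apply: eq_bigr => j _; rewrite mxE.
rewrite E; apply => v; rewrite quad_formE.
have := hessian_at_min v; congr (0 <= _).
by apply: eq_bigr => i _; apply: eq_bigr => j _; rewrite mxE.
Qed.

End Minimum.

(** * The exponential barrier *)

Section Barrier.
Context {R : realType} {d : nat}.
Variables (y : 'rV[R]_d) (alpha r2 : R).

(** Hopf's function: for [alpha > 0] it vanishes on the sphere of squared radius [r2] about [y] and
    is positive inside. *)
Definition barrier x : R := expR (- alpha * sqn (x - y)) - expR (- alpha * r2).

Let e x := expR (- alpha * sqn (x - y)).

Lemma smooth_gauss : smooth_on [set: 'rV[R]_d] e.
Proof.
apply: (smooth_expR openT); apply: (smoothM openT); first exact: smooth_cst.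
exact: smooth_sqnB.
Qed.

Lemma smooth_barrier : smooth_on [set: 'rV[R]_d] barrier.
Proof.
by apply: (smoothB openT); [exact: smooth_gauss|exact: smooth_cst].
Qed.

Lemma pd_gauss i x : pd i e x = - 2 * alpha * (x - y) ord0 i * e x.
Proof.
have ds : differentiable (fun x => sqn (x - y)) x.
  exact: smooth_differentiable (smooth_sqnB y) (I : setT x).
have da : differentiable (fun x => - alpha * sqn (x - y)) x.
  exact: (@differentiableM _ _ (fun=> - alpha)).
rewrite pdE (partial_comp1 i da (is_derive_expR _)).
rewrite (@partialM _ _ i (fun=> - alpha))// partial_cst -pdE pd_sqnB /e; ring.
Qed.

Lemma pd_barrier i : pd i barrier = fun x => - 2 * alpha * (x - y) ord0 i * e x.
Proof.
apply/funext => x; rewrite -pd_gauss pdE partialB ?partial_cst ?subr0//.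
exact: smooth_differentiable smooth_gauss (I : setT x).
Qed.

Lemma pd2_barrier i j x : pd i (pd j barrier) x =
  e x * (4 * alpha ^+ 2 * ((x - y) ord0 i * (x - y) ord0 j) - 2 * alpha * (i == j)%:R).
Proof.
rewrite pd_barrier pdE.
have de : differentiable e x by exact: smooth_differentiable smooth_gauss (I : setT x).
have dc : differentiable (fun x => (x - y) ord0 j) x.
  under eq_fun do rewrite submxE.
  by apply: differentiableB => //; exact: differentiable_coord.
have dc' : differentiable (fun x => - 2 * alpha * (x - y) ord0 j) x.
  exact: (@differentiableM _ _ (fun=> - 2 * alpha)).
rewrite partialM// (@partialM _ _ i (fun=> - 2 * alpha))// partial_cst.
rewrite -[X in _ + _ * X]/(partial i e x) -pdE pd_gauss.
have -> : pd i (fun x => (x - y) ord0 j) x = (i == j)%:R.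
  under eq_fun do rewrite submxE.
  rewrite pdE partialB//; last exact: differentiable_coord.
  by rewrite partial_coord partial_cst subr0.
by ring.
Qed.

(** The term quadratic in [alpha] carries the quadratic form of [a]. Away from the centre that form
    is positive, so this term outweighs the linear one for large [alpha]. *)
Lemma elliptic_barrier a b x : elliptic a b barrier x =
  e x * (4 * alpha ^+ 2 * ((x - y) *m a x *m (x - y)^T) ord0 ord0
         - 2 * alpha * (\tr (a x) + \sum_l b l x * (x - y) ord0 l)).
Proof.
rewrite /elliptic quad_formE.
transitivity (\sum_i (\sum_j e x * (4 * alpha ^+ 2 * (a x i j * ((x - y) ord0 i * (x - y) ord0 j)))
    - e x * (2 * alpha * a x i i)) + \sum_l e x * (- 2 * alpha * (b l x * (x - y) ord0 l))).
  congr (_ + _); last first.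
    by apply: eq_bigr => l _; rewrite pd_barrier -/(e x); ring.
  apply: eq_bigr => i _.
  rewrite [X in _ - X](_ : _ = \sum_j e x * (2 * alpha * (i == j)%:R * a x i j)).
    by rewrite -sumrB; apply: eq_bigr => j _; rewrite pd2_barrier; ring.
  rewrite (bigD1 i)//= eqxx big1 ?addr0 => [|j]; first by rewrite mulr1n; ring.
  by rewrite eq_sym => /negbTE ->; rewrite mulr0n; ring.
rewrite sumrB -!mulr_sumr /mxtrace.
under eq_bigr do rewrite -!mulr_sumr.
by rewrite -!mulr_sumr; ring.
Qed.

End Barrier.

(** * Hopf's lemma on a ball and the strong minimum principle *)

Section Hopf.
Context {R : realType} {d : nat}.
Implicit Types x y z t : 'rV[R]_d.
Variables (U : set 'rV[R]_d) (a : 'rV[R]_d -> 'M[R]_d).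
Variables (b : 'I_d -> 'rV[R]_d -> R) (c u : 'rV[R]_d -> R).
Hypotheses (oU : open U) (su : smooth_on U u).
Hypothesis pa : forall x, U x -> posdef (a x).
Hypothesis ca : forall i j x, U x -> {for x, continuous (fun z => a z i j)}.
Hypothesis cb : forall l x, U x -> {for x, continuous (b l)}.
Hypothesis cc : forall x, U x -> {for x, continuous c}.
Hypothesis c_ge0 : forall x, U x -> 0 <= c x.

Lemma ellipticB v w x k : U x -> smooth_on U v -> smooth_on U w ->
  elliptic a b (fun z => v z - k * w z) x = elliptic a b v x - k * elliptic a b w x.
Proof.
move=> Ux sv sw.
have skw : smooth_on U (fun z => k * w z) by apply: smoothM => //; exact: smooth_cst.
have E l z : U z -> pd l (fun z => v z - k * w z) z = pd l v z - k * pd l w z.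
  move=> Uz; rewrite pdB; [|exact: smooth_differentiable sv Uz|exact: smooth_differentiable skw Uz].
  by rewrite pdZ//; exact: smooth_differentiable sw Uz.
have E2 i j : pd i (pd j (fun z => v z - k * w z)) x =
    pd i (pd j v) x - k * pd i (pd j w) x.
  rewrite (@eq_pd _ _ i _ (fun z => pd j v z - k * pd j w z)); last first.
    by apply: (open_near oU) Ux => z; exact: E.
  have dv := smooth_differentiable (smooth_pd j sv) Ux.
  have dw := smooth_differentiable (smooth_pd j sw) Ux.
  rewrite pdB//; last exact: (@differentiableM _ _ (fun=> k)).
  by rewrite pdZ.
rewrite /elliptic mulrDr opprD addrACA; congr (_ + _).
  rewrite mulr_sumr -sumrB; apply: eq_bigr => i _.
  by rewrite mulr_sumr -sumrB; apply: eq_bigr => j _; rewrite E2; ring.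
by rewrite mulr_sumr -sumrB; apply: eq_bigr => l _; rewrite E//; ring.
Qed.

Section HopfBall.
Variables (y x0 : 'rV[R]_d) (r2 : R).
Hypotheses (r0 : 0 < r2) (x0r : sqn (x0 - y) = r2).
Hypothesis ballU : forall x, sqn (x - y) <= r2 -> U x.
Hypothesis u_ge0 : forall x, sqn (x - y) <= r2 -> 0 <= u x.
Hypothesis u_gt0 : forall x, sqn (x - y) < r2 -> 0 < u x.
Hypothesis ux0 : u x0 = 0.
Hypothesis Lu : forall x, sqn (x - y) < r2 -> elliptic a b u x <= c x * u x.

Let Q x := ((x - y) *m a x *m (x - y)^T) ord0 ord0.
Let S x := \tr (a x) + \sum_l b l x * (x - y) ord0 l.
(** The inner half of the ball is cut out because [Q] vanishes at the centre. *)
Let A := [set x : 'rV[R]_d | r2 / 4 <= sqn (x - y) <= r2].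

Let continuous_sqnBN x : {for x, continuous (fun x => - sqn (x - y))}.
Proof. exact: smooth_continuous (smoothN openT (smooth_sqnB y)) I. Qed.

Let compact_annulus : compact A.
Proof.
apply: (subclosed_compact _ (@compact_sqn_ball R d y r2)); last by move=> x /andP[].
have -> : A = [set x | - sqn (x - y) <= - (r2 / 4)] `&` [set x | sqn (x - y) <= r2].
  by apply/seteqP; split=> x /=; rewrite /A /= lerN2 => /andP.
apply: closedI.
  apply: (@closed_preimage_le _ _ (fun x => - sqn (x - y))) => x.
  exact: continuous_sqnBN.
by apply: (@closed_preimage_le _ _ (fun x => sqn (x - y))); exact: continuous_sqnB.
Qed.

Let AU x : A x -> U x. Proof. by move=> /andP[_ /ballU]. Qed.

Let A_x0 : A x0.
Proof. by have := r0; rewrite /A /= x0r lexx andbT => h; lra. Qed.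

Let continuous_coordB l x : {for x, continuous (fun z : 'rV[R]_d => (z - y) ord0 l)}.
Proof.
apply/differentiable_continuous; under eq_fun do rewrite submxE.
by apply: differentiableB => //; exact: differentiable_coord.
Qed.

Let continuous_Q x : U x -> {for x, continuous Q}.
Proof.
move=> Ux; change (continuous_at x Q); rewrite /Q; under eq_fun do rewrite quad_formE.
apply: continuous_bigsum => i; apply: continuous_bigsum => j.
apply: continuousM; first exact: ca.
by apply: (@continuousM _ _ (fun z : 'rV[R]_d => (z - y) ord0 i)); exact: continuous_coordB.
Qed.

Let continuous_S x : U x -> {for x, continuous S}.
Proof.
move=> Ux; apply: continuousD; first by apply: continuous_bigsum => i; exact: ca.
apply: continuous_bigsum => l; apply: continuousM; first exact: cb.
exact: continuous_coordB.
Qed.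

Let annulus_min (g : 'rV[R]_d -> R) : (forall x, U x -> {for x, continuous g}) ->
  exists2 z, A z & forall x, A x -> g z <= g x.
Proof.
move=> cg; have [|z Az zmin] := compact_EVT_min (ex_intro _ x0 A_x0) compact_annulus (f := g).
  exact: continuous_within AU cg.
exists z; first by rewrite inE in Az.
by move=> x Ax; apply: zmin; rewrite inE.
Qed.

Let Q_bound : exists2 q : R, 0 < q & forall x, A x -> q <= Q x.
Proof.
have [z Az zmin] := annulus_min continuous_Q.
exists (Q z) => //; have [_] := pa (AU Az); apply.
apply/eqP => zy; move: Az; rewrite /A /= zy sqn0 => /andP[+ _].
by rewrite leNgt divr_gt0.
Qed.

Let upper_bound_on (g : 'rV[R]_d -> R) : (forall x, U x -> {for x, continuous g}) ->
  exists2 k : R, 0 <= k & forall x, A x -> g x <= k.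
Proof.
move=> cg; have [|z Az zmin] := annulus_min (g := fun x => - g x).
  by move=> x Ux; apply: continuousN; exact: cg.
exists (Num.max 0 (g z)); first by rewrite le_max lexx.
by move=> x /zmin; rewrite lerN2 le_max => ->; rewrite orbT.
Qed.

Let barrier_subsolution : exists2 alpha : R, 0 < alpha &
  forall x, A x -> c x * barrier y alpha r2 x < elliptic a b (barrier y alpha r2) x.
Proof.
have [q q0 Qq] := Q_bound.
have [s s0 Ss] := upper_bound_on continuous_S.
have [k k0 Ck] := upper_bound_on cc.
(* Here q bounds [Q] from below, s bounds [S] and k bounds [c] from above on the annulus. The choice
   gives 4 alpha q = 4 q + 2 s + k; as alpha >= 1, multiplying by alpha yields 4 alpha^2 q > 2 alpha
   s + k. *)
pose alpha := 1 + (2 * s + k) / (4 * q).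
have alpha1 : 1 <= alpha.
  by rewrite /alpha lerDl divr_ge0 ?addr_ge0 ?mulr_ge0// ?ltW ?mulr_gt0.
have alphaq : 4 * alpha * q = 4 * q + (2 * s + k).
  by rewrite /alpha; field; exact: lt0r_neq0.
exists alpha; first by rewrite (lt_le_trans _ alpha1).
move=> x Ax; rewrite elliptic_barrier -/(Q x) -/(S x).
set e := expR _.
have e0 : 0 < e by exact: expR_gt0.
have cx := c_ge0 (AU Ax).
have h1 : c x * barrier y alpha r2 x <= c x * e.
  by rewrite ler_wpM2l// /barrier gerBl expR_ge0.
apply: (le_lt_trans h1); rewrite mulrC ltr_pM2l//.
have h2 : k + 2 * alpha * s < 4 * alpha ^+ 2 * q.
  have -> : 4 * alpha ^+ 2 * q = alpha * (4 * alpha * q) by ring.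
  rewrite alphaq; nra.
have h3 : 4 * alpha ^+ 2 * q <= 4 * alpha ^+ 2 * Q x.
  by rewrite ler_wpM2l ?Qq// mulr_ge0// sqr_ge0.
have h4 : 2 * alpha * S x <= 2 * alpha * s.
  by rewrite ler_wpM2l ?Ss// mulr_ge0// (le_trans _ alpha1).
by have h5 := Ck x Ax; lra.
Qed.

(** On the annulus [u] is compared with a multiple m v of the barrier. The function w = u - m v is
    nonnegative on both bounding spheres, and a negative interior minimum is excluded because v is a
    strict subsolution. Since w vanishes at [x0], its derivative towards the centre is nonnegative,
    which forces the outward derivative of [u] below that of m v, a negative number. *)
Lemma hopf : \sum_i (x0 - y) ord0 i * pd i u x0 < 0.
Proof.
have [alpha alpha0 Lv] := barrier_subsolution.
have r0' := r0.
pose v := barrier y alpha r2.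
have sv : smooth_on U v by apply: smooth_onS (@smooth_barrier R d y alpha r2).
pose y' := y + 2^-1 *: (x0 - y).
pose B := [set x : 'rV[R]_d | sqn (x - y) <= r2 / 4].
have By' : B y'.
  by rewrite /B /= /y' addrAC subrr add0r sqnZ x0r; lra.
have Br x : B x -> sqn (x - y) < r2.
  by move=> h; apply: (le_lt_trans h); lra.
(* As the barrier is at most 1, the minimum m of [u] on the inner ball gives u - m v >= 0 on the
   inner sphere. *)
have [m m0 mu] : exists2 m : R, 0 < m & forall x, B x -> m <= u x.
  have [|z Bz zmin] := compact_EVT_min (ex_intro _ y' By') (@compact_sqn_ball R d y (r2 / 4)) (f := u).
    apply: (@continuous_within _ _ _ U) => [x /Br /ltW /ballU//|x Ux].
    exact: smooth_continuous su Ux.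
  rewrite inE in Bz; exists (u z); first exact/u_gt0/Br.
  by move=> x Bx; apply: zmin; rewrite inE.
pose w x := u x - m * v x.
have sw : smooth_on U w.
  apply: smoothB => //; apply: smoothM => //; exact: smooth_cst.
have v_le1 x : v x <= 1.
  rewrite /v /barrier lerBlDr; apply: (@le_trans _ _ 1).
    by rewrite -expR0 ler_expR mulNr oppr_le0 mulr_ge0 ?sqn_ge0// ltW.
  by rewrite lerDl expR_ge0.
have w_ge0 x : A x -> 0 <= w x.
  have [z Az zmin] := annulus_min (fun x Ux => smooth_continuous sw Ux).
  move=> /zmin; apply: le_trans; rewrite leNgt; apply/negP => wz.
  have Uz := AU Az; have [z1 z2] := andP Az.
  have z1' : r2 / 4 < sqn (z - y).
    rewrite lt_neqAle z1 andbT; apply/eqP => zE.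
    have Bz : B z by rewrite /B /= zE.
    move: wz; rewrite ltNge subr_ge0 => /negP; apply.
    by apply: le_trans (mu z Bz); rewrite ger_pMr.
  have z2' : sqn (z - y) < r2.
    rewrite lt_neqAle z2 andbT; apply/eqP => zE.
    move: wz; rewrite /w /v /barrier zE subrr mulr0 subr0 ltNge => /negP; apply.
    exact: u_ge0.
  pose O := [set x : 'rV[R]_d | sqn (x - y) < r2] `&` [set x | - sqn (x - y) < - (r2 / 4)].
  have oO : open O.
    apply: openI; first exact: open_sqn_ball.
    apply: (@open_comp _ _ (fun x => - sqn (x - y)) [set s | s < - (r2 / 4)]) => [t _|]; last exact: open_lt.
    exact: continuous_sqnBN.
  have OA t : O t -> A t by move=> [/= t1]; rewrite ltrN2 => t2; rewrite /A /= !ltW.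
  have Oz : O z by split => //=; rewrite ltrN2.
  have sO : smooth_on O w by apply: smooth_onS sw => t /OA /AU.
  have Lw : 0 <= elliptic a b w z.
    by apply: (elliptic_at_min oO Oz sO) (pa Uz) => t /OA /zmin.
  move: Lw; rewrite ellipticB// leNgt => /negP; apply.
  have h1 := Lu z2'; have h2 := Lv z Az.
  have h3 : m * (c z * v z) < m * elliptic a b v z by rewrite ltr_pM2l.
  (* This is where [c >= 0] enters: at a negative value of w the zeroth order term has the
     favourable sign. *)
  have h4 : c z * w z <= 0 by rewrite mulr_ge0_le0 ?c_ge0// ltW.
  have h5 : c z * w z = c z * u z - m * (c z * v z) by rewrite /w; ring.
  lra.
have Ux0 := AU A_x0.
have dw := smooth_differentiable sw Ux0.
have vx0 : v x0 = 0 by rewrite /v /barrier x0r subrr.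
have wx0 : w x0 = 0 by rewrite /w ux0 vx0 mulr0 subrr.
have : 0 <= 'D_(y - x0) w x0.
  (* The inner radius is half the outer one, so moving less than half way towards the centre stays
     in the annulus. *)
  apply: (@derive_ge0_right _ _ _ _ _ 2^-1) => // s /andP[s0 s1].
  rewrite wx0; apply: w_ge0; rewrite /A /=.
  have -> : x0 + s *: (y - x0) - y = (1 - s) *: (x0 - y).
    by rewrite scalerBl scale1r -[y - x0]opprB scalerN addrAC.
  have s2 : s < 1 / 2 by rewrite div1r.
  have k1 : 0 <= (1 - s) ^+ 2 - 1 / 4.
    have -> : (1 - s) ^+ 2 - 1 / 4 = (1 / 2 - s) * (3 / 2 - s) by field.
    by apply: mulr_ge0; lra.
  have k2 : 0 <= 1 - (1 - s) ^+ 2.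
    have -> : 1 - (1 - s) ^+ 2 = s * (2 - s) by ring.
    by apply: mulr_ge0; lra.
  rewrite sqnZ x0r -subr_ge0 -[X in _ && X]subr_ge0.
  have -> : (1 - s) ^+ 2 * r2 - r2 / 4 = ((1 - s) ^+ 2 - 1 / 4) * r2 by field.
  have -> : r2 - (1 - s) ^+ 2 * r2 = (1 - (1 - s) ^+ 2) * r2 by ring.
  by rewrite !mulr_ge0// ltW.
rewrite derive_sum_partial// -pdE.
have du := smooth_differentiable su Ux0.
have dv := smooth_differentiable sv Ux0.
have E i : pd i w x0 = pd i u x0 - m * pd i v x0.
  rewrite pdB; [|exact: du|exact: (@differentiableM _ _ (fun=> m) v)].
  by rewrite pdZ.
have -> : \sum_i (y - x0) ord0 i * pd i w x0 =
  - \sum_i (x0 - y) ord0 i * pd i u x0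
  - 2 * m * alpha * expR (- alpha * r2) * r2.
  rewrite -[in RHS]x0r mulr_sumr -!sumrN -big_split/=; apply: eq_bigr => i _.
  by rewrite E /v pd_barrier x0r !submxE; ring.
have : 0 < 2 * m * alpha * expR (- alpha * r2) * r2 by rewrite !mulr_gt0 ?expR_gt0.
lra.
Qed.

End HopfBall.

(** If [u] were nonzero at some y near [x0], let z be the zero of [u] closest to y. The open ball
    about y through z contains no zero, so Hopf's lemma gives a nonzero gradient at z, whereas z is
    an interior minimum. *)
Lemma strong_minimum x0 : U x0 -> (forall x, U x -> 0 <= u x) ->
  (forall x, U x -> elliptic a b u x <= c x * u x) -> u x0 = 0 ->
  \forall x \near x0, u x = 0.
Proof.
move=> Ux0 u0 Lu ux0.
have [r2 r0 rU] := sqn_ball_nbhs (open_nbhs_nbhs (conj oU Ux0)).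
(* By [sqnD_le], two displacements of squared length at most r2 / 8 add up to squared length at most
   r2 / 2, so the balls used below stay in U. *)
have r8 : 0 < r2 / 8 by rewrite divr_gt0.
apply: (@filterS _ _ _ [set y | sqn (y - x0) < r2 / 8]); last first.
  apply: open_nbhs_nbhs; split; first exact: open_sqn_ball.
  by rewrite /= subrr sqn0.
move=> y /= yr; apply/eqP/negPn/negP => uy0.
pose K := [set z : 'rV[R]_d | sqn (z - y) <= r2 / 8].
have KU z : K z -> U z.
  move=> zK; apply: rU; have := sqnD_le (z - y) (y - x0).
  rewrite addrA subrK => h; apply: (le_lt_trans h).
  by move: zK yr; rewrite /K /=; lra.
pose Z := [set z | K z /\ u z = 0].
have Zx0 : Z x0 by split=> //; rewrite /K /= sqnB ltW.
have cZ : compact Z.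
  apply: (subclosed_compact _ (@compact_sqn_ball R d y (r2 / 8))); last by move=> z [].
  move=> z clz; have Kz : K z.
    have clK : closed K.
      by apply: (@closed_preimage_le _ _ (fun x => sqn (x - y))); exact: continuous_sqnB.
    by apply: clK; apply: closureS clz => t [].
  split => //; apply/eqP/negPn/negP => uz0.
  have cu : {for z, continuous u} by exact: smooth_continuous su (KU z Kz).
  have nz : nbhs z [set t | u t != 0].
    apply: (cu [set s : R | s != 0]); apply: open_nbhs_nbhs; split; last exact: uz0.
    exact: open_neq.
  by have [t [[_ /eqP ut] /negP]] := clz _ nz.
have [|z Zz zmin] := compact_EVT_min (ex_intro _ x0 Zx0) cZ (f := fun z => sqn (z - y)).
  by apply: (@continuous_within _ _ _ setT) => // x _; exact: continuous_sqnB.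
rewrite inE in Zz; case: Zz => Kz uz.
have zy : 0 < sqn (z - y).
  by apply: sqn_gt0; apply: contra uy0; rewrite subr_eq0 => /eqP <-; exact/eqP.
have ball_le x : sqn (x - y) <= sqn (z - y) -> U x.
  by move=> h; apply: KU; exact: le_trans h Kz.
suff : \sum_i (z - y) ord0 i * pd i u z < 0.
  rewrite big1 ?ltxx// => i _.
  rewrite (pd_at_min oU (KU z Kz) su) ?mulr0// => t Ut.
  by rewrite uz u0.
apply: (hopf zy erefl) => // [x /ball_le Ux|x xz|x /ltW /ball_le Ux]; [exact: u0| |exact: Lu].
have Ux := ball_le x (ltW xz).
rewrite lt_neqAle u0// andbT eq_sym; apply/eqP => ux.
have : x \in Z by rewrite inE; split => //; exact: le_trans (ltW xz) Kz.
by move=> /zmin; rewrite leNgt xz.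
Qed.

End Hopf.

(** * Mean curvature of a hypersurface *)

Section HalfSpace.
Context {R : realType} {n : nat}.

Lemma derive_opp_delta (h : 'rV[R]_n.+1 -> R) x i : differentiable h x ->
  'D_(- delta_mx ord0 i) h x = - pd i h x.
Proof. by move=> dh; rewrite deriveE// linearN pdE partialE. Qed.

Lemma pd_eq0_ray (h : 'rV[R]_n.+1 -> R) x i (r : R) :
  0 < r -> differentiable h x ->
  (forall t, 0 < t < r -> h (x + t *: (- delta_mx ord0 i)) = h x) ->
  pd i h x = 0.
Proof.
move=> r0 dh hx; apply/eqP; rewrite eq_le -oppr_ge0; apply/andP; split.
  rewrite -derive_opp_delta//; apply: (derive_ge0_right r0 dh) => t /hx ->.
  exact: lexx.
have dh' : differentiable (fun y => - h y) x by exact: differentiableN.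
have -> : pd i h x = - pd i (fun y => - h y) x by rewrite pdE partialN// opprK.
rewrite -derive_opp_delta//; apply: (derive_ge0_right r0 dh') => t /hx ->.
exact: lexx.
Qed.

Lemma ray_in_open (O : set 'rV[R]_n.+1) x i : open O -> O x ->
  exists2 r : R, 0 < r & forall t, 0 < t < r -> O (x + t *: (- delta_mx ord0 i)).
Proof.
move=> oO Ox.
have [r r0 Hr] := nbhs_line (- delta_mx ord0 i) 0 (open_nbhs_nbhs (conj oO Ox)).
exists r => // t /andP[t0 tr].
have := Hr t 0; rewrite scale0r addr0 normr0; apply; last exact: ltW.
by rewrite gtr0_norm// ltW.
Qed.

(** For every [i] the ray in direction [- delta_mx ord0 i] stays in the closed half-space: it points
    inwards for index 0 and is tangential otherwise. All first derivatives at the boundary, the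
    normal one included, are thus determined by the values on one side. *)
Lemma pd_eq0_halfspace (O : set 'rV[R]_n.+1) (h : 'rV[R]_n.+1 -> R) x i :
  open O -> O x -> differentiable h x -> x ord0 ord0 <= 0 ->
  (forall y, O y -> y ord0 ord0 <= 0 -> h y = 0) -> pd i h x = 0.
Proof.
move=> oO Ox dh x0 h0; have [r r0 Hr] := ray_in_open i oO Ox.
apply: (pd_eq0_ray r0 dh) => t /[dup] /andP[t0 _] /Hr Ot.
rewrite !h0// !mxE mulrN -oppr_ge0 opprD opprK addr_ge0 ?oppr_ge0//.
by rewrite mulr_ge0 ?(ltW t0)// ler0n.
Qed.

Lemma pd_tangential (O : set 'rV[R]_n.+1) (h : 'rV[R]_n.+1 -> R) x a :
  open O -> O x -> differentiable h x -> x ord0 ord0 = 0 ->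
  (forall y, O y -> y ord0 ord0 = 0 -> h y = 0) -> pd (lift ord0 a) h x = 0.
Proof.
move=> oO Ox dh x0 h0; have [r r0 Hr] := ray_in_open (lift ord0 a) oO Ox.
apply: (pd_eq0_ray r0 dh) => t /Hr Ot.
by rewrite !h0// !mxE/= oppr0 mulr0 addr0.
Qed.

Lemma pd_normal_le0 (O : set 'rV[R]_n.+1) (h : 'rV[R]_n.+1 -> R) x :
  open O -> O x -> differentiable h x -> x ord0 ord0 = 0 -> h x = 0 ->
  (forall y, O y -> y ord0 ord0 < 0 -> 0 <= h y) -> pd ord0 h x <= 0.
Proof.
move=> oO Ox dh x0 hx0 h0; have [r r0 Hr] := ray_in_open ord0 oO Ox.
rewrite -oppr_ge0 -derive_opp_delta//; apply: (derive_ge0_right r0 dh) => t tr.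
rewrite hx0; apply: h0; first exact: Hr.
by rewrite !mxE/= x0 add0r mulrN1 oppr_lt0; case/andP: tr.
Qed.

End HalfSpace.

Section MeanCurvature.
Context {R : realType} {n : nat}.
Implicit Types (G : 'rV[R]_n.+1 -> 'M[R]_n.+1) (x : 'rV[R]_n.+1).

Lemma posdef_induced G x : posdef (G x) -> posdef (induced_metric G x).
Proof.
move=> [sG pG]; split.
  by apply/matrixP => a b; rewrite !mxE -[in LHS]sG trmxE.
move=> v v0.
pose w : 'rV[R]_n.+1 := \row_k (if unlift ord0 k is Some a then v ord0 a else 0).
have wl a : w ord0 (lift ord0 a) = v ord0 a by rewrite mxE liftK.
have w0 : w ord0 ord0 = 0 by rewrite mxE unlift_none.
have := pG w; rewrite !quad_formE.
have -> : \sum_i \sum_j G x i j * (w ord0 i * w ord0 j) =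
    \sum_i \sum_j induced_metric G x i j * (v ord0 i * v ord0 j).
  rewrite big_ord_recl [X in X + _]big1 ?add0r => [|j _]; last by rewrite w0 mul0r mulr0.
  apply: eq_bigr => a _; rewrite big_ord_recl w0 !mulr0 add0r.
  by apply: eq_bigr => b _; rewrite !wl mxE.
apply; apply: contra_neq v0 => /rowP wz; apply/rowP => a.
by rewrite -wl wz !mxE.
Qed.

(** The normal is the normalized gradient of x_0, so lowering its index gives a multiple of dx_0.
    Only Christoffel symbols with upper index 0 then enter the second fundamental form. *)
Lemma normal_lower G x k : posdef (G x) ->
  \sum_l G x k l * unit_normal G x ord0 l =
  (k == ord0)%:R / Num.sqrt (invmx (G x) ord0 ord0).
Proof.
move=> pG; transitivity ((\sum_l G x k l * invmx (G x) l ord0) / Num.sqrt (invmx (G x) ord0 ord0)).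
  by rewrite mulr_suml; apply: eq_bigr => l _; rewrite [X in _ * X]mxE mulrA.
by rewrite -mulmxE mulmxV ?posdef_unit// mxE.
Qed.

Lemma second_fundamental_formE G x a b : posdef (G x) ->
  second_fundamental_form G x a b =
  - (christoffel G ord0 (lift ord0 a) (lift ord0 b) x / Num.sqrt (invmx (G x) ord0 ord0)).
Proof.
move=> pG; rewrite mxE; congr (- _).
transitivity (\sum_k christoffel G k (lift ord0 a) (lift ord0 b) x *
    ((k == ord0)%:R / Num.sqrt (invmx (G x) ord0 ord0))).
  apply: eq_bigr => k _; rewrite -normal_lower// mulr_sumr.
  by apply: eq_bigr => l _; rewrite mulrA.
rewrite big_ord_recl eqxx mul1r big1 ?addr0// => k _.
by rewrite mul0r mulr0.
Qed.

(** The formula involves first derivatives only. This serves two metrics that coincide on one side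
    of the hypersurface and hence have the same first derivatives on it. *)
Lemma eq_local_mean_curvature G H x : posdef (G x) -> G x = H x ->
  (forall i j k, pd i (fun y => G y j k) x = pd i (fun y => H y j k) x) ->
  local_mean_curvature G x = local_mean_curvature H x.
Proof.
move=> pG GH dGH; rewrite /local_mean_curvature; congr (\tr (invmx _ *m _)).
  by apply/matrixP => a b; rewrite !mxE GH.
apply/matrixP => a b; rewrite !second_fundamental_formE -?GH//.
congr (- (_ / _)); rewrite !christoffelE GH; congr (_ * _); apply: eq_bigr => l _.
by rewrite !dGH.
Qed.

(** For upper index 0 and tangential lower indices the Kronecker terms of the connection change
    vanish, and only - G_ab G^00 d_0 f is left. The second fundamental form thus changes by a
    multiple of the induced metric, whose trace is n. *)
Lemma local_mean_curvature_conformal (U : set 'rV[R]_n.+1) G Gt f x :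
  open U -> mx_smooth U G -> (forall x, U x -> posdef (G x)) -> smooth_on U f ->
  (forall x, U x -> Gt x = expR (2 * f x) *: G x) ->
  U x -> f x = 0 -> (forall a, pd (lift ord0 a) f x = 0) ->
  local_mean_curvature G x - local_mean_curvature Gt x =
  - (n%:R * (Num.sqrt (invmx (G x) ord0 ord0) * pd ord0 f x)).
Proof.
move=> oU sG pG sf GtE Ux fx tf.
have pGx := pG x Ux.
have Gx : Gt x = G x by rewrite GtE// fx mulr0 expR0 scale1r.
have iE : induced_metric Gt x = induced_metric G x.
  by apply/matrixP => a b; rewrite !mxE Gx.
have g0 : 0 < invmx (G x) ord0 ord0 by apply: posdef_diag; exact: posdef_inv.
set s := Num.sqrt _.
have s0 : 0 < s by rewrite sqrtr_gt0.
have sE : invmx (G x) ord0 ord0 = s * s by rewrite -expr2 sqr_sqrtr// ltW.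
have IIE : second_fundamental_form Gt x =
    second_fundamental_form G x + (s * pd ord0 f x) *: induced_metric G x.
  apply/matrixP => a b; rewrite addmxE scalemxE !second_fundamental_formE ?Gx//.
  rewrite (christoffel_conformal oU sG pG sf GtE) // CdiffE -/s big_ord_recl big1 => [|l _].
    rewrite sE [induced_metric G x a b]mxE !(negbTE (neq_lift _ _)) !mulr0n.
    by field; exact: lt0r_neq0.
  by rewrite tf mulr0.
rewrite /local_mean_curvature iE IIE mulmxDr mxtraceD opprD addrA subrr add0r.
rewrite -scalemxAr mulVmx ?posdef_unit//; last exact: posdef_induced.
by rewrite mxtraceZ mxtrace1 mulrC.
Qed.

End MeanCurvature.

(** * Charts of a manifold *)

(** Within A the level set is open by hypothesis and closed by continuity. *)
Lemma connected_level_set {R : realType} (T : topologicalType) (A : set T)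
    (u : T -> R) (m : R) : connected A ->
  (forall p, A p -> {for p, continuous u}) ->
  (forall p, A p -> u p = m -> \forall q \near p, u q = m) ->
  (exists2 p, A p & u p = m) -> forall p, A p -> u p = m.
Proof.
move=> cA cu ou [p0 Ap0 up0] p Ap.
pose Z := A `&` [set p | u p = m].
suff ZA : Z = A by move: Ap; rewrite -ZA => -[].
apply: cA; first by exists p0.
- exists [set q | \forall r \near q, u r = m].
    by rewrite openE => q /= uq; exact: nbhs_interior uq.
  apply/seteqP; split=> [q [Aq uq]|q [Aq /nbhs_singleton uq]]; split => //.
  exact: ou.
- exists (closure Z); first exact: closed_closure.
  apply/seteqP; split=> [q [Aq uq]|q [Aq clq]]; split => //.
    by apply: subset_closure.
  apply/eqP/negPn/negP => uqm.
  have nz : nbhs q [set r | u r != m].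
    apply: (cu q Aq [set s : R | s != m]); apply: open_nbhs_nbhs; split; last exact: uqm.
    exact: open_neq.
  by have [r [[_ /eqP ur] /negP]] := clq _ nz.
Qed.

(** An open set without boundary points is also closed. *)
Lemma boundary_nonempty (T : topologicalType) (A : set T) :
  connected [set: T] -> open A -> A !=set0 -> A `<` [set: T] ->
  boundary A !=set0.
Proof.
move=> cT oA A0 [_ nA]; apply/set0P/eqP => b0.
have AT : A = [set: T].
  apply: cT => //; first by exists A => //; rewrite setTI.
  exists A; last by rewrite setTI.
  move=> p clp; have [//|np] := pselect (A p).
  have : boundary A p by split => // /interior_subset.
  by rewrite b0.
by apply: nA; rewrite AT.
Qed.

(** * Metrics and scalar curvature read in charts *)

Section Charts.
Context {R : realType} {d : nat} {M : manifold R d}.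
Implicit Types (c e : chart R d M) (p q : M).

Definition chart_image c (A : set M) := cmap c @` (cdom c `&` A).

Lemma cmap_continuous c p : atlas M c -> cdom c p -> {for p, continuous (cmap c)}.
Proof.
move=> /atlas_chart[oD _ _ cm _] cp.
by move: cm; rewrite continuous_open_subspace// => cm; apply: cm; rewrite inE.
Qed.

Lemma cinv_continuous c p : atlas M c -> cdom c p -> {for cmap c p, continuous (cinv c)}.
Proof.
move=> /atlas_chart[_ oI _ _ cm] cp.
move: cm; rewrite continuous_open_subspace// => cm; apply: cm; rewrite inE.
by exists p.
Qed.

Lemma cmapK c p : atlas M c -> cdom c p -> cinv c (cmap c p) = p.
Proof. by move=> /atlas_chart[_ _ mK _ _]; exact: mK. Qed.

Lemma nbhs_cdom c p : atlas M c -> cdom c p -> nbhs p (cdom c).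
Proof. by move=> /atlas_chart[oD _ _ _ _] cp; exact: open_nbhs_nbhs. Qed.

Lemma nbhs_chart_image c p (A : set M) : atlas M c -> cdom c p -> nbhs p A ->
  nbhs (cmap c p) (chart_image c A).
Proof.
move=> ac cp nA.
have oI := chart_open_img (atlas_chart ac).
have nI : nbhs (cmap c p) (cmap c @` cdom c).
  by apply: open_nbhs_nbhs; split => //; exists p.
have nC : nbhs (cmap c p) (cinv c @^-1` (cdom c `&` A)).
  apply: (cinv_continuous ac cp); rewrite cmapK//.
  by apply: filterI => //; exact: nbhs_cdom.
apply: filterS2 nI nC => x [q cq <-] /=; rewrite cmapK// => qA.
by exists q.
Qed.

Lemma open_chart_image c (A : set M) : atlas M c -> open A -> open (chart_image c A).
Proof.
move=> ac; rewrite !openE => oA x [p [cp Ap] <-].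
by apply: nbhs_chart_image => //; exact: oA.
Qed.

Lemma nbhs_chart_pullback c p (P : set 'rV[R]_d) : atlas M c -> cdom c p ->
  nbhs (cmap c p) P -> nbhs p (fun q => P (cmap c q)).
Proof. by move=> ac cp nP; exact: cmap_continuous ac cp _ nP. Qed.

Lemma chart_imageP c (A : set M) x : atlas M c -> chart_image c A x ->
  [/\ cdom c (cinv c x), A (cinv c x) & cmap c (cinv c x) = x].
Proof. by move=> ac [p [cp Ap] <-]; rewrite cmapK. Qed.

Lemma smooth_fun_continuous (W : set M) (f : M -> R) p : open W -> smooth_fun W f ->
  W p -> {for p, continuous f}.
Proof.
move=> oW sf Wp; have [ac cp] := chart_atP p; set c := chart_at p in ac cp.
have cf : {for cmap c p, continuous (f \o cinv c)}.
  by apply: smooth_continuous (sf c ac) _; exists p.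
have cfc : {for p, continuous ((f \o cinv c) \o cmap c)}.
  by apply: continuous_comp cf; exact: cmap_continuous.
move=> A; rewrite -[in X in X -> _](cmapK ac cp) => nA.
apply: filterS2 (nbhs_cdom ac cp) (cfc A nA) => q cq /=.
by rewrite cmapK.
Qed.

Section MetricInChart.
Variables (V : set M) (g : tensor2 M).
Hypotheses (oV : open V) (mg : is_metric V g).

Lemma mx_smooth_in_chart c : atlas M c -> mx_smooth (chart_image c V) (in_chart g c).
Proof. by move=> ac i j; exact: (metric_smooth mg). Qed.

Lemma posdef_metric c p : atlas M c -> cdom c p -> V p -> posdef (g c p).
Proof.
by move=> ac cp Vp; split; [exact: (Defs.metric_sym mg ac cp Vp)|exact: (metric_pos mg ac cp Vp)].
Qed.

Lemma posdef_in_chart c x : atlas M c -> chart_image c V x -> posdef (in_chart g c x).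
Proof. by move=> ac /(chart_imageP ac)[cx Vx _]; exact: posdef_metric. Qed.

End MetricInChart.

Section Transition.
Variables (c e : chart R d M).
Hypotheses (ac : atlas M c) (ae : atlas M e).

Let tau x := cmap e (cinv c x).

Lemma smooth_tau k : smooth_on (chart_image c (cdom e)) (fun x => tau x ord0 k).
Proof. exact: (atlas_smooth ac ae). Qed.

Lemma jac_transition p : cdom c p -> cdom e p ->
  lin1_mx ('d (cmap e \o cinv c) (cmap c p)) = jac tau (cmap c p).
Proof.
move=> cp ep; apply/matrixP => i k; rewrite jacE pdE jacobianE// => l.
by apply: smooth_differentiable (smooth_tau l) _; exists p.
Qed.

Lemma metric_change (V : set M) (g : tensor2 M) p : is_metric V g ->
  cdom c p -> cdom e p -> V p ->
  g c p = jac tau (cmap c p) *m g e p *m (jac tau (cmap c p))^T.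
Proof.
move=> mg cp ep Vp; have := metric_transition mg ac ae cp ep Vp.
by rewrite /= jac_transition.
Qed.

Lemma scalar_chart_change (V : set M) (g : tensor2 M) p : open V -> is_metric V g ->
  cdom c p -> cdom e p -> V p ->
  Defs.scalar (in_chart g c) (cmap c p) = Defs.scalar (in_chart g e) (cmap e p).
Proof.
move=> oV mg cp ep Vp.
have oE : open (cdom e) by exact: chart_open_dom (atlas_chart ae).
have sub : chart_image c (cdom e `&` V) `<=` chart_image c V.
  by move=> x [q [cq [eq Vq]] <-]; exists q.
rewrite (@scalar_change _ _ (chart_image c (cdom e `&` V)) (chart_image e V)
  (in_chart g c) (in_chart g e) tau).
- by rewrite /tau cmapK.
- by apply: open_chart_image => //; exact: openI.
- exact: open_chart_image.
- by move=> i j; exact: mx_smooth_in_chart.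
- by move=> x /sub; exact: posdef_in_chart.
- by move=> x; exact: posdef_in_chart.
- move=> k; apply: smooth_onS (smooth_tau k) => x [q [cq [eq Vq]] <-].
  by exists q.
- by move=> x [q [cq [eq Vq]] <-]; rewrite /tau cmapK//; exists q.
- move=> x [q [cq [eq Vq]] <-]; rewrite /in_chart /tau !cmapK//.
  exact: metric_change mg cq eq Vq.
- by move=> i j; apply: smooth_onS (mx_smooth_in_chart mg ac i j).
- by exists p.
Qed.

End Transition.

(** The chart [chart_at p] varies with p in an uncontrolled way. Reading the scalar curvature in one
    fixed chart around a point makes it a smooth function there. *)
Lemma scalar_curvature_chart (V : set M) (g : tensor2 M) e p : open V -> is_metric V g ->
  atlas M e -> cdom e p -> V p ->
  scalar_curvature g p = Defs.scalar (in_chart g e) (cmap e p).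
Proof.
move=> oV mg ae ep Vp; have [ac cp] := chart_atP p.
exact: scalar_chart_change oV mg cp ep Vp.
Qed.

End Charts.

(** * The maximum principle for the conformal factor *)

Lemma eq_scalar {R : realType} {d} (O : set 'rV[R]_d) (G H : 'rV[R]_d -> 'M[R]_d) x :
  open O -> (forall y, O y -> G y = H y) -> O x -> Defs.scalar G x = Defs.scalar H x.
Proof.
move=> oO GH Ox.
have chE k i j y : O y -> christoffel G k i j y = christoffel H k i j y.
  move=> Oy; rewrite !christoffelE GH//; congr (_ * _); apply: eq_bigr => l _.
  have E a b c : pd a (fun z => G z b c) y = pd a (fun z => H z b c) y.
    by apply: eq_pd; apply: (open_near oO) Oy => z /GH ->.
  by rewrite !E.
rewrite /Defs.scalar; apply: eq_bigr => j _; apply: eq_bigr => k _.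
congr (_ * _); first by rewrite (GH x Ox).
rewrite !ricciE; apply: eq_bigr => i _.
have E a b c e : pd a (christoffel G b c e) x = pd a (christoffel H b c e) x.
  by apply: eq_pd; apply: (open_near oO) Ox => z; exact: chE.
rewrite !E; congr (_ + _); apply: eq_bigr => m _.
have F : (fun a b c => christoffel G a b c x) = (fun a b c => christoffel H a b c x).
  by apply/funext => a; apply/funext => b; apply/funext => c; exact: chE.
exact: (congr1 (fun C : 'I_d -> 'I_d -> 'I_d -> R =>
  C i i m * C m j k - C i j m * C m i k) F).
Qed.

Section EllipticLinear.
Context {R : realType} {d : nat}.
Variables (U : set 'rV[R]_d) (a : 'rV[R]_d -> 'M[R]_d) (b : 'I_d -> 'rV[R]_d -> R).
Hypothesis oU : open U.

Lemma elliptic_cst (k : R) x : elliptic a b (fun=> k) x = 0.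
Proof.
have E j : pd j (fun=> k) = fun=> 0 :> R by apply/funext => y; exact: pd_cst.
rewrite /elliptic !big1 ?addr0// => [l _|i _]; first by rewrite pd_cst mulr0.
by rewrite big1// => j _; rewrite E pd_cst mulr0.
Qed.

Lemma ellipticZ (k : R) w x : U x -> smooth_on U w ->
  elliptic a b (fun z => k * w z) x = k * elliptic a b w x.
Proof.
move=> Ux sw; have := ellipticB a b oU (- k) Ux (smooth_cst 0) sw.
rewrite elliptic_cst sub0r mulNr opprK => <-.
by under eq_fun do rewrite -[k * _]opprK -mulNr -[- (- k * _)]add0r.
Qed.

Lemma ellipticBc (k : R) w x : U x -> smooth_on U w ->
  elliptic a b (fun z => w z - k) x = elliptic a b w x.
Proof.
move=> Ux sw; have := ellipticB a b oU k Ux sw (smooth_cst 1).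
rewrite elliptic_cst mulr0 subr0 => <-.
by under [in RHS]eq_fun do rewrite mulr1.
Qed.

End EllipticLinear.

(** * The elliptic inequality for the conformal factor and its consequences *)

Section ConformalFactor.
Context {R : realType} {n : nat} {M : manifold R n.+1}.
Hypothesis n_gt0 : (0 < n)%N.
Variables (gbar g : tensor2 M) (Omega V W : set M) (f : M -> R).
Hypothesis mgbar : is_metric [set: M] gbar.
Hypothesis Rbar_le0 : forall p, scalar_curvature gbar p <= 0.
Hypotheses (oO : open Omega) (oV : open V) (oW : open W).
Hypotheses (OV : Omega `<=` V) (clW : closure Omega `<=` W).
Hypotheses (mg : is_metric V g) (sf : smooth_fun W f).
Hypothesis gE : forall p, Omega p -> forall c, atlas M c -> cdom c p ->
  g c p = expR (2 * f p) *: gbar c p.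

Let OW : Omega `<=` W. Proof. by move=> p Op; apply/clW/subset_closure. Qed.

(** The coefficient 2(N - 1) of the second order part in dimension N = [n.+1]; dividing by it is
    where N >= 2 is used. *)
Let K : R := 2 * (n.+1%:R - 1).

Let K_gt0 : 0 < K.
Proof. by rewrite /K mulr_gt0// -natr1 addrK ltr0n. Qed.

Definition inv_chart e x := invmx (in_chart gbar e x).

Lemma chart_imageS e (A B : set M) : A `<=` B -> chart_image e A `<=` chart_image e B.
Proof. by move=> AB x [p [ep /AB Bp] <-]; exists p. Qed.

Lemma smooth_gbar e (A : set M) : atlas M e -> mx_smooth (chart_image e A) (in_chart gbar e).
Proof.
by move=> ae i j; apply: smooth_onS (mx_smooth_in_chart mgbar ae i j); exact: chart_imageS.
Qed.

Lemma posdef_gbar e (A : set M) x : atlas M e -> chart_image e A x -> posdef (in_chart gbar e x).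
Proof.
move=> ae Ax; apply: (posdef_in_chart mgbar ae); move: Ax; exact: chart_imageS.
Qed.

(** The conformal law solved for its second order part. The coefficients [b] contain [f] itself and
    are smooth on the image of W, hence also at the boundary points where Hopf's lemma will be
    applied. *)
Lemma conformal_equation e : atlas M e ->
  exists b : 'I_n.+1 -> 'rV[R]_n.+1 -> R,
  (forall l, smooth_on (chart_image e W) (b l)) /\
  forall p, Omega p -> cdom e p ->
    elliptic (inv_chart e) b (f \o cinv e) (cmap e p) =
    (scalar_curvature gbar p - expR (2 * f p) * scalar_curvature g p) / K.
Proof.
move=> ae; set U := chart_image e W.
have oU : open U by exact: open_chart_image.
pose F := f \o cinv e.
have sF : smooth_on U F by exact: sf.
(* This metric is defined on all of W, whereas g is known to have this form only on Omega. Since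
   Omega is open, the scalar curvatures agree there. *)
pose Gt x := expR (2 * F x) *: in_chart gbar e x.
have [beta [sb E]] := scalar_conformal oU (@smooth_gbar e W ae)
  (fun x => @posdef_gbar e W x ae) sF (fun x (_ : U x) => erefl (Gt x)).
exists (fun l x => - K^-1 * beta l x); split=> [l|p Op ep].
  by apply: smoothM => //; exact: smooth_cst.
have Up : U (cmap e p) by exists p => //; split => //; exact: OW.
have -> : scalar_curvature g p = Defs.scalar Gt (cmap e p).
  rewrite (scalar_curvature_chart oV mg ae ep (OV Op)).
  apply: (eq_scalar (O := chart_image e Omega)); first exact: open_chart_image.
    by move=> x [q [eq Oq] <-]; rewrite /Gt /F /in_chart /= cmapK// gE.
  by exists p.
rewrite (scalar_curvature_chart openT mgbar ae ep I).
have := E _ Up; rewrite -/K /F /= cmapK// => T.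
rewrite /elliptic -/(metric_hessian (in_chart gbar e) F (cmap e p)).
have -> : \sum_l - K^-1 * beta l (cmap e p) * pd l F (cmap e p) =
    - K^-1 * \sum_l beta l (cmap e p) * pd l F (cmap e p).
  by rewrite mulr_sumr; apply: eq_bigr => l _; rewrite mulrA.
have K0 := lt0r_neq0 K_gt0.
rewrite -T /=; move: (Defs.scalar _ _) (Defs.scalar _ _) (metric_hessian _ _ _) K0 => A B C K0.
by field; exact: K0.
Qed.

Section Signed.
Variable s : R.
Hypothesis s1 : s = 1 \/ s = -1.
Hypothesis Rs : forall p, Omega p -> s * scalar_curvature gbar p <= s * scalar_curvature g p.

Let u p : R := s * f p.

Let smooth_u e : atlas M e -> smooth_on (chart_image e W) (u \o cinv e).
Proof.
move=> ae; apply: smoothM; [exact: open_chart_image|exact: smooth_cst|exact: sf].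
Qed.

Let continuous_u p : W p -> {for p, continuous u}.
Proof.
move=> Wp; apply: (@smooth_fun_continuous _ _ _ W) => // e ae; exact: smooth_u.
Qed.

Lemma signed_inequality e : atlas M e ->
  exists b : 'I_n.+1 -> 'rV[R]_n.+1 -> R,
  (forall l, smooth_on (chart_image e W) (b l)) /\
  forall p, Omega p -> cdom e p ->
    elliptic (inv_chart e) b (u \o cinv e) (cmap e p) <=
    s * (1 - expR (2 * f p)) * scalar_curvature gbar p / K.
Proof.
move=> ae; have [b [sb E]] := conformal_equation ae.
exists b; split=> // p Op ep.
have oU : open (chart_image e W) by exact: open_chart_image.
have Up : chart_image e W (cmap e p) by exists p => //; split => //; exact: OW.
rewrite (ellipticZ _ _ oU s Up (sf ae)) E// mulrA ler_pM2r ?invr_gt0//.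
rewrite -subr_ge0; have := Rs Op.
move: (scalar_curvature gbar p) (scalar_curvature g p) => Rb Rg Rbg.
have -> : s * (1 - expR (2 * f p)) * Rb - s * (Rb - expR (2 * f p) * Rg) =
    expR (2 * f p) * (s * Rg - s * Rb) by ring.
by rewrite mulr_ge0 ?expR_ge0// subr_ge0.
Qed.

Lemma signed_le0 p : u p <= 0 -> 0 <= s * (1 - expR (2 * f p)).
Proof.
rewrite /u; case: s1 => ->.
  rewrite !mul1r subr_ge0 => f0; have := ler_expR (2 * f p) 0.
  by rewrite expR0 => ->; lra.
rewrite !mulN1r opprB subr_ge0 => f0; have := ler_expR 0 (2 * f p).
by rewrite expR0 => ->; lra.
Qed.

(** Both cases follow from 1 + t <= e^t. For s = 1 it gives e^(2u) - 1 <= 2 u e^(2u); for s = -1 it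
    gives 1 - e^(-2u) <= 2 u, which is enlarged by the factor e^(2u) >= 1 so that one coefficient
    serves both. *)
Lemma signed_ge0 p : 0 <= u p -> - (s * (1 - expR (2 * f p))) <= 2 * expR (2 * u p) * u p.
Proof.
rewrite /u; case: s1 => ->; rewrite ?mul1r ?mulN1r.
  move=> f0; have := expR_ge1Dx (- (2 * f p)).
  have e0 := expR_gt0 (2 * f p).
  move=> /(ler_wpM2r (ltW e0)); rewrite -expRD addNr expR0 => h.
  by rewrite opprB; move: h; lra.
move=> f0; rewrite opprK.
have := expR_ge1Dx (2 * f p); have : 1 <= expR (2 * - f p).
  by have := ler_expR 0 (2 * - f p); rewrite expR0 => ->; lra.
move=> h1 h2; have : 2 * - f p <= 2 * - f p * expR (2 * - f p) by rewrite ler_peMr//; lra.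
by move: h2; lra.
Qed.

Let OC e (A : set M) : A `<=` Omega -> chart_image e A `<=` chart_image e W.
Proof. by move=> AO; apply: chart_imageS => p /AO /OW. Qed.

Let continuous_inv e i j x : atlas M e -> chart_image e W x ->
  {for x, continuous (fun z => inv_chart e z i j)}.
Proof.
move=> ae Wx; apply: smooth_continuous Wx; apply: smooth_inv_metric.
- exact: open_chart_image.
- exact: smooth_gbar.
- by move=> y; exact: posdef_gbar.
Qed.

(** On the open set where u < 0 the right-hand side of the inequality is nonpositive. The operator
    annihilates constants, so u - u p satisfies the strong minimum principle with zero potential. *)
Lemma negative_min_open p : Omega p -> u p < 0 -> (forall q, Omega q -> u p <= u q) ->
  \forall q \near p, u q = u p.
Proof.
move=> Op up umin; have [ae ep] := chart_atP p; set e := chart_at p in ae ep.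
pose A := Omega `&` [set q | u q < 0].
have oA : open A.
  rewrite openE => q [Oq uq]; apply: filterI; first exact: open_nbhs_nbhs.
  have cu := continuous_u (OW Oq).
  apply: (cu [set t : R | t < 0]).
  by apply: open_nbhs_nbhs; split; [exact: open_lt|].
have AO : A `<=` Omega by move=> q [].
have [b [sb L]] := signed_inequality ae.
have oU : open (chart_image e A) by exact: open_chart_image.
have su : smooth_on (chart_image e A) (fun x => u (cinv e x) - u p).
  apply: smoothB => //; last exact: smooth_cst.
  by apply: smooth_onS (smooth_u ae); exact: OC.
have Ap : chart_image e A (cmap e p) by exists p.
have : \forall x \near cmap e p, u (cinv e x) - u p = 0.
  apply: (strong_minimum (a := inv_chart e) (b := b) (c := fun=> 0) oU su).
  - by move=> x; move=> /(posdef_gbar ae) /posdef_inv.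
  - by move=> i j x /(OC AO); exact: continuous_inv.
  - by move=> l x /(OC AO) Wx; exact: smooth_continuous (sb l) Wx.
  - by move=> x _; exact: cst_continuous.
  - by [].
  - exact: Ap.
  - by move=> x [q [eq [Oq _]] <-]; rewrite cmapK// subr_ge0 umin.
  - move=> x [q [eq [Oq uq]] <-]; rewrite mul0r.
    rewrite (ellipticBc _ _ (open_chart_image ae oW) (u p)); last exact: smooth_u.
      apply: le_trans (L q Oq eq) _.
      rewrite -mulrA; apply: mulr_ge0_le0; first by apply: signed_le0; exact: ltW.
      by apply: mulr_le0_ge0; [exact: Rbar_le0|rewrite invr_ge0 ltW].
    by exists q => //; split => //; exact: OW.
  - by rewrite cmapK// subrr.
move=> /(nbhs_chart_pullback ae ep); apply: filterS2 (nbhs_cdom ae ep) => q eq.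
by rewrite cmapK// => /eqP; rewrite subr_eq0 => /eqP.
Qed.

Let Rchart e x := Defs.scalar (in_chart gbar e) x.

(** The coefficient c of the linear inequality in the chart [e]; the factor 2 e^(2u) is the one of
    [signed_ge0]. *)
Let potential e x : R := - (2 / K) * Rchart e x * expR (2 * u (cinv e x)).

Let smooth_potential e : atlas M e -> smooth_on (chart_image e W) (potential e).
Proof.
move=> ae; have oU : open (chart_image e W) by exact: open_chart_image.
apply: smoothM => //; last first.
  apply: smooth_expR => //; apply: smoothM => //; first exact: smooth_cst.
  exact: smooth_u.
apply: smoothM => //; first exact: smooth_cst.
apply: smooth_scalar => //; first exact: smooth_gbar.
by move=> x; exact: posdef_gbar.
Qed.

Let potentialE e p : atlas M e -> cdom e p ->
  potential e (cmap e p) = - (2 / K) * scalar_curvature gbar p * expR (2 * u p).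
Proof.
move=> ae ep; rewrite (scalar_curvature_chart openT mgbar ae ep I).
by rewrite /potential /Rchart (cmapK ae ep).
Qed.

Let potential_ge0 e x : atlas M e -> chart_image e W x -> 0 <= potential e x.
Proof.
move=> ae [p [ep _] <-]; rewrite potentialE// mulr_ge0 ?expR_ge0//.
rewrite mulNr -mulrN; apply: mulr_ge0; last by rewrite oppr_ge0.
by rewrite divr_ge0// ltW.
Qed.

Lemma supersolution e : atlas M e ->
  exists b : 'I_n.+1 -> 'rV[R]_n.+1 -> R,
  (forall l, smooth_on (chart_image e W) (b l)) /\
  forall p, Omega p -> cdom e p -> 0 <= u p ->
    elliptic (inv_chart e) b (u \o cinv e) (cmap e p) <=
    potential e (cmap e p) * u p.
Proof.
move=> ae; have [b [sb L]] := signed_inequality ae.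
exists b; split => // p Op ep up; apply: le_trans (L p Op ep) _.
rewrite potentialE//; have := Rbar_le0 p; have := signed_ge0 up.
move: (u p) (expR (2 * u p)) (s * (1 - expR (2 * f p))) (scalar_curvature gbar p) => v E k Rb.
move=> h Rb0; rewrite ler_pdivrMr//.
have -> : - (2 / K) * Rb * E * v * K = (2 * E * v) * (- Rb) by field; exact: (lt0r_neq0 K_gt0).
have -> : k * Rb = (- k) * (- Rb) by ring.
by apply: ler_wpM2r => //; rewrite oppr_ge0.
Qed.

Lemma zero_open p : (forall q, Omega q -> 0 <= u q) -> Omega p -> u p = 0 ->
  \forall q \near p, u q = 0.
Proof.
move=> u0 Op up; have [ae ep] := chart_atP p; set e := chart_at p in ae ep.
have [b [sb L]] := supersolution ae.
have OWe : chart_image e Omega `<=` chart_image e W by apply: OC.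
have su : smooth_on (chart_image e Omega) (u \o cinv e).
  by apply: smooth_onS (smooth_u ae).
have : \forall x \near cmap e p, (u \o cinv e) x = 0.
  apply: (strong_minimum (U := chart_image e Omega) (a := inv_chart e) (b := b) (c := potential e) _ su).
  - exact: open_chart_image.
  - by move=> x; move=> /(posdef_gbar ae) /posdef_inv.
  - by move=> i j x /OWe; exact: continuous_inv.
  - by move=> l x /OWe Wx; exact: smooth_continuous (sb l) Wx.
  - by move=> x /OWe; apply: smooth_continuous; exact: smooth_potential.
  - by move=> x /OWe; exact: potential_ge0.
  - by exists p.
  - by move=> x [q [eq Oq] <-] /=; rewrite cmapK// u0.
  - by move=> x [q [eq Oq] <-] /=; rewrite cmapK//; apply: L => //; exact: u0.
  - by rewrite /= cmapK.
move=> /(nbhs_chart_pullback ae ep); apply: filterS2 (nbhs_cdom ae ep) => q eq.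
by rewrite /= cmapK.
Qed.

Hypothesis f_boundary : forall p, boundary Omega p -> f p = 0.
Hypotheses (cO : connected Omega) (cptO : compact (closure Omega)).
Hypothesis Oproper : Omega `<` [set: M].

Let u_boundary p : boundary Omega p -> u p = 0.
Proof. by rewrite /u => /f_boundary ->; rewrite mulr0. Qed.

Let closure_split p : closure Omega p -> Omega p \/ boundary Omega p.
Proof.
move=> clp; have [Op|nOp] := pselect (Omega p); first by left.
by right; split => // /interior_subset.
Qed.

(** A negative minimum over the compact closure lies in Omega, as u vanishes on the boundary. By
    connectedness u would equal this minimum throughout Omega, contradicting continuity at a
    boundary point; such a point exists because Omega is a proper subset of the connected M. *)
Lemma signed_factor_ge0 p : closure Omega p -> 0 <= u p.
Proof.
move=> clp; rewrite leNgt; apply/negP => up0.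
have cu : {within closure Omega, continuous u}.
  by apply: continuous_in_subspaceT => q; rewrite inE => /clW; exact: continuous_u.
have [q] := compact_EVT_min (ex_intro _ p clp) cptO cu.
rewrite inE => clq qmin.
have uq : u q < 0 by apply: le_lt_trans up0; apply: qmin; rewrite inE.
have Oq : Omega q.
  by have [//|/u_boundary uq0] := closure_split clq; move: uq; rewrite uq0 ltxx.
have [r br] : boundary Omega !=set0.
  by apply: boundary_nonempty => //; [exact: manifold_connected|exists q].
have ur : u r = 0 by exact: u_boundary.
have qmin' t : Omega t -> u q <= u t.
  by move=> Ot; apply: qmin; rewrite inE; exact: subset_closure.
have const t : Omega t -> u t = u q.
  apply: (@connected_level_set R M Omega u (u q)) => //.
  - by move=> z /OW; exact: continuous_u.
  - move=> z Oz uz; rewrite -uz; apply: negative_min_open => //; first by rewrite uz.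
    by move=> y; rewrite uz; exact: qmin'.
  - by exists q.
have : nbhs r [set t | u t != u q].
  have Wr : W r by apply: clW; case: br.
  have cur := continuous_u Wr.
  apply: (cur [set t : R | t != u q]); apply: open_nbhs_nbhs.
  by split; [exact: open_neq|rewrite /= ur eq_sym; exact: ltr0_neq0].
move=> nr; have [clr _] := br.
by have [t [/const ut /=]] := clr _ nr; rewrite ut eqxx.
Qed.

Lemma signed_factor_dichotomy :
  (forall p, Omega p -> u p = 0) \/ (forall p, Omega p -> 0 < u p).
Proof.
have u0 p : Omega p -> 0 <= u p by move=> /subset_closure; exact: signed_factor_ge0.
have [[p Op up]|np] := pselect (exists2 p, Omega p & u p = 0).
  left; apply: (@connected_level_set R M Omega u 0) => //.
  - by move=> z /OW; exact: continuous_u.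
  - by move=> z Oz uz; exact: zero_open.
  - by exists p.
right=> p Op; rewrite lt_neqAle u0// andbT eq_sym; apply/eqP => up.
by apply: np; exists p.
Qed.

Lemma boundary_adapted e p : adapted_chart Omega e -> cdom e p ->
  boundary Omega p <-> cmap e p ord0 ord0 = 0.
Proof.
move=> [ae eO] ep; have cm := cmap_continuous ae ep.
have cc : {for p, continuous (fun q => cmap e q ord0 ord0)}.
  apply: (@continuous_comp _ _ _ (cmap e) (fun x : 'rV[R]_n.+1 => x ord0 ord0)) => //.
  exact: coord_continuous.
split=> [[clp np]|x0].
  apply/eqP; rewrite eq_le; apply/andP; split; last first.
    rewrite leNgt; apply/negP => /(eO p ep).
    by move=> Op; apply: np; exact: open_nbhs_nbhs.
  rewrite leNgt; apply/negP => x0.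
  have n1 : nbhs p [set q | 0 < cmap e q ord0 ord0].
    by apply: (cc [set t : R | 0 < t]); apply: open_nbhs_nbhs; split => //; exact: open_gt.
  have [q [Oq [q0 eq]]] := clp _ (filterI n1 (nbhs_cdom ae ep)).
  by have := q0; rewrite /= ltNge ltW//; exact/(eO q eq).
split; last by move=> /interior_subset /(eO p ep); rewrite x0 ltxx.
move=> B nB; have nI := nbhs_chart_image ae ep nB.
have [h h0 H] := nbhs_line (- delta_mx ord0 ord0) 0 nI.
have := H h 0; rewrite scale0r addr0 normr0 gtr0_norm// => /(_ (lexx _) (ltW h0)).
move=> [q [eq Bq] qE]; exists q; split => //; apply/(eO q eq).
by rewrite qE !mxE x0 add0r mulrN1 oppr_lt0.
Qed.

(** In the adapted chart the boundary is the hyperplane x_0 = 0, so a small ball tangent to it from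
    inside has its centre on the normal through x, and Hopf's lemma applies at the point of
    contact. *)
Lemma boundary_derivative e p : adapted_chart Omega e -> cdom e p ->
  boundary Omega p -> (forall q, Omega q -> 0 < u q) ->
  pd ord0 (u \o cinv e) (cmap e p) < 0.
Proof.
move=> ade ep bp u_gt0; have [ae eO] := ade.
have x0 := (boundary_adapted ade ep).1 bp.
set x := cmap e p in x0 *.
have Wp : W p by apply: clW; case: bp.
have oU : open (chart_image e W) by exact: open_chart_image.
have [r2 r0 Hr] : exists2 r2 : R, 0 < r2 &
    forall y, sqn (y - x) < r2 -> chart_image e W y.
  apply: sqn_ball_nbhs; apply: open_nbhs_nbhs; split => //.
  by exists p.
(* Points of the ball are within squared distance 2 r2 / 5 + 2 r2 / 5 of x by [sqnD_le]; the divisor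
   5 makes this less than r2. *)
pose rho := Num.sqrt (r2 / 5).
have rho2 : rho ^+ 2 = r2 / 5 by rewrite sqr_sqrtr// divr_ge0 ?ltW.
have rho0 : 0 < rho by rewrite sqrtr_gt0 divr_gt0.
pose y := x - rho *: delta_mx ord0 ord0.
have xy : x - y = rho *: delta_mx ord0 ord0 by rewrite /y opprB addrC subrK.
have sdelta : sqn (delta_mx ord0 ord0 : 'rV[R]_n.+1) = 1.
  rewrite /sqn (bigD1 ord0)//= mxE !eqxx expr1n big1 ?addr0// => i i0.
  by rewrite mxE (negbTE i0) andbF expr0n.
have xyr : sqn (x - y) = r2 / 5 by rewrite xy sqnZ sdelta mulr1.
have ballW (z : 'rV[R]_n.+1) : sqn (z - y) <= r2 / 5 -> chart_image e W z.
  move=> zy; apply: Hr; have := sqnD_le (z - y) (y - x).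
  rewrite addrA subrK => h; apply: (le_lt_trans h).
  by rewrite [sqn (y - x)]sqnB xyr; move: zy; lra.
have coord (z : 'rV[R]_n.+1) : z ord0 ord0 = (z - y) ord0 ord0 - rho.
  have yE : y ord0 ord0 = - rho.
    by rewrite /y submxE scalemxE mxE x0 eqxx mulr1 sub0r.
  by rewrite submxE yE; ring.
have z_le0 (z : 'rV[R]_n.+1) : sqn (z - y) <= r2 / 5 -> z ord0 ord0 <= 0.
  move=> zy; have := le_trans (coord_le_sqn (z - y) ord0) zy.
  rewrite (coord z) -rho2; move: ((z - y) ord0 ord0) => t tr.
  by rewrite subr_le0; apply: le_trans (ler_norm _) _; rewrite -(@ler_pXn2r _ 2) ?nnegrE ?(ltW rho0)// real_normK ?num_real.
have z_lt0 (z : 'rV[R]_n.+1) : sqn (z - y) < r2 / 5 -> z ord0 ord0 < 0.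
  move=> zy; have := le_lt_trans (coord_le_sqn (z - y) ord0) zy.
  rewrite (coord z) -rho2; move: ((z - y) ord0 ord0) => t tr.
  by rewrite subr_lt0; apply: le_lt_trans (ler_norm _) _; rewrite -(@ltr_pXn2r _ 2) ?nnegrE ?(ltW rho0)// real_normK ?num_real.
have inO (z : 'rV[R]_n.+1) : sqn (z - y) < r2 / 5 -> exists q, [/\ cdom e q, Omega q & cmap e q = z].
  move=> zy; have [q [eq Wq] qz] := ballW z (ltW zy).
  by exists q; split => //; apply/(eO q eq); rewrite qz; exact: z_lt0.
have [b [sb L]] := supersolution ae.
have : \sum_i (x - y) ord0 i * pd i (u \o cinv e) x < 0.
  apply: (hopf (a := inv_chart e) (b := b) (c := potential e) oU (smooth_u ae) _ _ _ _ _ _ xyr).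
  - by move=> z; move=> /(posdef_gbar ae) /posdef_inv.
  - by move=> i j z; exact: continuous_inv.
  - by move=> l z Wz; exact: smooth_continuous (sb l) Wz.
  - by move=> z; apply: smooth_continuous; exact: smooth_potential.
  - by move=> z; exact: potential_ge0.
  - by rewrite divr_gt0.
  - exact: ballW.
  - move=> z zy; have [q [eq Wq] qz] := ballW z zy; rewrite -qz /= cmapK//.
    have := z_le0 z zy; rewrite le_eqVlt => /orP[/eqP z0|z0].
      by rewrite u_boundary//; apply/(boundary_adapted ade eq); rewrite qz.
    by apply/ltW/u_gt0/(eO q eq); rewrite qz.
  - by move=> z /inO[q [eq Oq <-]]; rewrite /= cmapK//; exact: u_gt0.
  - by rewrite /= cmapK// u_boundary.
  - move=> z /inO[q [eq Oq <-]]; rewrite /= [X in _ * u X]cmapK//; apply: L => //.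
    exact/ltW/u_gt0.
rewrite (bigD1 ord0)//= big1 ?addr0 => [|i i0].
  by rewrite xy !mxE !eqxx mulr1 pmulr_rlt0.
by rewrite xy !mxE (negbTE i0) andbF mulr0 mul0r.
Qed.

End Signed.
End ConformalFactor.

(** * Mean curvature and the gradient of the conformal factor *)

Section GradientNorm.
Context {R : realType} {d : nat} {M : manifold R d}.
Variables (gbar : tensor2 M) (W : set M) (f : M -> R).
Hypotheses (mgbar : is_metric [set: M] gbar) (oW : open W) (sf : smooth_fun W f).

Definition gradient c x : 'rV[R]_d := \row_i pd i (f \o cinv c) x.

Definition gradient_sqnorm c x : R :=
  (gradient c x *m invmx (in_chart gbar c x) *m (gradient c x)^T) ord0 ord0.

Lemma gradient_change c e p : atlas M c -> atlas M e -> cdom c p -> cdom e p -> W p ->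
  gradient c (cmap c p) =
  gradient e (cmap e p) *m (jac (fun x => cmap e (cinv c x)) (cmap c p))^T.
Proof.
move=> ac ae cp ep Wp; apply/rowP => i; rewrite mulmxE mxE.
pose tau x := cmap e (cinv c x).
have E : \forall x \near cmap c p, (f \o cinv c) x = (f \o cinv e) (tau x).
  have oE : open (cdom e) by exact: chart_open_dom (atlas_chart ae).
  have nE : nbhs (cmap c p) (chart_image c (cdom e)).
    by apply: nbhs_chart_image => //; exact: open_nbhs_nbhs.
  by apply: filterS nE => x [q [cq eq] <-]; rewrite /tau /= !cmapK.
rewrite (eq_pd i E) pdE (@partial_comp _ _ _ tau).
- apply: eq_bigr => k _; rewrite trmxE jacE !mxE pdE mulrC.
  by rewrite /tau cmapK.
- move=> k; apply: (smooth_differentiable (smooth_tau ac ae k)).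
  by exists p.
- rewrite /tau cmapK//; apply: (smooth_differentiable (sf ae)).
  by exists p.
Qed.

(** Invariance of |df|^2 allows the normal derivative, taken in an adapted chart chosen at each
    point, to be replaced by a quantity computed in any chart. *)
Lemma gradient_sqnorm_change c e p : atlas M c -> atlas M e -> cdom c p -> cdom e p ->
  W p -> gradient_sqnorm c (cmap c p) = gradient_sqnorm e (cmap e p).
Proof.
move=> ac ae cp ep Wp; rewrite /gradient_sqnorm (gradient_change ac ae cp ep Wp).
rewrite /in_chart !cmapK//.
have GE := metric_change ac ae mgbar cp ep I.
have uG := posdef_unit (posdef_metric mgbar ac cp I).
have uH := posdef_unit (posdef_metric mgbar ae ep I).
move: GE uG; set J := jac _ _ => GE; rewrite GE !unitmx_mul => /andP[/andP[uJ _] _].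
rewrite invmx_congruence// trmx_mul trmxK !mulmxA.
rewrite -(mulmxA (gradient e (cmap e p)) J^T) -trmx_mul mulVmx// trmx1 mulmx1.
by rewrite mulmxKV.
Qed.

Lemma smooth_gradient_sqnorm c : atlas M c ->
  smooth_on (chart_image c W) (gradient_sqnorm c).
Proof.
move=> ac; have oU : open (chart_image c W) by exact: open_chart_image.
rewrite /gradient_sqnorm; under eq_fun do rewrite quad_formE.
apply: smooth_bigsum => // i; apply: smooth_bigsum => // j; apply: smoothM => //.
  apply: smooth_inv_metric => //.
    by move=> k l; apply: smooth_onS (mx_smooth_in_chart mgbar ac k l) => x [q [cq _] <-]; exists q.
  move=> x [q [cq _] <-]; apply: (posdef_in_chart mgbar ac); exists q => //.
by under eq_fun do rewrite !mxE; apply: smoothM => //; apply: smooth_pd; exact: sf.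
Qed.

End GradientNorm.

(** * The difference of the mean curvatures as a gradient norm *)

Section MeanCurvatureDifference.
Context {R : realType} {n : nat} {M : manifold R n.+1}.
Variables (gbar g : tensor2 M) (Omega V W : set M) (f : M -> R).
Hypothesis mgbar : is_metric [set: M] gbar.
Hypotheses (oV : open V) (oW : open W).
Hypotheses (clV : closure Omega `<=` V) (clW : closure Omega `<=` W).
Hypotheses (mg : is_metric V g) (sf : smooth_fun W f).
Hypothesis gE : forall p, closure Omega p -> forall c, atlas M c -> cdom c p ->
  g c p = expR (2 * f p) *: gbar c p.
Hypothesis f_boundary : forall p, boundary Omega p -> f p = 0.
Hypothesis oO : open Omega.

Lemma closure_adapted e p : adapted_chart Omega e -> cdom e p ->
  cmap e p ord0 ord0 <= 0 -> closure Omega p.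
Proof.
move=> ade ep; rewrite le_eqVlt => /orP[/eqP|] x0.
  by have [] := (boundary_adapted oO ade ep).2 x0.
by apply/subset_closure/(ade.2 p ep).
Qed.

Lemma pd_tangential_factor e p a : adapted_chart Omega e -> cdom e p ->
  boundary Omega p -> pd (lift ord0 a) (f \o cinv e) (cmap e p) = 0.
Proof.
move=> ade ep bp; have [ae _] := ade.
have x0 := (boundary_adapted oO ade ep).1 bp.
have Wx : chart_image e W (cmap e p) by exists p => //; split => //; apply: clW; case: bp.
apply: (pd_tangential a (open_chart_image ae oW) Wx) => //.
  by apply: (smooth_differentiable (sf ae)).
move=> y [q [eq Wq] <-] y0; rewrite /= cmapK//; apply: f_boundary.
exact/(boundary_adapted oO ade eq).
Qed.

(** The tensor g is conformal to gbar on the closure only. It is replaced by e^(2f) gbar, conformal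
    on all of W, which has the same value and the same first derivatives at boundary points by
    [pd_eq0_halfspace]. *)
Lemma local_mean_curvature_difference e p : adapted_chart Omega e -> cdom e p ->
  boundary Omega p ->
  local_mean_curvature (in_chart gbar e) (cmap e p)
  - local_mean_curvature (in_chart g e) (cmap e p) =
  - (n%:R * (Num.sqrt (invmx (in_chart gbar e (cmap e p)) ord0 ord0)
             * pd ord0 (f \o cinv e) (cmap e p))).
Proof.
move=> ade ep bp; have [ae _] := ade.
have clp : closure Omega p by case: bp.
have [Vp Wp] := (clV clp, clW clp).
have x0 := (boundary_adapted oO ade ep).1 bp.
pose F := f \o cinv e; pose Gt x := expR (2 * F x) *: in_chart gbar e x.
have oU : open (chart_image e W) by exact: open_chart_image.
have sG : mx_smooth (chart_image e W) (in_chart gbar e) by exact: smooth_gbar.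
have Wx : chart_image e W (cmap e p) by exists p.
have -> : local_mean_curvature (in_chart g e) (cmap e p) = local_mean_curvature Gt (cmap e p).
  apply: eq_local_mean_curvature.
  - by rewrite /in_chart (cmapK ae ep); exact: (posdef_metric mg ae ep Vp).
  - by rewrite /Gt /F /in_chart /= cmapK// gE.
  move=> i j k; pose O := chart_image e (V `&` W).
  have oO' : open O by apply: open_chart_image => //; exact: openI.
  have Ox : O (cmap e p) by exists p.
  have d1 : differentiable (fun y => in_chart g e y j k) (cmap e p).
    by apply: (smooth_differentiable (mx_smooth_in_chart mg ae j k)); exists p.
  have d2 : differentiable (fun y => Gt y j k) (cmap e p).
    apply: (@smooth_differentiable _ _ (chart_image e W)) => //.
    under eq_fun do rewrite scalemxE; apply: smoothM => //.
    apply: smooth_expR => //; apply: smoothM => //; first exact: smooth_cst.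
    exact: sf.
  apply/eqP; rewrite -subr_eq0 -pdB//; apply/eqP.
  apply: (pd_eq0_halfspace i oO' Ox) => //; first exact: differentiableB.
    by rewrite x0.
  move=> y [q [eq [Vq Wq]] <-] y0; rewrite /Gt /F /in_chart /= cmapK//.
  by rewrite (gE (closure_adapted ade eq y0) ae eq) subrr.
apply: (local_mean_curvature_conformal oU sG _ (sf ae)) => //.
- by move=> x; exact: posdef_gbar.
- by rewrite /= cmapK// f_boundary.
- by move=> a; exact: pd_tangential_factor.
Qed.

(** As f vanishes along the boundary, only the normal component of df survives. *)
Lemma gradient_sqnorm_boundary e p : adapted_chart Omega e -> cdom e p ->
  boundary Omega p -> gradient_sqnorm gbar f e (cmap e p) =
  invmx (in_chart gbar e (cmap e p)) ord0 ord0 * pd ord0 (f \o cinv e) (cmap e p) ^+ 2.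
Proof.
move=> ade ep bp; rewrite /gradient_sqnorm quad_formE.
have t0 a : gradient f e (cmap e p) ord0 (lift ord0 a) = 0.
  by rewrite mxE pd_tangential_factor.
rewrite big_ord_recl [X in _ + X]big1 ?addr0 => [|a _]; last first.
  by apply: big1 => j _; rewrite t0 mul0r mulr0.
rewrite big_ord_recl big1 ?addr0 => [|a _]; last by rewrite t0 !mulr0.
by rewrite !mxE expr2.
Qed.

Variable s : R.
Hypothesis s1 : s = 1 \/ s = -1.
Hypothesis u_ge0 : forall p, Omega p -> 0 <= s * f p.
Hypothesis smO : smooth_boundary Omega.

Lemma pd_normal_factor_le0 e p : adapted_chart Omega e -> cdom e p ->
  boundary Omega p -> s * pd ord0 (f \o cinv e) (cmap e p) <= 0.
Proof.
move=> ade ep bp; have [ae eO] := ade.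
have x0 := (boundary_adapted oO ade ep).1 bp.
have Wx : chart_image e W (cmap e p) by exists p => //; split => //; apply: clW; case: bp.
have dF : differentiable (f \o cinv e) (cmap e p) by exact: (smooth_differentiable (sf ae)).
rewrite -pdZ//; apply: (pd_normal_le0 (open_chart_image ae oW) Wx) => //.
- exact: (@differentiableM _ _ (fun=> s)).
- by rewrite /= cmapK// f_boundary// mulr0.
- move=> y [q [eq Wq] <-] y0; rewrite /= cmapK//; apply: u_ge0.
  exact/(eO q eq).
Qed.

(** The known sign of the normal derivative turns it into |df|. The left-hand side refers to a chart
    chosen separately at each p, while the right-hand side can be read in a fixed chart [c], where
    it is continuous. *)
Lemma mean_curvature_difference c p : atlas M c -> cdom c p -> boundary Omega p ->
  s * (mean_curvature Omega gbar p - mean_curvature Omega g p) =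
  n%:R * Num.sqrt (gradient_sqnorm gbar f c (cmap c p)).
Proof.
move=> ac cp bp; have [ade ep] := adapted_atP smO bp.
rewrite /mean_curvature; set e := adapted_at Omega p in ade ep *.
have Wp : W p by apply: clW; case: bp.
rewrite local_mean_curvature_difference//.
rewrite (gradient_sqnorm_change mgbar sf ac ade.1 cp ep Wp).
rewrite gradient_sqnorm_boundary//.
have g0 : 0 <= invmx (in_chart gbar e (cmap e p)) ord0 ord0.
  apply/ltW/posdef_diag/posdef_inv; rewrite /in_chart (cmapK ade.1 ep).
  exact: (posdef_metric mgbar ade.1 ep I).
have := pd_normal_factor_le0 ade ep bp.
rewrite sqrtrM// sqrtr_sqr; move: (Num.sqrt _) (pd _ _ _) => G D.
by case: s1 => ->; rewrite ?mul1r ?mulN1r => D0; [rewrite ler0_norm//|rewrite ger0_norm -?oppr_le0//]; ring.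
Qed.

End MeanCurvatureDifference.

(** * Integration over the boundary *)

Section SimpleLowerBound.
Import HBNNSimple.

(* No measurability is needed: the integral of a nonnegative function is the
   supremum of the integrals of the simple functions below it. *)
Lemma integral_ge_cst (disp : measure_display) (T : measurableType disp)
    (R : realType) (mu : {measure set T -> \bar R}) (h : T -> \bar R) (A : set T)
    (k : R) : measurable A -> (0 <= k)%R -> (forall t, 0 <= h t)%E ->
  (forall t, A t -> k%:E <= h t)%E ->
  (k%:E * mu A <= \int[mu]_t h t)%E.
Proof.
move=> mA k0 h0 hk; rewrite ge0_integralTE//.
pose g := scale_nnsfun (indic_nnsfun R mA) k0.
have <- : sintegral mu g = (k%:E * mu A)%E.
  apply: (etrans (sintegralrM mu k (indic_nnsfun R mA))).
  by congr (_ * _)%E; exact: sintegral_indic.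
apply: ereal_sup_ubound; exists g => // t; change ((k * \1_A t)%:E <= h t)%E.
rewrite indicE; have [tA|tA] := boolP (t \in A); rewrite ?mulr1 ?mulr0 ?h0//.
by apply: hk; rewrite inE in tA.
Qed.

End SimpleLowerBound.

(** * Lower bounds for iterated integrals *)

Section IteratedIntegral.
Context {R : realType}.
Local Open Scope ereal_scope.

Lemma integral_ge_box (h : R -> \bar R) (t0 r k : R) : (0 < r)%R -> (0 <= k)%R ->
  (forall t, 0 <= h t) -> (forall t, (`|t - t0| < r)%R -> k%:E <= h t) ->
  (k * (r * 2))%:E <= \int[@lebesgue_measure R]_t h t.
Proof.
move=> r0 k0 h0 hk.
pose A : set R := [set` Interval (BRight (t0 - r)%R) (BLeft (t0 + r)%R)].
have mE : (@lebesgue_measure R) A = (r * 2)%:E.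
  apply: (etrans (lebesgue_measure_itv _)); rewrite /= lte_fin ifT; last by lra.
  by rewrite -EFinB; congr EFin; ring.
apply: le_trans (integral_ge_cst (@lebesgue_measure R) (A := A) _ k0 h0 _).
- by rewrite [X in _ * X]mE -EFinM lexx.
- exact: measurable_itv.
- move=> t; rewrite /A /= in_itv/= => /andP[a b]; apply: hk.
  by rewrite ltr_distl; apply/andP; split; lra.
Qed.

Lemma Rn_integral_ge0 n (F : 'rV[R]_n -> \bar R) : (forall y, 0 <= F y) ->
  0 <= Rn_integral F.
Proof.
elim: n F => [|n IH] F F0 //=.
by apply: integral_ge0 => t _; exact: IH.
Qed.

Lemma Rn_integral_eq0 n (F : 'rV[R]_n -> \bar R) : (forall y, F y = 0) ->
  Rn_integral F = 0.
Proof.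
elim: n F => [|n IH] F F0 //=.
by apply: integral0_eq => t _; exact: IH.
Qed.

(** By induction on the dimension, each one-dimensional integral contributes the edge length [r * 2]
    of a cube on which the integrand is at least k. *)
Lemma Rn_integral_ge_box n (F : 'rV[R]_n -> \bar R) (y0 : 'rV[R]_n) (r k : R) :
  (0 < r)%R -> (0 <= k)%R -> (forall y, 0 <= F y) ->
  (forall y : 'rV[R]_n, (forall i, `|y ord0 i - y0 ord0 i| < r)%R -> k%:E <= F y) ->
  (k * (r * 2) ^+ n)%:E <= Rn_integral F.
Proof.
move=> r0 k0; elim: n F y0 => [|n IH] F y0 F0 Fk /=.
  by rewrite expr0 mulr1; apply: Fk => -[].
rewrite exprSr mulrA; apply: (@integral_ge_box _ (y0 ord0 ord0)) => //.
- by rewrite mulr_ge0// exprn_ge0// mulr_ge0// ltW.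
- by move=> t; exact: Rn_integral_ge0.
move=> t tr; apply: (IH _ (\row_i y0 ord0 (lift ord0 i))) => // y yr.
apply: Fk => i; rewrite mxE; case: splitP => j ij.
  rewrite ord1 in ij *; rewrite mxE eqxx mulr1n.
  by rewrite (_ : i = ord0)//; apply: val_inj.
have -> : i = lift ord0 j by apply: val_inj; rewrite /= ij.
by have := yr j; rewrite mxE.
Qed.

Lemma Rn_integral_gt0 n (F : 'rV[R]_n -> \bar R) (y0 : 'rV[R]_n) (k : R) :
  (0 < k)%R -> (forall y, 0 <= F y) -> (\forall y \near y0, k%:E <= F y) ->
  0 < Rn_integral F.
Proof.
move=> k0 F0 /nbhs_normP[r /= r0 Fk].
have r20 : (0 < r / 2)%R by rewrite divr_gt0.
apply: lt_le_trans (Rn_integral_ge_box (y0 := y0) r20 (ltW k0) F0 _).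
  by rewrite lte_fin mulr_gt0// exprn_gt0// divfK.
move=> y yr; apply: Fk => /=.
rewrite [`|_|%R]mx_normrE.
apply: (big_ind (fun z => z < r)%R) => // [a b ar br|[i j] _].
  by rewrite gt_max ar.
rewrite ord1/= submxE distrC; apply: (lt_trans (yr j)).
by rewrite ltr_pdivrMr//; lra.
Qed.

End IteratedIntegral.

(** * Sign and vanishing of boundary integrals *)

Section BoundaryIntegral.
Context {R : realType} {n : nat} {M : manifold R n.+1}.
Variables (g : tensor2 M) (Omega : set M).
Hypothesis mg : is_metric [set: M] g.
Implicit Types (phi : M -> \bar R) (c : chart R n.+1 M) (A : set M).

Definition slice (y : 'rV[R]_n) : 'rV[R]_n.+1 := row_mx (0 : 'rV[R]_1) y.

Lemma slice0 y : slice y ord0 ord0 = 0.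
Proof.
rewrite /slice mxE; case: splitP => j ij; first by rewrite mxE.
by move: ij => /=; rewrite add1n.
Qed.

Lemma slice_lift y a : slice y ord0 (lift ord0 a) = y ord0 a.
Proof.
rewrite /slice mxE; case: splitP => j ij.
  by move: (ltn_ord j); rewrite -ij.
by congr (y _ _); apply: val_inj; move: ij => /= [].
Qed.

Lemma slice_surj (x : 'rV[R]_n.+1) : x ord0 ord0 = 0 ->
  exists y, slice y = x.
Proof.
move=> x0; exists (\row_a x ord0 (lift ord0 a)); apply/rowP => i.
by case: (unliftP ord0 i) => [a|] ->; rewrite ?slice_lift ?slice0 ?mxE.
Qed.

Lemma slice_continuous : continuous slice.
Proof.
move=> y; apply: differentiable_continuous; apply: differentiable_row => k.
case: (unliftP ord0 k) => [a|] ->.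
  by under eq_fun do rewrite slice_lift; exact: differentiable_coord.
by under eq_fun do rewrite slice0; exact: differentiable_cst.
Qed.

Lemma patch_integral_ge0 phi c A : (forall p, 0 <= phi p)%E ->
  (0 <= patch_integral g phi c A)%E.
Proof.
move=> phi0; apply: Rn_integral_ge0 => y; apply: erestrict_ge0 => z _.
by rewrite mule_ge0// lee_fin sqrtr_ge0.
Qed.

Lemma patch_integral_eq0 phi c A : atlas M c -> (forall p, A p -> phi p = 0)%E ->
  patch_integral g phi c A = 0%E.
Proof.
move=> ac phi0; apply: Rn_integral_eq0 => y; rewrite patchE.
case: ifPn => //; rewrite inE => -[p [cp Ap] pE].
by rewrite -[row_mx _ _]pE cmapK// phi0// mul0e.
Qed.

Lemma area_density_gt0 c p : atlas M c -> cdom c p ->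
  0 < area_density (in_chart g c) (cmap c p).
Proof.
move=> ac cp; rewrite sqrtr_gt0; apply/posdef_det/posdef_induced.
by rewrite /in_chart cmapK//; exact: (posdef_metric mg ac cp I).
Qed.

Lemma area_density_continuous c p : atlas M c -> cdom c p ->
  {for cmap c p, continuous (area_density (in_chart g c))}.
Proof.
move=> ac cp; apply: (@continuous_comp _ _ _ (fun x => \det (induced_metric (in_chart g c) x)) Num.sqrt); last exact: sqrt_continuous.
have oU : open (chart_image c [set: M]) by apply: open_chart_image => //; exact: openT.
apply: (@smooth_continuous _ _ (chart_image c [set: M])); last by exists p.
apply: smooth_det => // i j; under eq_fun do rewrite mxE.
exact: mx_smooth_in_chart.
Qed.

Hypothesis oO : open Omega.

(** The function phi is only bounded below, on the boundary, by [Phi] read in the chart. The product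
    of [Phi] with the area density is continuous and positive at p, hence stays above half its value
    on a neighbourhood in the slice x_0 = 0. *)
Lemma patch_integral_gt0 phi c p (Phi : 'rV[R]_n.+1 -> R) :
  adapted_chart Omega c -> cdom c p -> boundary Omega p ->
  (forall q, 0 <= phi q)%E ->
  (forall q, boundary Omega q -> cdom c q -> (Phi (cmap c q))%:E <= phi q)%E ->
  {for cmap c p, continuous Phi} -> 0 < Phi (cmap c p) ->
  (0 < patch_integral g phi c (boundary Omega))%E.
Proof.
move=> adc cp bp phi0 Phile cPhi Phip; have [ac _] := adc.
have [y0 y0E] := slice_surj ((boundary_adapted oO adc cp).1 bp).
pose Psi x := Phi x * area_density (in_chart g c) x.
have cPsi : {for cmap c p, continuous Psi}.
  by apply: continuousM => //; exact: area_density_continuous.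
have Psi0 : 0 < Psi (cmap c p) by rewrite mulr_gt0// area_density_gt0.
apply: (@Rn_integral_gt0 _ _ _ y0 (Psi (cmap c p) / 2)); first by rewrite divr_gt0.
  by move=> y; apply: erestrict_ge0 => z _; rewrite mule_ge0// lee_fin sqrtr_ge0.
have nPsi : nbhs (cmap c p) [set x | Psi (cmap c p) / 2 <= Psi x].
  have nlt : nbhs (Psi (cmap c p)) [set t : R | Psi (cmap c p) / 2 < t].
    by apply: open_nbhs_nbhs; split; [exact: open_gt|rewrite /= ltr_pdivrMr//; lra].
  have nPsi : nbhs (cmap c p) [set x | Psi (cmap c p) / 2 < Psi x].
    exact: (cPsi [set t : R | Psi (cmap c p) / 2 < t]).
  by apply: filterS nPsi => x /ltW.
have nI : nbhs (cmap c p) (cmap c @` cdom c).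
  by apply: open_nbhs_nbhs; split; [exact: chart_open_img (atlas_chart ac)|exists p].
have nB : nbhs y0 [set y | Psi (cmap c p) / 2 <= Psi (slice y) /\
    (cmap c @` cdom c) (slice y)].
  apply: (@slice_continuous y0 [set x | Psi (cmap c p) / 2 <= Psi x /\ (cmap c @` cdom c) x]).
  by rewrite y0E; exact: filterI.
apply: filterS nB => y [/= Py [q cq qE]].
have bq : boundary Omega q by apply/(boundary_adapted oO adc cq); rewrite qE slice0.
rewrite patchE ifT; last by rewrite inE; exists q.
rewrite -[row_mx _ _]/(slice y) -qE (cmapK ac cq).
apply: (@le_trans _ _ (Psi (cmap c q))%:E); first by rewrite lee_fin qE.
rewrite /Psi EFinM; apply: lee_wpmul2r; last exact: Phile.
by rewrite lee_fin sqrtr_ge0.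
Qed.

Lemma patch_sum_ge0 phi s A : (forall p, 0 <= phi p)%E -> (0 <= patch_sum g phi s A)%E.
Proof.
move=> phi0; elim: s A => //= c s IH A.
by apply: adde_ge0 => //; exact: patch_integral_ge0.
Qed.

Lemma patch_sum_eq0 phi s A : (forall c, c \in s -> atlas M c) ->
  (forall p, A p -> phi p = 0)%E -> patch_sum g phi s A = 0%E.
Proof.
elim: s A => //= c s IH A ats phi0.
rewrite patch_integral_eq0 ?add0e//; last by apply: ats; rewrite mem_head.
apply: IH => [e es|p [Ap _]]; last exact: phi0.
by apply: ats; rewrite in_cons es orbT.
Qed.

(** One positive piece suffices, the others being nonnegative. The first chart of the list that
    meets the boundary provides it: the charts before it remove nothing, so its piece is cut from
    the full boundary. *)
Lemma patch_sum_gt0 phi s p : (forall q, 0 <= phi q)%E ->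
  (forall c q, c \in s -> cdom c q -> boundary Omega q ->
    0 < patch_integral g phi c (boundary Omega))%E ->
  boundary Omega p -> (exists2 c, c \in s & cdom c p) ->
  (0 < patch_sum g phi s (boundary Omega))%E.
Proof.
move=> phi0; elim: s => [|c s IH] Hs bp [e es ep] //=.
have [[q [cq bq]]|nq] := pselect (exists q, cdom c q /\ boundary Omega q).
  apply: (lt_le_trans (Hs c q (mem_head _ _) cq bq)).
  by rewrite leeDl// patch_sum_ge0.
have -> : boundary Omega `\` cdom c = boundary Omega.
  apply/seteqP; split=> [q []//|q bq]; split => // cq.
  by apply: nq; exists q.
have spos : (0 < patch_sum g phi s (boundary Omega))%E.
  apply: IH => //; first by move=> f q fs; apply: Hs; rewrite in_cons fs orbT.
  exists e => //; move: es; rewrite in_cons => /orP[/eqP ec|//].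
  by exfalso; apply: nq; exists p; rewrite -ec.
by apply: (lt_le_trans spos); rewrite leeDr// patch_integral_ge0.
Qed.

Hypotheses (smO : smooth_boundary Omega) (cptO : compact (closure Omega)).

Let I psi := patch_sum g psi (boundary_charts Omega) (boundary Omega).

Let charts_adapted c : c \in boundary_charts Omega -> adapted_chart Omega c.
Proof. by have [+ _] := boundary_chartsP smO cptO; apply. Qed.

Let I_eq0 psi : (forall p, boundary Omega p -> psi p = 0)%E -> I psi = 0%E.
Proof. by apply: patch_sum_eq0 => c /charts_adapted[]. Qed.

Let I_gt0 (psi : M -> \bar R) : boundary Omega !=set0 -> (forall q, 0 <= psi q)%E ->
  (forall c, adapted_chart Omega c -> exists Phi : 'rV[R]_n.+1 -> R,
    forall p, boundary Omega p -> cdom c p ->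
     [/\ {for cmap c p, continuous Phi}, 0 < Phi (cmap c p) &
      ((Phi (cmap c p))%:E <= psi p)%E]) ->
  (0 < I psi)%E.
Proof.
move=> [p bp] psi0 HPhi; apply: (patch_sum_gt0 psi0 _ bp).
  move=> c q /charts_adapted adc cq bq; have [Phi H] := HPhi c adc.
  have [cPhi Phi0 _] := H q bq cq.
  apply: (patch_integral_gt0 adc cq bq psi0 _ cPhi Phi0) => r br cr.
  by have [] := H r br cr.
by have [_] := boundary_chartsP smO cptO; apply.
Qed.

Let boundary_integral_posneg (phi : M -> R) : boundary_integral Omega g phi =
  (I (EFin \o phi)^\+ - I (EFin \o phi)^\-)%E.
Proof. by []. Qed.

Lemma boundary_integral0 (phi : M -> R) : (forall p, boundary Omega p -> phi p = 0) ->
  boundary_integral Omega g phi = 0%E.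
Proof.
move=> phi0; rewrite boundary_integral_posneg !I_eq0 ?sube0// => p /phi0 p0.
  by rewrite funenegE /= p0 oppr0 maxxx.
by rewrite funeposE /= p0 maxxx.
Qed.

Variables (s : R) (phi : M -> R).
Hypothesis s1 : s = 1 \/ s = -1.
Hypothesis sphi : forall p, boundary Omega p -> 0 <= s * phi p.

(** Because s phi is nonnegative on the boundary, one of the positive and negative parts of phi
    vanishes there; psi is the other one. *)
Let boundary_integralE : exists psi, [/\ (forall q, 0 <= psi q)%E,
  (forall q, boundary Omega q -> psi q = (s * phi q)%:E) &
  boundary_integral Omega g phi = (s%:E * I psi)%E].
Proof.
rewrite boundary_integral_posneg; case: s1 => sE.
  exists (EFin \o phi)^\+%E; split=> [q|q bq|]; first exact: funepos_ge0.
    by have := sphi bq; rewrite sE mul1r funeposE /= => h; apply/max_idPl; rewrite lee_fin.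
  rewrite sE mul1e [X in (_ - X)%E]I_eq0 ?sube0// => q bq.
  have := sphi bq; rewrite sE mul1r funenegE /= => h.
  by apply/max_idPr; rewrite lee_fin oppr_le0.
exists (EFin \o phi)^\-%E; split=> [q|q bq|]; first exact: funeneg_ge0.
  have := sphi bq; rewrite sE mulN1r funenegE /= => h.
  by apply/max_idPl; rewrite lee_fin.
rewrite sE EFinN mulN1e [X in (X - _)%E]I_eq0 ?sub0e// => q bq.
have := sphi bq; rewrite sE mulN1r oppr_ge0 funeposE /= => h.
by apply/max_idPr; rewrite lee_fin.
Qed.

Lemma boundary_integral_sign : (0 <= s%:E * boundary_integral Omega g phi)%E.
Proof.
have [psi [psi0 _ ->]] := boundary_integralE.
rewrite muleA -EFinM; have -> : s * s = 1 by case: s1 => ->; ring.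
by rewrite mul1e patch_sum_ge0.
Qed.

Lemma boundary_integral_neq0 : boundary Omega !=set0 ->
  (forall c, adapted_chart Omega c -> exists Phi : 'rV[R]_n.+1 -> R,
    forall p, boundary Omega p -> cdom c p ->
     [/\ {for cmap c p, continuous Phi}, 0 < Phi (cmap c p) &
      Phi (cmap c p) = s * phi p]) ->
  boundary_integral Omega g phi <> 0%E.
Proof.
move=> b0 HPhi; have [psi [psi0 psiE ->]] := boundary_integralE.
have I0 : (0 < I psi)%E.
  apply: I_gt0 => // c /HPhi[Phi H]; exists Phi => p bp cp.
  by have [c1 c2 c3] := H p bp cp; split => //; rewrite c3 psiE.
apply/eqP; rewrite mule_eq0 negb_or (gt_eqF I0) andbT.
by case: s1 => ->; rewrite eqe ?oppr_eq0 oner_eq0.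
Qed.

End BoundaryIntegral.

(** * The Brown-York mass *)

Section ConformalRigidity.
Context {R : realType} {n : nat} {M : manifold R n.+1}.
Hypothesis n_gt0 : (0 < n)%N.
Variables (gbar g : tensor2 M) (Omega V W : set M) (f : M -> R).
Hypothesis mgbar : is_metric [set: M] gbar.
Hypothesis Rbar_le0 : forall p, scalar_curvature gbar p <= 0.
Hypotheses (oO : open Omega) (cO : connected Omega) (cptO : compact (closure Omega)).
Hypotheses (Oproper : Omega `<` [set: M]).
Hypotheses (oV : open V) (oW : open W).
Hypotheses (clV : closure Omega `<=` V) (clW : closure Omega `<=` W).
Hypotheses (mg : is_metric V g) (sf : smooth_fun W f).
Hypothesis gE : forall p, closure Omega p -> forall c, atlas M c -> cdom c p ->
  g c p = expR (2 * f p) *: gbar c p.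

Lemma conformal_factor_eq0 p : closure Omega p -> eq_at g gbar p <-> f p = 0.
Proof.
move=> clp; split=> [gg|f0 c ac cp]; last by rewrite gE// f0 mulr0 expR0 scale1r.
have [ac cp] := chart_atP p; set c := chart_at p in ac cp.
have G0 := posdef_diag ord0 (posdef_metric mgbar ac cp I).
have := gg c ac cp; rewrite gE// => /matrixP/(_ ord0 ord0); rewrite scalemxE => E.
have : expR (2 * f p) = expR 0.
  by rewrite expR0; apply: (mulIf (lt0r_neq0 G0)); rewrite E mul1r.
by move=> /expR_inj /eqP; rewrite mulf_eq0 pnatr_eq0 /= => /eqP.
Qed.

Hypothesis f_boundary : forall p, boundary Omega p -> f p = 0.
Variable s : R.
Hypothesis s1 : s = 1 \/ s = -1.
Hypothesis Rs : forall p, Omega p -> s * scalar_curvature gbar p <= s * scalar_curvature g p.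

Let OV : Omega `<=` V. Proof. by move=> p /subset_closure /clV. Qed.

Let gE' p : Omega p -> forall c, atlas M c -> cdom c p ->
  g c p = expR (2 * f p) *: gbar c p.
Proof. by move=> /subset_closure; exact: gE. Qed.

Let s_neq0 : s != 0. Proof. by case: s1 => ->; rewrite ?oppr_eq0 oner_eq0. Qed.

Lemma conformal_factor_sign p : closure Omega p -> 0 <= s * f p.
Proof.
exact: (signed_factor_ge0 n_gt0 mgbar Rbar_le0 oO oV oW OV clW mg sf gE' s1 Rs
  f_boundary cO cptO Oproper).
Qed.

Hypothesis smO : smooth_boundary Omega.

Let u_ge0 p : Omega p -> 0 <= s * f p.
Proof. by move=> /subset_closure; exact: conformal_factor_sign. Qed.

Let phi p := mean_curvature Omega gbar p - mean_curvature Omega g p.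

Let phiE c p : atlas M c -> cdom c p -> boundary Omega p ->
  s * phi p = n%:R * Num.sqrt (gradient_sqnorm gbar f c (cmap c p)).
Proof.
exact: (mean_curvature_difference mgbar oV oW clV clW mg sf gE f_boundary oO s1 u_ge0 smO).
Qed.

Let phi_ge0 p : boundary Omega p -> 0 <= s * phi p.
Proof.
move=> bp; have [ac cp] := chart_atP p.
by rewrite (phiE ac cp bp) mulr_ge0 ?sqrtr_ge0.
Qed.

Lemma signed_mass_ge0 : (0 <= s%:E * brown_york_mass Omega gbar g)%E.
Proof. exact: (boundary_integral_sign gbar smO cptO s1 phi_ge0). Qed.

Lemma mass_eq0 : brown_york_mass Omega gbar g = 0%E <-> eq_on Omega g gbar.
Proof.
split=> [mass0|gg].
  have [f0|u0] := signed_factor_dichotomy n_gt0 mgbar Rbar_le0 oO oV oW OV clW mg sf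
    gE' s1 Rs f_boundary cO cptO Oproper.
    move=> p Op; apply/conformal_factor_eq0; first exact: subset_closure.
    by apply/eqP; have /eqP := f0 p Op; rewrite mulf_eq0 (negbTE s_neq0).
  move=> p Op; exfalso; move: mass0.
  apply: (boundary_integral_neq0 mgbar oO smO cptO s1 phi_ge0).
    by apply: boundary_nonempty => //; [exact: manifold_connected|exists p].
  move=> c adc; have [ac _] := adc.
  (* In the chart [c] this expression is continuous and equals the signed integrand on the boundary.
     Its positivity reduces to a nonzero normal derivative, which Hopf's lemma provides. *)
  exists (fun x => n%:R * Num.sqrt (gradient_sqnorm gbar f c x)) => q bq cq.
  have Wq : chart_image c W (cmap c q) by exists q => //; split => //; apply: clW; case: bq.
  have oU : open (chart_image c W) by exact: open_chart_image.
  split; last by rewrite (phiE ac cq bq).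
    apply: (@continuousM _ _ (fun=> n%:R)); first exact: cst_continuous.
    apply: (@continuous_comp _ _ _ (gradient_sqnorm gbar f c) Num.sqrt); last exact: sqrt_continuous.
    exact: smooth_continuous (smooth_gradient_sqnorm mgbar oW sf ac) Wq.
  rewrite mulr_gt0 ?ltr0n// sqrtr_gt0.
  rewrite (gradient_sqnorm_boundary gbar oW clW sf f_boundary oO adc cq bq).
  apply: mulr_gt0.
    apply/posdef_diag/posdef_inv; rewrite /in_chart (cmapK ac cq).
    exact: (posdef_metric mgbar ac cq I).
  rewrite lt_neqAle sqr_ge0 andbT eq_sym sqrf_eq0; apply/eqP => d0.
  have := boundary_derivative n_gt0 mgbar Rbar_le0 oO oV oW OV clW mg sf
    gE' s1 Rs f_boundary adc cq bq u0.
  rewrite pdZ; first by rewrite d0 mulr0 ltxx.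
  exact: (smooth_differentiable (sf ac) Wq).
apply: (boundary_integral0 gbar smO cptO) => p bp.
have [ade ep] := adapted_atP smO bp; have [ae eO] := ade.
have clp : closure Omega p by case: bp.
apply: (mulfI s_neq0); rewrite mulr0 (phiE ae ep bp).
rewrite (gradient_sqnorm_boundary gbar oW clW sf f_boundary oO ade ep bp).
have Wx : chart_image (adapted_at Omega p) W (cmap (adapted_at Omega p) p).
  by exists p => //; split => //; exact: clW.
(* Nothing is known about f outside the closure of Omega, but its vanishing on the closed half-space
   already determines the normal derivative. *)
rewrite (pd_eq0_halfspace ord0 (open_chart_image ae oW) Wx).
- by rewrite expr0n mulr0 sqrtr0 mulr0.
- exact: (smooth_differentiable (sf ae) Wx).
- by rewrite ((boundary_adapted oO ade ep).1 bp).
- move=> y [q [eq Wq] <-]; rewrite /= (cmapK ae eq) le_eqVlt => /orP[/eqP y0|y0].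
    by apply: f_boundary; apply/(boundary_adapted oO ade eq).
  have Oq : Omega q by apply/(eO q eq).
  by apply/conformal_factor_eq0; [exact: subset_closure|exact: gg].
Qed.

End ConformalRigidity.

Unset Implicit Arguments.
Set Strict Implicit.

Theorem corollary1p7 (R : realType) (n : nat) (hn : (2 <= n.+1)%N)
    (M : manifold R n.+1) (gbar : tensor2 M)
    (hgbar : is_metric [set: M] gbar)
    (hRbar : forall p, scalar_curvature gbar p <= 0)
    (Omega : set M) (hopen : open Omega) (hconn : connected Omega)
    (hproper : Omega `<` [set: M]) (hcompact : compact (closure Omega))
    (hsmooth : smooth_boundary Omega) :
  (forall (V : set M) (g : tensor2 M),
     open V -> closure Omega `<=` V -> is_metric V g ->
     conformal_on (closure Omega) gbar g ->
     eq_on (boundary Omega) g gbar ->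
     ((forall p, Omega p -> scalar_curvature gbar p <= scalar_curvature g p) ->
      (0 <= brown_york_mass Omega gbar g)%E /\
      (brown_york_mass Omega gbar g = 0%E <-> eq_on Omega g gbar)) /\
     ((forall p, Omega p -> scalar_curvature g p <= scalar_curvature gbar p) ->
      (brown_york_mass Omega gbar g <= 0)%E /\
      (brown_york_mass Omega gbar g = 0%E <-> eq_on Omega g gbar))) /\
  (forall g : tensor2 M, is_metric [set: M] g ->
     ([/\ forall p, scalar_curvature g p = scalar_curvature gbar p,
          conformal_on [set: M] gbar g &
          tensor_supp g gbar `<=` Omega] <->
      eq_on [set: M] g gbar)).
Proof.
have n_gt0 : (0 < n)%N by [].
split=> [V g oV clV mg [W [f [oW clW sf gE]]] eqb|g mg].
  have f_boundary p : boundary Omega p -> f p = 0.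
    move=> bp; have clp : closure Omega p by case: bp.
    by apply/(conformal_factor_eq0 hgbar gE clp); exact: eqb.
  split=> Rg.
    have Rs p : Omega p -> 1 * scalar_curvature gbar p <= 1 * scalar_curvature g p.
      by rewrite !mul1r; exact: Rg.
    have s1 : (1 : R) = 1 \/ (1 : R) = -1 by left.
    split; last exact: (mass_eq0 n_gt0 hgbar hRbar hopen hconn hcompact hproper oV oW clV clW mg sf gE f_boundary s1 Rs hsmooth).
    have := signed_mass_ge0 n_gt0 hgbar hRbar hopen hconn hcompact hproper oV oW clV clW mg sf gE f_boundary s1 Rs hsmooth.
    by rewrite mul1e.
  have Rs p : Omega p -> -1 * scalar_curvature gbar p <= -1 * scalar_curvature g p.
    by move=> /Rg; rewrite !mulN1r lerN2.
  have s1 : (-1 : R) = 1 \/ (-1 : R) = -1 by right.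
  split; last exact: (mass_eq0 n_gt0 hgbar hRbar hopen hconn hcompact hproper oV oW clV clW mg sf gE f_boundary s1 Rs hsmooth).
  have := signed_mass_ge0 n_gt0 hgbar hRbar hopen hconn hcompact hproper oV oW clV clW mg sf gE f_boundary s1 Rs hsmooth.
  by rewrite EFinN mulN1e oppe_ge0.
split=> [[Rg [W [f [oW WT sf gE]]] supp]|gg].
  have gE' p : closure Omega p -> forall c, atlas M c -> cdom c p ->
    g c p = expR (2 * f p) *: gbar c p by move=> _; exact: gE.
  have clW : closure Omega `<=` W by move=> p _; exact: WT.
  have clT : closure Omega `<=` [set: M] by [].
  have out p : ~ Omega p -> eq_at g gbar p.
    move=> np; apply: contrapT => ne; apply: np; apply: supp.
    exact: subset_closure.
  have f_boundary p : boundary Omega p -> f p = 0.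
    move=> [clp np]; apply/(conformal_factor_eq0 hgbar gE' clp); apply: out.
    by move=> Op; apply: np; exact: open_nbhs_nbhs.
  move=> p _; have [Op|/out//] := pselect (Omega p).
  have clp : closure Omega p by exact: subset_closure.
  apply/(conformal_factor_eq0 hgbar gE' clp); apply/eqP.
  have Rs s q : Omega q -> s * scalar_curvature gbar q <= s * scalar_curvature g q.
    by rewrite Rg.
  have := conformal_factor_sign n_gt0 hgbar hRbar hopen hconn hcompact hproper openT oW clT clW mg sf gE' f_boundary (or_introl erefl) (Rs 1) clp.
  have := conformal_factor_sign n_gt0 hgbar hRbar hopen hconn hcompact hproper openT oW clT clW mg sf gE' f_boundary (or_intror erefl) (Rs (-1)) clp.
  by rewrite mul1r mulN1r oppr_ge0 eq_le => -> ->.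
split.
- move=> p; have [ac cp] := chart_atP p.
  (* The relation [eq_on] compares components in charts of the atlas at points of their domains
     only, so the tensors need not be equal as functions; locality of the scalar curvature is used
     instead. *)
  apply: (eq_scalar (O := chart_image (chart_at p) [set: M])).
  + by apply: open_chart_image => //; exact: openT.
  + by move=> x [q [cq _] <-]; rewrite /in_chart cmapK//; apply: gg.
  + by exists p.
- exists [set: M], (fun=> 0); split => //; first exact: openT.
    by move=> c ac; exact: smooth_cst.
  by move=> p _ c ac cp; rewrite mulr0 expR0 scale1r; exact: gg.
- rewrite /tensor_supp (_ : [set p | _] = set0) ?closure0//.
  by apply/seteqP; split=> // p /= []; exact: gg.
Qed.
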